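(* For every integer $n\ge 0$, the functors $L^2_n$ and $D^2_n$ are simple artinian of type $2$.
   Context: $\mathcal{E}$ is the category of $\mathbb{F}_2$-vector spaces, $\mathcal{E}^f$ its full subcategory of finite-dimensional spaces, $\mathcal{F}$ the (abelian) category of functors $\mathcal{E}^f\to\mathcal{E}$, with pointwise tensor product $\otimes$ over $\mathbb{F}_2$; $\Lambda^n$ is the $n$-th exterior power functor. The duality $D:\mathcal{F}^{op}\to\mathcal{F}$ is $DF(V)=F(V^* )^*$; it commutes with tensor products and exterior powers of functors with finite-dimensional values, and exterior powers $\Lambda^n$ and $\Lambda^n(\Lambda^3)$ are identified with their duals. $\bar P$ is the functor $V\mapsto \mathbb{F}_2[V]/\mathbb{F}_2\cdot[0]$, where $\mathbb{F}_2[V]$ has basis $([v])_{v\in V}$ (so $[0]=0$ in $\bar P(V)$), and $\bar I=D\bar P$. The endomorphism $\Pi$ of $\Lambda^2(\bar P)$ given by $[u]\wedge[v]\mapsto([u]+[v])\wedge[u+v]$ ($u,v\in V\setminus\{0\}$) is idempotent; put $P_{2,1}=\mathrm{im}\,\Pi$, $\bar G(2)=\ker\Pi$, $L(2)=DP_{2,1}$, $\bar D(2)=D\bar G(2)$, so $\Lambda^2(\bar P)\simeq P_{2,1}\oplus\bar G(2)$ and $\Lambda^2(\bar I)\simeq L(2)\oplus\bar D(2)$. For $n\ge 1$ let $g_n:\Lambda^2(\bar P)\otimes\Lambda^n\to\Lambda^2(\bar P)\otimes\Lambda^n(\Lambda^3)$ be given by $([u]\wedge[v])\otimes(a_1\wedge\dots\wedge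 a_n)\mapsto([u]\wedge[v])\otimes\bigwedge_{1\le i\le n}(u\wedge v\wedge a_i)$. It commutes with $\Pi$ (tensored with identities), hence is the direct sum of morphisms $g^L_n:P_{2,1}\otimes\Lambda^n\to P_{2,1}\otimes\Lambda^n(\Lambda^3)$ and $g^D_n:\bar G(2)\otimes\Lambda^n\to\bar G(2)\otimes\Lambda^n(\Lambda^3)$. Define $L^2_n=\mathrm{im}(Dg^L_n)\subset L(2)\otimes\Lambda^n$ and $D^2_n=\mathrm{im}(Dg^D_n)\subset\bar D(2)\otimes\Lambda^n$ for $n\geq 1$, and $L^2_0=L(2)$, $D^2_0=\bar D(2)$. The notions ''simple artinian of type $m$'' and ''artinian of type $m$'' are defined by induction on $m\in\mathbb{N}$: a simple artinian functor of type $0$ is a simple functor; a simple artinian functor of type $m+1$ is a functor that is not artinian of type $m$ but all of whose strict subobjects are artinian of type $m$; an artinian functor of type $m$ is a functor having a finite filtration whose subquotients are simple artinian of types $\le m$. *)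

(* Defs.v *)
From HB Require Import structures.
From mathcomp Require Import all_boot all_algebra.
From mathcomp Require Import boolp functions.
From mathcomp Require Import generic_quotient ring_quotient freeg.

Set Implicit Arguments.
Unset Strict Implicit.
Unset Printing Implicit Defensive.

Import GRing.Theory.
Local Open Scope ring_scope.
Local Open Scope quotient_scope.

(* mklin bundles a function together with a proof of linearity. *)
Section LinearOf.
Variables (R : pzRingType) (M N : lmodType R).

Definition linear_of (f : M -> N) (lf : linear f) : M -> N := f.

HB.instance Definition _ f lf :=
  GRing.isLinear.Build R M N *:%R (@linear_of f lf) lf.

Definition mklin f lf : {linear M -> N} := @linear_of f lf.

Lemma mklinE f lf x : @mklin f lf x = f x. Proof. by []. Qed.
End LinearOf.

Section Submodules.
Variables (R : comNzRingType) (M : lmodType R).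

(* The span of S is the intersection of all submodules containing S. *)
Definition span_pred (S : M -> Prop) : {pred M} :=
  fun x => `[< forall U : submodClosed M,
                 (forall y, S y -> y \in U) -> x \in U >].

Lemma span_pred_submod S : submod_closed (span_pred S).
Proof.
split; first by apply/asboolP => U _; exact: rpred0.
move=> a u v /asboolP Su /asboolP Sv; apply/asboolP => U SU.
by rewrite rpredD ?rpredZ // ?Su ?Sv.
Qed.

HB.instance Definition _ S :=
  GRing.isSubmodClosed.Build R M (span_pred S) (span_pred_submod S).

Definition span_of S : submodClosed M := span_pred S.

Lemma mem_span_of (S : M -> Prop) x : S x -> x \in span_of S.
Proof. by move=> Sx; apply/asboolP => U; exact. Qed.

Definition submod_type (U : submodClosed M) := {x : M | x \in U}.
HB.instance Definition _ (U : submodClosed M) := SubChoice.on (submod_type U).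
HB.instance Definition _ (U : submodClosed M) :=
  [SubChoice_isSubLmodule of submod_type U by <:].

Definition zmod_pred (U : submodClosed M) : {pred M} := fun x => x \in U.

Lemma zmod_predP U : zmod_closed (zmod_pred U).
Proof. exact: GRing.submod_closedB (GRing.submodClosedP U). Qed.

HB.instance Definition _ U :=
  GRing.isZmodClosed.Build M (zmod_pred U) (zmod_predP U).

Definition quotmod (U : submodClosed M) := {ideal_quot zmod_pred U}.
HB.instance Definition _ U := GRing.Zmodule.on (quotmod U).

Variable U : submodClosed M.

Definition quotproj (x : M) : quotmod U := \pi_({ideal_quot zmod_pred U}) x.

Lemma quotproj_eq x y : (quotproj x = quotproj y) <-> (x - y \in U).
Proof.
rewrite -[_ \in U]/(x - y \in zmod_pred U) Quotient.idealrBE.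
by split=> [/eqP|/eqP].
Qed.

Lemma quotprojB : {morph quotproj : x y / x - y}.
Proof. by move=> x y; rewrite /quotproj raddfB. Qed.
Lemma quotprojD : {morph quotproj : x y / x + y}.
Proof. by move=> x y; rewrite /quotproj raddfD. Qed.

Definition quot_repr (q : quotmod U) : M := repr (q : {ideal_quot zmod_pred U}).
Lemma quot_reprK q : quotproj (quot_repr q) = q.
Proof. exact: reprK. Qed.

Definition quot_scale (a : R) (q : quotmod U) : quotmod U :=
  quotproj (a *: quot_repr q).

Lemma quot_scaleE a x : quot_scale a (quotproj x) = quotproj (a *: x).
Proof.
apply/quotproj_eq; rewrite -scalerBr rpredZ //.
by apply/quotproj_eq; rewrite quot_reprK.
Qed.

Lemma quot_scaleA a b q : quot_scale a (quot_scale b q) = quot_scale (a * b) q.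
Proof. by rewrite -[q]quot_reprK !quot_scaleE scalerA. Qed.
Lemma quot_scale1 : left_id 1 quot_scale.
Proof. by move=> q; rewrite -[q]quot_reprK !quot_scaleE scale1r. Qed.
Lemma quot_scaleDr : right_distributive quot_scale +%R.
Proof.
move=> a p q; rewrite -[q]quot_reprK -[p]quot_reprK -quotprojD !quot_scaleE.
by rewrite -quotprojD scalerDr.
Qed.
Lemma quot_scaleDl q : {morph quot_scale^~ q : a b / a + b}.
Proof.
by move=> a b; rewrite -[q]quot_reprK !quot_scaleE -quotprojD scalerDl.
Qed.

HB.instance Definition _ := GRing.Zmodule_isLmodule.Build R (quotmod U)
  quot_scaleA quot_scale1 quot_scaleDr quot_scaleDl.

Lemma quotproj_linear : linear quotproj.
Proof. by move=> a x y; rewrite quotprojD -quot_scaleE. Qed.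

HB.instance Definition _ :=
  GRing.isLinear.Build R M (quotmod U) *:%R quotproj quotproj_linear.

Lemma quot_ind (P : quotmod U -> Prop) :
  (forall x, P (quotproj x)) -> forall q, P q.
Proof. by move=> Px q; rewrite -[q]quot_reprK. Qed.

Section Lift.
Variables (N : lmodType R) (f : {linear M -> N}).
Hypothesis f0 : forall x, x \in U -> f x = 0.

Lemma quot_lift_eq x : f (quot_repr (quotproj x)) = f x.
Proof.
apply/eqP; rewrite -subr_eq0 -linearB; apply/eqP/f0/quotproj_eq.
by rewrite quot_reprK.
Qed.

Lemma quot_lift_linear : linear (fun q : quotmod U => f (quot_repr q)).
Proof.
move=> a p q; rewrite -[p]quot_reprK -[q]quot_reprK -quotproj_linear.
by rewrite !quot_lift_eq linearP.
Qed.

Definition quot_lift : {linear quotmod U -> N} := mklin quot_lift_linear.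

Lemma quot_liftE x : quot_lift (quotproj x) = f x.
Proof. exact: quot_lift_eq. Qed.
End Lift.

End Submodules.

(* The module with generators X and relations rel: the quotient of the free
   module on X by the span of rel.  Tensor products, exterior powers and
   k[V]/k.[0] are all obtained in this way. *)
Section Presented.
Variables (R : comNzRingType) (X : choiceType).
Variable rel : {freeg X / R} -> Prop.

Definition presented := quotmod (span_of rel).
HB.instance Definition _ := GRing.Lmodule.on presented.

Definition gen (x : X) : presented := quotproj _ << 1 *g x >>.

Section Lift.
Variables (N : lmodType R) (f : X -> N).

Lemma fglift_linear : linear (fun D : {freeg X / R} => fglift f D).
Proof.
have Z c D : fglift f (c *: D) = c *: fglift f D.
  elim/freeg_ind_dom0: D => [|k x D _ _ IH].
    by rewrite scaler0 -[0]/(0 : {freeg X / R}) -(subrr 0) lift_is_additive subrr scaler0.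
  have DD D1 D2 : fglift f (D1 + D2) = fglift f D1 + fglift f D2.
    rewrite -[D2 in LHS]opprK lift_is_additive -[- D2]sub0r lift_is_additive.
    by rewrite -[0]/(0 : {freeg X / R}) -(subrr 0) lift_is_additive !subrr sub0r opprK.
  rewrite scalerDr !DD IH scalerDr liftU scalerA -(liftU f (c * k)).
  by congr (fglift f _ + _); apply/eqP/freeg_eqP=> y; rewrite coeffZ !coeffU mulrA.
move=> c D E; rewrite -Z -[E in LHS]opprK lift_is_additive -[- E]sub0r.
rewrite lift_is_additive.
by rewrite -[0]/(0 : {freeg X / R}) -(subrr 0) lift_is_additive !subrr sub0r opprK.
Qed.

Definition free_lift : {linear {freeg X / R} -> N} := mklin fglift_linear.

Lemma free_liftE x : free_lift << 1 *g x >> = f x.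
Proof. by rewrite /= /linear_of liftU scale1r. Qed.

Lemma free_lift_rel : (forall r, rel r -> free_lift r = 0) ->
  forall x, x \in span_of rel -> free_lift x = 0.
Proof.
move=> frel x /asboolP sx.
pose K : {pred {freeg X / R}} := fun y => free_lift y == 0.
have KS : submod_closed K.
  split; first by rewrite unfold_in linear0.
  by move=> a u v /eqP u0 /eqP v0; rewrite unfold_in linearP u0 v0 scaler0 addr0.
pose KU : submodClosed {freeg X / R} :=
  HB.pack K (GRing.isSubmodClosed.Build R {freeg X / R} K KS).
by apply/eqP/(sx KU) => y /frel fy; exact/eqP.
Qed.

Hypothesis frel : forall r, rel r -> free_lift r = 0.

Definition pres_lift : {linear presented -> N} :=
  quot_lift (free_lift_rel frel).

Lemma pres_liftE x : pres_lift (gen x) = f x.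
Proof. by rewrite [LHS]quot_liftE free_liftE. Qed.
End Lift.

Lemma pres_ind (P : presented -> Prop) :
    P 0 -> (forall c x p, P p -> P (c *: gen x + p)) -> forall p, P p.
Proof.
move=> P0 PS; apply: quot_ind => D.
elim/freeg_ind_dom0: D => [|k x D _ _ IH]; first by rewrite linear0.
have -> : << k *g x >> = k *: << 1 *g x >> :> {freeg X / R}.
  by apply/eqP/freeg_eqP=> y; rewrite coeffZ !coeffU mul1r.
by rewrite linearP; exact: PS.
Qed.

Lemma pres_ext (N : lmodType R) (f g : {linear presented -> N}) :
  (forall x, f (gen x) = g (gen x)) -> f =1 g.
Proof.
move=> fg; apply: pres_ind => [|c x p IH]; first by rewrite !linear0.
by rewrite !linearP fg IH.
Qed.
End Presented.

Section Tensor.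
Variables (R : comNzRingType) (M N : lmodType R).

Inductive tensor_rel : {freeg (M * N) / R} -> Prop :=
| TensorRelL c x x' y :
    tensor_rel (<< 1 *g (c *: x + x', y) >>
                - c *: << 1 *g (x, y) >> - << 1 *g (x', y) >>)
| TensorRelR c x y y' :
    tensor_rel (<< 1 *g (x, c *: y + y') >>
                - c *: << 1 *g (x, y) >> - << 1 *g (x, y') >>).

Definition tensor := presented tensor_rel.
HB.instance Definition _ := GRing.Lmodule.on tensor.

Definition tens (x : M) (y : N) : tensor := gen tensor_rel (x, y).

Lemma tens_linl y : linear (tens^~ y).
Proof.
move=> c x x'; apply/eqP; rewrite -subr_eq0 opprD addrA; apply/eqP.
rewrite /tens /gen -!linearZ -!linearB -[0](linear0 (quotproj _)).
by apply/quotproj_eq; rewrite subr0; apply/mem_span_of/TensorRelL.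
Qed.

Lemma tens_linr x : linear (tens x).
Proof.
move=> c y y'; apply/eqP; rewrite -subr_eq0 opprD addrA; apply/eqP.
rewrite /tens /gen -!linearZ -!linearB -[0](linear0 (quotproj _)).
by apply/quotproj_eq; rewrite subr0; apply/mem_span_of/TensorRelR.
Qed.

Lemma tensDl x x' y : tens (x + x') y = tens x y + tens x' y.
Proof. exact: (linearD (mklin (tens_linl y))). Qed.
Lemma tens0l y : tens 0 y = 0.
Proof. exact: (linear0 (mklin (tens_linl y))). Qed.

Section Lift.
Variables (P : lmodType R) (f : M -> N -> P).
Hypotheses (fl : forall y, linear (f^~ y)) (fr : forall x, linear (f x)).

Lemma tensor_lift_rel r : tensor_rel r ->
  free_lift (fun p : M * N => f p.1 p.2) r = 0.
Proof.
case=> [c x x' y|c x y y']; rewrite !linearB linearZ !free_liftE /=.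
  by rewrite (fl y) addrAC addrK subrr.
by rewrite (fr x) addrAC addrK subrr.
Qed.

Definition tensor_lift : {linear tensor -> P} := pres_lift tensor_lift_rel.

Lemma tensor_liftE x y : tensor_lift (tens x y) = f x y.
Proof. exact: pres_liftE. Qed.
End Lift.

Lemma tensor_ext (P : lmodType R) (f g : {linear tensor -> P}) :
  (forall x y, f (tens x y) = g (tens x y)) -> f =1 g.
Proof. by move=> fg; apply: pres_ext => -[x y]; exact: fg. Qed.

End Tensor.

Section TensorMap.
Variables (R : comNzRingType) (M M' N N' : lmodType R).
Variables (f : {linear M -> M'}) (g : {linear N -> N'}).

Lemma tensor_map_linl y : linear (fun x => tens (f x) (g y)).
Proof. by move=> c x x'; rewrite linearP tens_linl. Qed.
Lemma tensor_map_linr x : linear (fun y => tens (f x) (g y)).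
Proof. by move=> c y y'; rewrite linearP tens_linr. Qed.

Definition tensor_map : {linear tensor M N -> tensor M' N'} :=
  tensor_lift tensor_map_linl tensor_map_linr.

Lemma tensor_mapE x y : tensor_map (tens x y) = tens (f x) (g y).
Proof. exact: tensor_liftE. Qed.
End TensorMap.

Section TupleSet.
Variables (T : Type) (n : nat).

(* The tuple t with its i-th entry replaced by x. *)
Definition tset (t : n.-tuple T) (i : 'I_n) (x : T) : n.-tuple T :=
  [tuple if j == i then x else tnth t j | j < n].

Lemma tnth_tset t i x j : tnth (tset t i x) j = if j == i then x else tnth t j.
Proof. exact: tnth_mktuple. Qed.
End TupleSet.

Lemma map_tset (T T' : Type) n (f : T -> T') (t : n.-tuple T) i x :
  map_tuple f (tset t i x) = tset (map_tuple f t) i (f x).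
Proof.
apply: eq_from_tnth => j; rewrite tnth_map !tnth_tset tnth_map.
by case: (j == i).
Qed.

Section Exterior.
Variables (R : comNzRingType) (n : nat) (M : lmodType R).

(* The relations of the n-th exterior power: multilinearity in each slot, and
   vanishing on tuples with a repeated entry (not mere antisymmetry, which is
   weaker in characteristic 2). *)
Inductive ext_rel : {freeg (n.-tuple M) / R} -> Prop :=
| ExtRelLin t i c x y :
    ext_rel (<< 1 *g tset t i (c *: x + y) >>
             - c *: << 1 *g tset t i x >> - << 1 *g tset t i y >>)
| ExtRelAlt t i j : i != j -> tnth t i = tnth t j -> ext_rel << 1 *g t >>.

Definition ext := presented ext_rel.
HB.instance Definition _ := GRing.Lmodule.on ext.

Definition wedge (t : n.-tuple M) : ext := gen ext_rel t.

Definition multilinear (N : lmodType R) (f : n.-tuple M -> N) :=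
  forall t i, linear (fun x => f (tset t i x)).
Definition alternating (N : lmodType R) (f : n.-tuple M -> N) :=
  forall t i j, i != j -> tnth t i = tnth t j -> f t = 0.

Lemma wedge_multilinear : multilinear wedge.
Proof.
move=> t i c x y; apply/eqP; rewrite -subr_eq0 opprD addrA; apply/eqP.
rewrite /wedge /gen -!linearZ -!linearB -[0](linear0 (quotproj _)).
by apply/quotproj_eq; rewrite subr0; apply/mem_span_of/ExtRelLin.
Qed.

Lemma wedge_alternating : alternating wedge.
Proof.
move=> t i j ij tij; rewrite /wedge /gen -[RHS](linear0 (quotproj _)).
by apply/quotproj_eq; rewrite subr0; apply: mem_span_of; exact: ExtRelAlt tij.
Qed.

Section Lift.
Variables (N : lmodType R) (f : n.-tuple M -> N).
Hypotheses (fm : multilinear f) (fa : alternating f).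

Lemma ext_lift_rel r : ext_rel r -> free_lift f r = 0.
Proof.
case=> [t i c x y|t i j ij tij]; last by rewrite free_liftE (fa ij).
by rewrite !linearB linearZ !free_liftE fm addrAC addrK subrr.
Qed.

Definition ext_lift : {linear ext -> N} := pres_lift ext_lift_rel.

Lemma ext_liftE t : ext_lift (wedge t) = f t.
Proof. exact: pres_liftE. Qed.
End Lift.

Lemma ext_ext (N : lmodType R) (f g : {linear ext -> N}) :
  (forall t, f (wedge t) = g (wedge t)) -> f =1 g.
Proof. exact: pres_ext. Qed.

End Exterior.

Section ExteriorMap.
Variables (R : comNzRingType) (n : nat) (M N : lmodType R).
Variables (f : {linear M -> N}).

Lemma ext_map_multilinear :
  multilinear (fun t : n.-tuple M => wedge (map_tuple f t)).
Proof. by move=> t i c x y; rewrite !map_tset linearP wedge_multilinear. Qed.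

Lemma ext_map_alternating :
  alternating (fun t : n.-tuple M => wedge (map_tuple f t)).
Proof.
move=> t i j ij tij; apply: (wedge_alternating ij).
by rewrite !tnth_map tij.
Qed.

Definition ext_map : {linear ext n M -> ext n N} :=
  ext_lift ext_map_multilinear ext_map_alternating.

Lemma ext_mapE t : ext_map (wedge t) = wedge (map_tuple f t).
Proof. exact: ext_liftE. Qed.
End ExteriorMap.

Section Dual.
Variables (R : comNzRingType) (M : lmodType R).

(* The full algebraic dual, as the submodule of linear functions M -> R. *)
Definition linear_pred : {pred M -> R^o} := fun f => `[< linear f >].

Lemma linear_pred_submod : submod_closed linear_pred.
Proof.
split; first by apply/asboolP => a x y; rewrite scaler0 addr0.
move=> a f g /asboolP lf /asboolP lg; apply/asboolP => b x y.
rewrite /GRing.add /= /GRing.scale /= lf lg.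
rewrite -![_ *: _]/(_ * _) mulrDr addrACA mulrDr; congr (_ + _ + _).
by rewrite mulrCA.
Qed.

HB.instance Definition _ :=
  GRing.isSubmodClosed.Build R (M -> R^o) linear_pred linear_pred_submod.

Definition dual := submod_type (linear_pred : submodClosed _).
HB.instance Definition _ := GRing.Lmodule.on dual.

Definition dual_app (f : dual) : {linear M -> R^o} :=
  mklin (asboolW (valP f)).

Definition mkdual (f : {linear M -> R^o}) : dual :=
  exist _ (f : M -> R^o) (asboolT (@linearP _ _ _ _ f)).

Lemma mkdualE f x : dual_app (mkdual f) x = f x. Proof. by []. Qed.

Lemma dualP (f g : dual) : (forall x, dual_app f x = dual_app g x) -> f = g.
Proof. by move=> fg; apply/val_inj/funext. Qed.
End Dual.

Section DualMap.
Variables (R : comNzRingType) (M N : lmodType R) (f : {linear M -> N}).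

Lemma dual_map_subproof (phi : dual N) : linear (fun x => dual_app phi (f x)).
Proof. by move=> a x y; rewrite !linearP. Qed.

Definition dual_map_fun (phi : dual N) : dual M :=
  mkdual (mklin (dual_map_subproof phi)).

Lemma dual_map_linear : linear dual_map_fun.
Proof. by move=> a phi psi; apply: dualP. Qed.

Definition dual_map : {linear dual N -> dual M} := mklin dual_map_linear.

Lemma dual_mapE phi x : dual_app (dual_map phi) x = dual_app phi (f x).
Proof. by []. Qed.
End DualMap.

Section Functors.
Variable k : fieldType.

(* Functors from finite-dimensional k-vector spaces (with 'Hom(V, W) as
   morphisms) to arbitrary k-vector spaces. *)
Record functor := Functor {
  fobj :> vectType k -> lmodType k;
  fmap : forall V W : vectType k, 'Hom(V, W) -> {linear fobj V -> fobj W};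
  fmap_id : forall (V : vectType k) (x : fobj V), fmap \1%VF x = x;
  fmap_comp : forall (U V W : vectType k) (g : 'Hom(V, W)) (f : 'Hom(U, V)) x,
    fmap (g \o f)%VF x = fmap g (fmap f x)
}.
Arguments fmap F {V W} f : rename.

Record ntrans (F G : functor) := NTrans {
  ntapp :> forall V : vectType k, {linear F V -> G V};
  ntrans_nat : forall (V W : vectType k) (f : 'Hom(V, W)) x,
    ntapp W (fmap F f x) = fmap G f (ntapp V x)
}.

Record subfunctor (F : functor) := SubFunctor {
  subf_at :> forall V : vectType k, submodClosed (F V);
  subf_map : forall (V W : vectType k) (f : 'Hom(V, W)) x,
    x \in subf_at V -> fmap F f x \in subf_at W
}.

Section SubQuotient.
Variables (F : functor) (U : subfunctor F).

Section SubMap.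
Variables (V W : vectType k) (f : 'Hom(V, W)).
Definition sub_map_fun (x : submod_type (U V)) : submod_type (U W) :=
  exist _ (fmap F f (val x)) (subf_map f (valP x)).
Lemma sub_map_linear : linear sub_map_fun.
Proof. by move=> a x y; apply: val_inj; rewrite /= !linearP. Qed.
Definition sub_map : {linear submod_type (U V) -> submod_type (U W)} :=
  mklin sub_map_linear.
Lemma quot_map_subproof (x : F V) : x \in U V ->
  (quotproj (U W) \o fmap F f) x = 0.
Proof.
move=> Ux; rewrite -[RHS](linear0 (quotproj (U W))).
by apply/quotproj_eq; rewrite subr0 subf_map.
Qed.
Definition quot_map : {linear quotmod (U V) -> quotmod (U W)} :=
  quot_lift quot_map_subproof.
Lemma quot_mapE x : quot_map (quotproj _ x) = quotproj _ (fmap F f x).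
Proof. exact: quot_liftE. Qed.
End SubMap.

Lemma sub_map_id (V : vectType k) x : sub_map (\1%VF : 'End(V)) x = x.
Proof. by apply: val_inj; exact: fmap_id. Qed.
Lemma sub_map_comp (V V' W : vectType k) (g : 'Hom(V', W)) (f : 'Hom(V, V')) x :
  sub_map (g \o f)%VF x = sub_map g (sub_map f x).
Proof. by apply: val_inj; exact: fmap_comp. Qed.
Definition subF : functor := Functor sub_map_id sub_map_comp.

Lemma quot_map_id (V : vectType k) x : quot_map (\1%VF : 'End(V)) x = x.
Proof. by elim/quot_ind: x => x; rewrite quot_mapE fmap_id. Qed.
Lemma quot_map_comp (V V' W : vectType k) (g : 'Hom(V', W)) (f : 'Hom(V, V')) x :
  quot_map (g \o f)%VF x = quot_map g (quot_map f x).
Proof. by elim/quot_ind: x => x; rewrite !quot_mapE fmap_comp. Qed.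
Definition quotF : functor := Functor quot_map_id quot_map_comp.

Lemma sub_incl_linear V : linear (fun x : subF V => val x : F V).
Proof. by []. Qed.
Lemma sub_incl_nat (V W : vectType k) (f : 'Hom(V, W)) x :
  mklin (@sub_incl_linear W) (fmap subF f x)
    = fmap F f (mklin (@sub_incl_linear V) x).
Proof. by []. Qed.
Definition sub_incl : ntrans subF F := NTrans sub_incl_nat.

Lemma sub_corestr_linear G (phi : ntrans G F)
    (phiU : forall V x, phi V x \in U V) V :
  linear (fun x => exist _ (phi V x) (phiU V x) : subF V).
Proof. by move=> a x y; apply: val_inj; rewrite /= linearP. Qed.
Lemma sub_corestr_nat G (phi : ntrans G F)
    (phiU : forall V x, phi V x \in U V) (V W : vectType k) (f : 'Hom(V, W)) x :
  mklin (@sub_corestr_linear G phi phiU W) (fmap G f x)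
    = fmap subF f (mklin (@sub_corestr_linear G phi phiU V) x).
Proof. by apply: val_inj; exact: ntrans_nat. Qed.
Definition sub_corestr G (phi : ntrans G F)
    (phiU : forall V x, phi V x \in U V) : ntrans G subF :=
  NTrans (sub_corestr_nat phiU).
End SubQuotient.

Section ImageKernel.
Variables (F G : functor) (phi : ntrans F G).

Definition im_pred (V : vectType k) : {pred G V} :=
  fun y => `[< exists x, phi V x = y >].
Arguments im_pred V _ : clear implicits.
Lemma im_pred_submod V : submod_closed (im_pred V).
Proof.
split; first by apply/asboolP; exists 0; rewrite linear0.
move=> a _ _ /asboolP[x <-] /asboolP[y <-]; apply/asboolP.
by exists (a *: x + y); rewrite linearP.
Qed.
HB.instance Definition _ V :=
  GRing.isSubmodClosed.Build k (G V) (im_pred V) (im_pred_submod V).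
Lemma im_pred_map (V W : vectType k) (f : 'Hom(V, W)) x :
  x \in im_pred V -> fmap G f x \in im_pred W.
Proof.
by move=> /asboolP[y <-]; apply/asboolP; exists (fmap F f y); rewrite ntrans_nat.
Qed.
Definition imF : subfunctor G :=
  @SubFunctor G (fun V => im_pred V : submodClosed _) im_pred_map.
Lemma mem_imF V x : phi V x \in imF V.
Proof. by apply/asboolP; exists x. Qed.

Definition ker_pred (V : vectType k) : {pred F V} := fun x => phi V x == 0.
Arguments ker_pred V _ : clear implicits.
Lemma ker_pred_submod V : submod_closed (ker_pred V).
Proof.
split; first by rewrite unfold_in linear0.
by move=> a x y /eqP x0 /eqP y0; rewrite unfold_in linearP x0 y0 scaler0 addr0.
Qed.
HB.instance Definition _ V :=
  GRing.isSubmodClosed.Build k (F V) (ker_pred V) (ker_pred_submod V).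
Lemma ker_pred_map (V W : vectType k) (f : 'Hom(V, W)) x :
  x \in ker_pred V -> fmap F f x \in ker_pred W.
Proof. by move=> /eqP x0; rewrite unfold_in ntrans_nat x0 linear0. Qed.
Definition kerF : subfunctor F :=
  @SubFunctor F (fun V => ker_pred V : submodClosed _) ker_pred_map.
Lemma mem_kerF V x : (x \in kerF V) = (phi V x == 0).
Proof. by []. Qed.
End ImageKernel.

Definition subf_le (F : functor) (U W : subfunctor F) :=
  forall (V : vectType k) (x : F V), x \in U V -> x \in W V.
Definition subf_zero (F : functor) (U : subfunctor F) :=
  forall (V : vectType k) (x : F V), x \in U V -> x = 0.
Definition subf_full (F : functor) (U : subfunctor F) :=
  forall (V : vectType k) (x : F V), x \in U V.

Section SubQuot.
Variables (F : functor) (U W : subfunctor F).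
Definition restr_pred (V : vectType k) : {pred subF W V} :=
  fun x => val x \in U V.
Arguments restr_pred V _ : clear implicits.
Lemma restr_pred_submod V : submod_closed (restr_pred V).
Proof.
split; first by rewrite unfold_in rpred0.
by move=> a x y Ux Uy; rewrite unfold_in rpredD ?rpredZ.
Qed.
HB.instance Definition _ V :=
  GRing.isSubmodClosed.Build k (subF W V) (restr_pred V) (restr_pred_submod V).
Lemma restr_pred_map (V V' : vectType k) (f : 'Hom(V, V')) x :
  x \in restr_pred V -> fmap (subF W) f x \in restr_pred V'.
Proof. exact: subf_map. Qed.
(* U, not assumed to be contained in W, is cut down to the subfunctor U :&: W
   of W; subquotF is then W / (U :&: W), which is W / U when U <= W. *)
Definition subf_restr : subfunctor (subF W) :=
  @SubFunctor (subF W) (fun V => restr_pred V : submodClosed _) restr_pred_map.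
Definition subquotF : functor := quotF subf_restr.
End SubQuot.

Definition is_simple (F : functor) :=
  (exists (V : vectType k) (x : F V), x <> 0) /\
  forall U : subfunctor F, subf_zero U \/ subf_full U.

(* F has a finite filtration 0 = U 0 <= ... <= U l = F with all successive
   quotients satisfying P; l = 0 is allowed, and forces F = 0. *)
Definition filtered_by (P : functor -> Prop) (F : functor) :=
  exists (l : nat) (U : nat -> subfunctor F),
    [/\ subf_zero (U 0), subf_full (U l)
      & forall i, i < l ->
          subf_le (U i) (U i.+1) /\ P (subquotF (U i) (U i.+1))]%N.

(* "Simple artinian of some type j <= m" (see simple_artinian_leP).  It is
   defined first because artinian m, on which simple_artinian m.+1 depends,
   involves all the types up to m. *)
Fixpoint simple_artinian_le (m : nat) (F : functor) : Prop :=
  match m with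
  | 0 => is_simple F
  | m'.+1 =>
      simple_artinian_le m' F \/
      (~ filtered_by (simple_artinian_le m') F /\
       forall U : subfunctor F, ~ subf_full U ->
         filtered_by (simple_artinian_le m') (subF U))
  end.

Definition artinian (m : nat) := filtered_by (simple_artinian_le m).

Definition simple_artinian (m : nat) (F : functor) : Prop :=
  match m with
  | 0 => is_simple F
  | m'.+1 => ~ artinian m' F /\
      forall U : subfunctor F, ~ subf_full U -> artinian m' (subF U)
  end.

Lemma simple_artinian_leP m F :
  simple_artinian_le m F <-> exists2 j, (j <= m)%N & simple_artinian j F.
Proof.
elim: m => [|m IH] /=; first by split=> [?|[[|j] //]]; exists 0%N.
rewrite IH; split=> [[[j jm Fj]|Fm]|[j]].
- by exists j => //; exact: leqW.
- by exists m.+1.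
- rewrite leq_eqVlt => /predU1P[->|jm] Fj; first by right.
  by left; exists j.
Qed.

Section Basic.

Lemma idF_linear (V W : vectType k) (f : 'Hom(V, W)) : linear f.
Proof. exact: linearP. Qed.
Definition idF : functor.
by refine (@Functor (fun V => V) (fun V W f => mklin (idF_linear f)) _ _)
  => [V x|U V W g f x]; rewrite /= /linear_of ?id_lfunE ?comp_lfunE.
Defined.

Variables (F G F' G' : functor).

Lemma tensF_id (V : vectType k) x :
  tensor_map (fmap F (\1%VF : 'End(V))) (fmap G (\1%VF : 'End(V))) x = x.
Proof.
refine (tensor_ext (f := tensor_map _ _) (g := idfun) _ x) => {x} x y.
by rewrite tensor_mapE !fmap_id.
Qed.
Lemma tensF_comp (U V W : vectType k) (g : 'Hom(V, W)) (f : 'Hom(U, V)) x :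
  tensor_map (fmap F (g \o f)%VF) (fmap G (g \o f)%VF) x
  = tensor_map (fmap F g) (fmap G g) (tensor_map (fmap F f) (fmap G f) x).
Proof.
refine (tensor_ext (f := tensor_map _ _)
  (g := tensor_map (fmap F g) (fmap G g) \o tensor_map (fmap F f) (fmap G f)) _ x) => {x} x y.
by rewrite /= !tensor_mapE !fmap_comp.
Qed.
End Basic.
Definition tensF (F G : functor) : functor :=
  Functor (@tensF_id F G) (@tensF_comp F G).

Lemma tensF_ntrans_nat (F F' G G' : functor)
    (phi : ntrans F F') (psi : ntrans G G') (V W : vectType k) (f : 'Hom(V, W)) x :
  tensor_map (phi W) (psi W) (fmap (tensF F G) f x)
  = fmap (tensF F' G') f (tensor_map (phi V) (psi V) x).
Proof.
refine (tensor_ext (f := tensor_map (phi W) (psi W) \o fmap (tensF F G) f)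
  (g := fmap (tensF F' G') f \o tensor_map (phi V) (psi V)) _ x) => {x} x y.
rewrite [LHS](congr1 (tensor_map _ _) (tensor_mapE _ _ x y)).
rewrite [RHS](congr1 (tensor_map _ _) (tensor_mapE _ _ x y)).
by rewrite !tensor_mapE !ntrans_nat.
Qed.
Definition tensF_ntrans (F F' G G' : functor)
    (phi : ntrans F F') (psi : ntrans G G') : ntrans (tensF F G) (tensF F' G') :=
  @NTrans (tensF F G) (tensF F' G') _ (tensF_ntrans_nat phi psi).

Lemma extF_id n (F : functor) (V : vectType k) x :
  ext_map n (fmap F (\1%VF : 'End(V))) x = x.
Proof.
refine (ext_ext (f := ext_map _ _) (g := idfun) _ x) => {x} t.
by rewrite ext_mapE; congr wedge; apply: eq_from_tnth => i;
  rewrite tnth_map fmap_id.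
Qed.
Lemma extF_comp n (F : functor)
    (U V W : vectType k) (g : 'Hom(V, W)) (f : 'Hom(U, V)) x :
  ext_map n (fmap F (g \o f)%VF) x
  = ext_map n (fmap F g) (ext_map n (fmap F f) x).
Proof.
refine (ext_ext (f := ext_map _ _)
  (g := ext_map n (fmap F g) \o ext_map n (fmap F f)) _ x) => {x} t.
rewrite /= !ext_mapE; congr wedge; apply: eq_from_tnth => i.
by rewrite !tnth_map fmap_comp.
Qed.
Definition extF n (F : functor) : functor :=
  Functor (@extF_id n F) (@extF_comp n F).

(* The duality of functors: dualF F sends V to the dual of F (vdual V). *)
Definition vdual (V : vectType k) : vectType k := 'Hom(V, k^o).

Section Transpose.
Variables (V W : vectType k) (f : 'Hom(V, W)).
Lemma vtransp_linear : linear (fun phi : vdual W => (phi \o f)%VF : vdual V).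
Proof.
by move=> a phi psi; apply/lfunP => x; rewrite !lfunE /= !lfunE /= !lfunE.
Qed.
Definition vtransp : 'Hom(vdual W, vdual V) := linfun (mklin vtransp_linear).
Lemma vtranspE phi : vtransp phi = (phi \o f)%VF.
Proof. by rewrite lfunE. Qed.
End Transpose.

Lemma vtransp_id (V : vectType k) : vtransp (\1%VF : 'End(V)) = \1%VF.
Proof. by apply/lfunP => phi; rewrite vtranspE comp_lfun1r id_lfunE. Qed.
Lemma vtransp_comp (U V W : vectType k) (g : 'Hom(V, W)) (f : 'Hom(U, V)) :
  vtransp (g \o f)%VF = (vtransp f \o vtransp g)%VF.
Proof.
by apply/lfunP => phi; rewrite comp_lfunE !vtranspE comp_lfunA.
Qed.

Lemma dualF_id (F : functor) (V : vectType k) (x : dual (F (vdual V))) :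
  dual_map (fmap F (vtransp (\1%VF : 'End(V)))) x = x.
Proof. by apply: dualP => y; rewrite dual_mapE vtransp_id fmap_id. Qed.
Lemma dualF_comp (F : functor)
    (U V W : vectType k) (g : 'Hom(V, W)) (f : 'Hom(U, V)) x :
  dual_map (fmap F (vtransp (g \o f)%VF)) x
  = dual_map (fmap F (vtransp g)) (dual_map (fmap F (vtransp f)) x).
Proof. by apply: dualP => y; rewrite !dual_mapE vtransp_comp fmap_comp. Qed.
Definition dualF (F : functor) : functor :=
  Functor (@dualF_id F) (@dualF_comp F).

Lemma dualF_ntrans_nat (F G : functor) (phi : ntrans F G)
    (V W : vectType k) (f : 'Hom(V, W)) x :
  dual_map (phi (vdual W)) (fmap (dualF G) f x)
  = fmap (dualF F) f (dual_map (phi (vdual V)) x).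
Proof.
apply: dualP => y.
exact: (congr1 (dual_app x) (esym (ntrans_nat phi (vtransp f) y))).
Qed.
Definition dualF_ntrans (F G : functor) (phi : ntrans F G) :
  ntrans (dualF G) (dualF F) :=
  @NTrans (dualF G) (dualF F) _ (dualF_ntrans_nat phi).

Lemma idF_nat (F : functor) (V W : vectType k) (f : 'Hom(V, W)) (x : F V) :
  idfun (fmap F f x) = fmap F f (idfun x).
Proof. by []. Qed.
Definition ntrans_id F : ntrans F F := @NTrans F F (fun V => idfun) (@idF_nat F).

Lemma ntrans_comp_nat (F G H : functor) (psi : ntrans G H) (phi : ntrans F G)
    (V W : vectType k) (f : 'Hom(V, W)) (x : F V) :
  (psi W \o phi W) (fmap F f x) = fmap H f ((psi V \o phi V) x).
Proof. by rewrite /= !ntrans_nat. Qed.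
Definition ntrans_comp (F G H : functor) (psi : ntrans G H) (phi : ntrans F G) :
  ntrans F H := @NTrans F H (fun V => psi V \o phi V) (ntrans_comp_nat psi phi).

(* Pbar V is k[V] / k.[0], where k[V] has basis the elements of V. *)
Section Pbar.
Section Obj.
Variable V : vectType k.
Inductive Pbar_rel : {freeg V / k} -> Prop := PbarRel : Pbar_rel << 1 *g 0 >>.
Definition Pbar_obj := presented Pbar_rel.
HB.instance Definition _ := GRing.Lmodule.on Pbar_obj.
Definition Pbar_gen (v : V) : Pbar_obj := gen Pbar_rel v.
Lemma Pbar_gen0 : Pbar_gen 0 = 0.
Proof.
rewrite /Pbar_gen /gen -[RHS](linear0 (quotproj _)).
by apply/quotproj_eq; rewrite subr0; apply: mem_span_of; exact: PbarRel.
Qed.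
Section Lift.
Variables (N : lmodType k) (f : V -> N).
Hypothesis f0 : f 0 = 0.
Lemma Pbar_lift_rel r : Pbar_rel r -> free_lift f r = 0.
Proof. by case; rewrite free_liftE. Qed.
Definition Pbar_lift : {linear Pbar_obj -> N} := pres_lift Pbar_lift_rel.
Lemma Pbar_liftE v : Pbar_lift (Pbar_gen v) = f v.
Proof. exact: pres_liftE. Qed.
End Lift.
Lemma Pbar_ext (N : lmodType k) (f g : {linear Pbar_obj -> N}) :
  (forall v, f (Pbar_gen v) = g (Pbar_gen v)) -> f =1 g.
Proof. exact: pres_ext. Qed.
Lemma Pbar_ind (P : Pbar_obj -> Prop) :
  P 0 -> (forall c v p, P p -> P (c *: Pbar_gen v + p)) -> forall p, P p.
Proof. exact: pres_ind. Qed.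
End Obj.

Section Map.
Variables (V W : vectType k) (f : 'Hom(V, W)).
Lemma Pbar_map0 : Pbar_gen (f 0) = 0.
Proof. by rewrite linear0 Pbar_gen0. Qed.
Definition Pbar_map : {linear Pbar_obj V -> Pbar_obj W} :=
  Pbar_lift (f := fun v => Pbar_gen (f v)) Pbar_map0.
Lemma Pbar_mapE v : Pbar_map (Pbar_gen v) = Pbar_gen (f v).
Proof. exact: Pbar_liftE. Qed.
End Map.

Lemma Pbar_id (V : vectType k) x : Pbar_map (\1%VF : 'End(V)) x = x.
Proof.
refine (Pbar_ext (f := Pbar_map _) (g := idfun) _ x) => {x} v.
by rewrite Pbar_mapE id_lfunE.
Qed.
Lemma Pbar_comp (U V W : vectType k) (g : 'Hom(V, W)) (f : 'Hom(U, V)) x :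
  Pbar_map (g \o f)%VF x = Pbar_map g (Pbar_map f x).
Proof.
refine (Pbar_ext (f := Pbar_map _) (g := Pbar_map g \o Pbar_map f) _ x) => {x} v.
by rewrite /= !Pbar_mapE comp_lfunE.
Qed.
Definition Pbar : functor := Functor Pbar_id Pbar_comp.
End Pbar.

End Functors.

Section Wedge2.
Variables (R : comNzRingType) (M : lmodType R).

Definition wedge2 (x y : M) : ext 2 M := wedge [tuple x; y].

Lemma ord2P (P : 'I_2 -> Prop) : P ord0 -> P ord_max -> forall i, P i.
Proof.
by move=> P0 P1 [[|[|//]] i]; [have <- : ord0 = Ordinal i by exact: val_inj
  | have <- : ord_max = Ordinal i by exact: val_inj].
Qed.

Lemma tuple2P (t : 2.-tuple M) : t = [tuple tnth t ord0; tnth t ord_max].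
Proof. by apply: eq_from_tnth; apply: ord2P; rewrite !(tnth_nth 0). Qed.

Lemma tset2_0 (x y z : M) : tset [tuple x; y] ord0 z = [tuple z; y].
Proof. by apply: eq_from_tnth; apply: ord2P; rewrite tnth_tset. Qed.
Lemma tset2_1 (x y z : M) : tset [tuple x; y] ord_max z = [tuple x; z].
Proof. by apply: eq_from_tnth; apply: ord2P; rewrite tnth_tset. Qed.

Lemma wedge2_linl y : linear (wedge2^~ y).
Proof.
move=> c x x'; have := wedge_multilinear [tuple 0; y] ord0 c x x'.
by rewrite !tset2_0.
Qed.
Lemma wedge2_linr x : linear (wedge2 x).
Proof.
move=> c y y'; have := wedge_multilinear [tuple x; 0] ord_max c y y'.
by rewrite !tset2_1.
Qed.
Lemma wedge2xx x : wedge2 x x = 0.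
Proof. by apply: (@wedge_alternating _ _ _ _ ord0 ord_max). Qed.
Lemma wedge20x y : wedge2 0 y = 0.
Proof. exact: (linear0 (mklin (wedge2_linl y))). Qed.
Lemma wedge2x0 x : wedge2 x 0 = 0.
Proof. exact: (linear0 (mklin (wedge2_linr x))). Qed.
Lemma wedge2Dl x x' y : wedge2 (x + x') y = wedge2 x y + wedge2 x' y.
Proof. exact: (linearD (mklin (wedge2_linl y))). Qed.
Lemma wedge2Dr x y y' : wedge2 x (y + y') = wedge2 x y + wedge2 x y'.
Proof. exact: (linearD (mklin (wedge2_linr x))). Qed.

Definition wedge3 (u v a : M) : ext 3 M := wedge [tuple u; v; a].

Lemma ord3P (P : 'I_3 -> Prop) :
  P ord0 -> P (fintype.lift ord0 ord0) -> P ord_max -> forall i, P i.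
Proof.
move=> P0 P1 P2 [[|[|[|//]]] i].
- by have <- : ord0 = Ordinal i by exact: val_inj.
- by have <- : fintype.lift ord0 ord0 = Ordinal i by exact: val_inj.
- by have <- : ord_max = Ordinal i by exact: val_inj.
Qed.

Lemma wedge3_lin1 v a : linear (fun u => wedge3 u v a).
Proof.
move=> c x x'; have := wedge_multilinear [tuple 0; v; a] ord0 c x x'.
by congr (wedge _ = c *: wedge _ + wedge _); apply: eq_from_tnth; apply: ord3P;
  rewrite tnth_tset.
Qed.
Lemma wedge3_lin2 u a : linear (fun v => wedge3 u v a).
Proof.
move=> c x x'.
have := wedge_multilinear [tuple u; 0; a] (fintype.lift ord0 ord0) c x x'.
by congr (wedge _ = c *: wedge _ + wedge _); apply: eq_from_tnth; apply: ord3P;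
  rewrite tnth_tset.
Qed.
Lemma wedge3_lin3 u v : linear (wedge3 u v).
Proof.
move=> c x x'; have := wedge_multilinear [tuple u; v; 0] ord_max c x x'.
by congr (wedge _ = c *: wedge _ + wedge _); apply: eq_from_tnth; apply: ord3P;
  rewrite tnth_tset.
Qed.
Lemma wedge3xx u a : wedge3 u u a = 0.
Proof.
by apply: (@wedge_alternating _ _ _ _ ord0 (fintype.lift ord0 ord0)).
Qed.
Lemma wedge3Dl u u' v a : wedge3 (u + u') v a = wedge3 u v a + wedge3 u' v a.
Proof. exact: (linearD (mklin (wedge3_lin1 v a))). Qed.
Lemma wedge3Dm u v v' a : wedge3 u (v + v') a = wedge3 u v a + wedge3 u v' a.
Proof. exact: (linearD (mklin (wedge3_lin2 u a))). Qed.
End Wedge2.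

(* A constant of its own, so that unification does not unfold 'F_2. *)
Definition F2 : fieldType := 'F_2.

Section Char2.

Lemma F2_addrr (N : lmodType F2) (x : N) : x + x = 0.
Proof.
rewrite -[x]scale1r -scalerDl.
by have -> : 1 + 1 = 0 :> F2; [exact: val_inj | rewrite scale0r].
Qed.
Lemma F2_addr_eq0 (N : lmodType F2) (x y : N) : x + y = 0 -> x = y.
Proof. by move=> xy; rewrite -[x]addr0 -(F2_addrr y) addrA xy add0r. Qed.

Lemma wedge2C (N : lmodType F2) (x y : N) : wedge2 x y = wedge2 y x.
Proof.
apply: F2_addr_eq0; have := wedge2xx (x + y).
by rewrite wedge2Dl !wedge2Dr !wedge2xx add0r addr0.
Qed.
Lemma wedge3C (N : lmodType F2) (u v a : N) : wedge3 u v a = wedge3 v u a.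
Proof.
apply: F2_addr_eq0; have := wedge3xx (u + v) a.
by rewrite wedge3Dl !wedge3Dm !wedge3xx add0r addr0.
Qed.

(* A linear map out of the exterior square of Pbar V is determined by its values
   f u v on the elements [u] /\ [v]; f has to be symmetric, zero on the diagonal
   (alternation in characteristic 2), and zero when u = 0 (because [0] = 0). *)
Section AltLift.
Variables (V : vectType F2) (N : lmodType F2).
Local Notation PV := (@Pbar_obj F2 V).
Local Notation "[ v ]p" := (@Pbar_gen F2 V v) (format "[ v ]p").

Lemma Pbar_ext2 (f g : {linear ext 2 PV -> N}) :
  (forall u v, f (wedge2 [u]p [v]p) = g (wedge2 [u]p [v]p)) -> f =1 g.
Proof.
move=> fg; apply: ext_ext => t; rewrite (tuple2P t) -/(wedge2 _ _).
move: (tnth t ord_max) (tnth t ord0) => q p.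
refine (Pbar_ext (f := f \o mklin (wedge2_linl q))
                 (g := g \o mklin (wedge2_linl q)) _ p) => {p} u.
refine (Pbar_ext (f := f \o mklin (wedge2_linr [u]p))
                 (g := g \o mklin (wedge2_linr [u]p)) _ q) => {q} v; exact: fg.
Qed.

Variable f : V -> V -> N.
Hypotheses (f0 : forall v, f 0 v = 0) (fC : forall u v, f u v = f v u).
Hypothesis fxx : forall u, f u u = 0.

Lemma alt_f0r u : f u 0 = 0. Proof. by rewrite fC f0. Qed.

Definition alt_inner u : {linear PV -> N} := Pbar_lift (alt_f0r u).

Lemma alt_inner0 q : alt_inner 0 q = 0.
Proof.
refine (Pbar_ext (f := alt_inner 0) (g := \0) _ q) => {q} v.
by rewrite [LHS]Pbar_liftE f0.
Qed.

Definition alt_outer (q : PV) : {linear PV -> N} :=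
  Pbar_lift (f := fun u => alt_inner u q) (alt_inner0 q).
Definition alt_bil (q p : PV) : N := alt_outer q p.

Lemma alt_bilE u v : alt_bil [v]p [u]p = f u v.
Proof. by rewrite /alt_bil /alt_outer Pbar_liftE /alt_inner Pbar_liftE. Qed.

Lemma alt_bil_linl q : linear (alt_bil q).
Proof. exact: linearP. Qed.

Lemma alt_bil_linr p : linear (alt_bil^~ p).
Proof.
move=> c q q'; refine (Pbar_ext (f := alt_outer (c *: q + q'))
  (g := c \*: alt_outer q \+ alt_outer q') _ p) => {p} u.
by rewrite /= /alt_outer !Pbar_liftE linearP.
Qed.

Lemma alt_bilC p q : alt_bil q p = alt_bil p q.
Proof.
refine (Pbar_ext (f := mklin (alt_bil_linl q)) (g := mklin (alt_bil_linr q)) _ p) => {p} u; rewrite /= /linear_of.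
refine (Pbar_ext (f := mklin (alt_bil_linr [u]p))
  (g := mklin (alt_bil_linl [u]p)) _ q) => {q} v.
by rewrite /= /linear_of !alt_bilE.
Qed.

Lemma alt_bilxx p : alt_bil p p = 0.
Proof.
elim/Pbar_ind: p => [|c u p IH].
  exact: (linear0 (mklin (alt_bil_linl 0))).
rewrite alt_bil_linl !alt_bil_linr alt_bilE fxx scaler0 add0r.
by rewrite IH addr0 (alt_bilC p) F2_addrr.
Qed.

Definition alt_fun (t : 2.-tuple PV) : N :=
  alt_bil (tnth t ord_max) (tnth t ord0).

Lemma alt_fun_multilinear : multilinear alt_fun.
Proof.
move=> t i c x y; rewrite /alt_fun !tnth_tset; elim/ord2P: i => /=.
  exact: alt_bil_linl.
exact: alt_bil_linr.
Qed.

Lemma alt_fun_alternating : alternating alt_fun.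
Proof.
move=> t i j ij tij; rewrite /alt_fun.
suff -> : tnth t ord0 = tnth t ord_max by exact: alt_bilxx.
by move: ij tij; elim/ord2P: i; elim/ord2P: j.
Qed.

Definition alt_lift : {linear ext 2 PV -> N} :=
  ext_lift alt_fun_multilinear alt_fun_alternating.

Lemma alt_liftE u v : alt_lift (wedge2 [u]p [v]p) = f u v.
Proof. by rewrite ext_liftE /alt_fun !(tnth_nth 0) alt_bilE. Qed.
End AltLift.

Local Notation functor2 := (functor F2).
Definition LP2 : functor2 := extF 2 (Pbar F2).
Definition Lam (n : nat) : functor2 := extF n (idF F2).

Section PiDef.
Variable V : vectType F2.
Local Notation "[ v ]p" := (@Pbar_gen F2 V v) (format "[ v ]p").

(* For u = 0 or v = 0, [u] /\ [v] is zero and so is the value below: the formula,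
   meant for nonzero u and v, holds for all of them. *)
Definition Pi_fun (u v : V) : LP2 V := wedge2 ([u]p + [v]p) [u + v]p.

Lemma Pi_fun0 v : Pi_fun 0 v = 0.
Proof. by rewrite /Pi_fun Pbar_gen0 !add0r wedge2xx. Qed.
Lemma Pi_funC u v : Pi_fun u v = Pi_fun v u.
Proof. by rewrite /Pi_fun addrC [u + v]addrC. Qed.
Lemma Pi_funxx u : Pi_fun u u = 0.
Proof. by rewrite /Pi_fun F2_addrr wedge20x. Qed.

Definition Pi_app : {linear LP2 V -> LP2 V} := alt_lift Pi_fun0 Pi_funC Pi_funxx.

Lemma Pi_appE u v :
  Pi_app (wedge2 [u]p [v]p) = wedge2 ([u]p + [v]p) [u + v]p.
Proof. exact: alt_liftE. Qed.

Lemma Pi_app_idem x : Pi_app (Pi_app x) = Pi_app x.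
Proof.
refine (Pbar_ext2 (f := Pi_app \o Pi_app) (g := Pi_app) _ x) => {x} u v /=.
rewrite !Pi_appE wedge2Dl linearD !Pi_appE.
rewrite [u + (u + v)]addrA F2_addrr add0r [v + (u + v)]addrCA F2_addrr addr0.
rewrite !wedge2Dl addrACA (wedge2C [v]p [u]p) F2_addrr add0r addrC.
by rewrite (wedge2C [u + v]p [u]p) (wedge2C [u + v]p [v]p).
Qed.
End PiDef.
End Char2.

Section Main.
Local Notation "[ v ]p" := (@Pbar_gen F2 _ v) (format "[ v ]p").
Local Notation functor2 := (functor F2).

Lemma LP2_mapE (V W : vectType F2) (f : 'Hom(V, W)) (u v : V) :
  fmap LP2 f (wedge2 [u]p [v]p) = wedge2 [f u]p [f v]p.
Proof.
rewrite [LHS]ext_mapE; congr wedge; apply: eq_from_tnth; apply: ord2P;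
by rewrite tnth_map !(tnth_nth 0) /=; exact: Pbar_mapE.
Qed.

Lemma Pi_nat (V W : vectType F2) (f : 'Hom(V, W)) (x : LP2 V) :
  Pi_app W (fmap LP2 f x) = fmap LP2 f (Pi_app V x).
Proof.
refine (Pbar_ext2 (f := Pi_app W \o fmap LP2 f) (g := fmap LP2 f \o Pi_app V)
  _ x) => {x} u v.
rewrite [LHS](congr1 (Pi_app W) (LP2_mapE f u v)).
rewrite [RHS](congr1 (fmap LP2 f) (Pi_appE u v)).
by rewrite Pi_appE !wedge2Dl linearD !LP2_mapE linearD.
Qed.

Definition Pi : ntrans LP2 LP2 := NTrans Pi_nat.

Definition P21 : functor2 := subF (imF Pi).
Definition Gbar2 : functor2 := subF (kerF Pi).
Definition L_2 : functor2 := dualF P21.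
Definition Dbar2 : functor2 := dualF Gbar2.

Lemma coPi_nat (V W : vectType F2) (f : 'Hom(V, W)) (x : LP2 V) :
  (idfun \- Pi_app W) (fmap LP2 f x) = fmap LP2 f ((idfun \- Pi_app V) x).
Proof. by rewrite linearB /= -Pi_nat. Qed.
(* coPi = id - Pi is the projection onto ker Pi, because Pi is idempotent. *)
Definition coPi : ntrans LP2 LP2 :=
  @NTrans _ LP2 LP2 (fun V => idfun \- Pi_app V) coPi_nat.
Lemma coPi_ker V x : coPi V x \in kerF Pi V.
Proof. by rewrite mem_kerF linearB /= Pi_app_idem subrr. Qed.

Definition projP21 : ntrans LP2 P21 := sub_corestr (mem_imF Pi).
Definition projGbar2 : ntrans LP2 Gbar2 := sub_corestr coPi_ker.

Section GDef.
Variable n : nat.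

Definition LamLam3 : functor2 := extF n (Lam 3).

Section GApp.
Variable V : vectType F2.
Local Notation T := (tensF LP2 LamLam3 V).

Definition wedge_uv (u v : V) : {linear idF F2 V -> Lam 3 V} :=
  mklin (wedge3_lin3 (u : idF F2 V) v).

(* ext_map n (wedge_uv u v) sends a1 /\ .. /\ an to the wedge of the u/\v/\ai. *)
Definition g_fun (x : Lam n V) (u v : V) : T :=
  tens (wedge2 [u]p [v]p : LP2 V) (ext_map n (wedge_uv u v) x).

Lemma g_fun0 x v : g_fun x 0 v = 0.
Proof.
by rewrite /g_fun Pbar_gen0 wedge20x; exact: tens0l.
Qed.
Lemma g_funC x u v : g_fun x u v = g_fun x v u.
Proof.
rewrite /g_fun wedge2C; congr tens.
refine (ext_ext (f := ext_map n (wedge_uv u v)) (g := ext_map n (wedge_uv v u))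
  _ x) => {x} t.
rewrite !ext_mapE; congr wedge; apply: eq_from_tnth => i.
by rewrite !tnth_map; exact: wedge3C.
Qed.
Lemma g_funxx x u : g_fun x u u = 0.
Proof.
by rewrite /g_fun wedge2xx; exact: tens0l.
Qed.

Definition g_lift (x : Lam n V) : {linear LP2 V -> T} :=
  alt_lift (g_fun0 x) (g_funC x) (@g_funxx x).

Lemma g_liftE x u v : g_lift x (wedge2 [u]p [v]p) = g_fun x u v.
Proof. exact: alt_liftE. Qed.

Lemma g_lift_linr p : linear (g_lift^~ p).
Proof.
move=> c x y; refine (Pbar_ext2 (f := g_lift (c *: x + y))
  (g := c \*: g_lift x \+ g_lift y) _ p) => {p} u v.
have E : g_fun (c *: x + y) u v = c *: g_fun x u v + g_fun y u v.
  exact: etrans (congr1 (tens _) (linearP _ _ _ _)) (tens_linr _ _ _ _).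
exact: etrans (g_liftE _ u v) (etrans E (esym
  (congr2 (fun a b => c *: a + b) (g_liftE x u v) (g_liftE y u v)))).
Qed.

Definition g_app : {linear tensF LP2 (Lam n) V -> T} :=
  tensor_lift (f := fun p x => g_lift x p) (fun x => @linearP _ _ _ _ (g_lift x)) g_lift_linr.

Lemma g_appE' u v (x : Lam n V) :
  g_app (tens (wedge2 [u]p [v]p : LP2 V) x) = g_fun x u v.
Proof. by rewrite tensor_liftE g_liftE. Qed.

Lemma g_appE u v (a : n.-tuple (idF F2 V)) :
  g_app (tens (wedge2 [u]p [v]p : LP2 V) (wedge a : Lam n V))
  = tens (wedge2 [u]p [v]p : LP2 V)
      (wedge (map_tuple (fun ai => wedge3 (u : idF F2 V) v ai) a) : LamLam3 V).
Proof. by rewrite g_appE' /g_fun ext_mapE. Qed.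

Lemma g_ext (N : lmodType F2) (f h : {linear tensF LP2 (Lam n) V -> N}) :
  (forall u v (a : n.-tuple (idF F2 V)),
     f (tens (wedge2 [u]p [v]p : LP2 V) (wedge a : Lam n V))
     = h (tens (wedge2 [u]p [v]p : LP2 V) (wedge a : Lam n V))) -> f =1 h.
Proof.
move=> fh; apply: tensor_ext => p x.
refine (Pbar_ext2 (f := f \o mklin (tens_linl x)) (g := h \o mklin (tens_linl x))
  _ p) => {p} u v.
refine (ext_ext (f := f \o mklin (tens_linr (wedge2 [u]p [v]p : LP2 V)))
  (g := h \o mklin (tens_linr (wedge2 [u]p [v]p : LP2 V))) _ x) => {x} a.
exact: fh.
Qed.
End GApp.

Lemma Lam_mapE m (V W : vectType F2) (f : 'Hom(V, W)) (a : m.-tuple (idF F2 V)) :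
  fmap (Lam m) f (wedge a) = wedge (map_tuple (fmap (idF F2) f) a).
Proof. exact: ext_mapE. Qed.

Lemma wedge3_map (V W : vectType F2) (f : 'Hom(V, W)) (u v a : idF F2 V) :
  fmap (Lam 3) f (wedge3 u v a)
  = wedge3 (fmap (idF F2) f u) (fmap (idF F2) f v) (fmap (idF F2) f a).
Proof.
rewrite [LHS]Lam_mapE; congr wedge; apply: eq_from_tnth; apply: ord3P;
by rewrite tnth_map !(tnth_nth 0).
Qed.

Lemma g_nat (V W : vectType F2) (f : 'Hom(V, W)) x :
  g_app W (fmap (tensF LP2 (Lam n)) f x)
  = fmap (tensF LP2 LamLam3) f (g_app V x).
Proof.
refine (g_ext (f := g_app W \o fmap (tensF LP2 (Lam n)) f)
  (h := fmap (tensF LP2 LamLam3) f \o g_app V) _ x) => {x} u v a.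
rewrite [LHS](congr1 (g_app W) (tensor_mapE _ _ _ _)).
rewrite [RHS](congr1 (fmap (tensF LP2 LamLam3) f) (g_appE u v a)).
rewrite [RHS]tensor_mapE LP2_mapE Lam_mapE g_appE; congr tens.
rewrite [RHS]ext_mapE; congr wedge; apply: eq_from_tnth => i.
by rewrite !tnth_map; exact: esym (wedge3_map _ _ _ _).
Qed.

Definition g : ntrans (tensF LP2 (Lam n)) (tensF LP2 LamLam3) := NTrans g_nat.

Lemma g_Pi (V : vectType F2) x :
  g V (tensF_ntrans Pi (ntrans_id (Lam n)) V x)
  = tensF_ntrans Pi (ntrans_id LamLam3) V (g V x).
Proof.
refine (g_ext (f := g V \o tensF_ntrans Pi (ntrans_id (Lam n)) V)
  (h := tensF_ntrans Pi (ntrans_id LamLam3) V \o g V) _ x) => {x} u v a.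
rewrite [LHS](congr1 (g V) (tensor_mapE _ _ _ _)).
rewrite [RHS](congr1 (tensF_ntrans Pi (ntrans_id LamLam3) V) (g_appE u v a)).
rewrite [RHS]tensor_mapE.
have PiE : Pi V (wedge2 [u]p [v]p)
  = wedge2 [u]p [u + v]p + wedge2 [v]p [u + v]p by rewrite [LHS]Pi_appE wedge2Dl.
rewrite PiE !tensDl linearD; congr (_ + _); rewrite [LHS]g_appE;
  congr tens; congr wedge; apply: eq_from_tnth => i;
  rewrite !tnth_map wedge3Dm wedge3xx ?add0r ?addr0 //.
exact: wedge3C.
Qed.

(* The components of g on im Pi and ker Pi are obtained from the inclusions and
   the projections; gL_incl and gD_incl state that they are restrictions of g. *)
Definition gL : ntrans (tensF P21 (Lam n)) (tensF P21 LamLam3) :=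
  ntrans_comp (tensF_ntrans projP21 (ntrans_id LamLam3))
    (ntrans_comp g (tensF_ntrans (sub_incl (imF Pi)) (ntrans_id (Lam n)))).
Definition gD : ntrans (tensF Gbar2 (Lam n)) (tensF Gbar2 LamLam3) :=
  ntrans_comp (tensF_ntrans projGbar2 (ntrans_id LamLam3))
    (ntrans_comp g (tensF_ntrans (sub_incl (kerF Pi)) (ntrans_id (Lam n)))).


Lemma gL_incl (V : vectType F2) x :
  tensF_ntrans (sub_incl (imF Pi)) (ntrans_id LamLam3) V (gL V x)
  = g V (tensF_ntrans (sub_incl (imF Pi)) (ntrans_id (Lam n)) V x).
Proof.
set y := tensF_ntrans _ _ V x.
transitivity (tensF_ntrans Pi (ntrans_id LamLam3) V (g V y)).
  rewrite -[gL V x]/(tensF_ntrans projP21 (ntrans_id LamLam3) V (g V y)).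
  move: (g V y) => z.
  refine (tensor_ext (f := tensF_ntrans (sub_incl (imF Pi)) (ntrans_id LamLam3) V
    \o tensF_ntrans projP21 (ntrans_id LamLam3) V)
    (g := tensF_ntrans Pi (ntrans_id LamLam3) V) _ z) => {}z t.
  rewrite [LHS](congr1 (tensF_ntrans (sub_incl (imF Pi)) (ntrans_id LamLam3) V)
    (tensor_mapE _ _ z t)).
  by rewrite [LHS]tensor_mapE [RHS]tensor_mapE.
rewrite -g_Pi; congr (g V _); rewrite /y.
refine (tensor_ext (f := tensF_ntrans Pi (ntrans_id (Lam n)) V
  \o tensF_ntrans (sub_incl (imF Pi)) (ntrans_id (Lam n)) V)
  (g := tensF_ntrans (sub_incl (imF Pi)) (ntrans_id (Lam n)) V) _ x) => p t.
rewrite [LHS](congr1 (tensF_ntrans Pi (ntrans_id (Lam n)) V) (tensor_mapE _ _ p t)).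
rewrite [LHS]tensor_mapE [RHS]tensor_mapE; congr tens.
have /asboolP[q Eq] := valP p.
rewrite -[LHS]/(Pi_app V (val p)) -[RHS]/(val p) -Eq; exact: Pi_app_idem.
Qed.

Lemma gD_incl (V : vectType F2) x :
  tensF_ntrans (sub_incl (kerF Pi)) (ntrans_id LamLam3) V (gD V x)
  = g V (tensF_ntrans (sub_incl (kerF Pi)) (ntrans_id (Lam n)) V x).
Proof.
set y := tensF_ntrans _ _ V x.
transitivity (g V y - tensF_ntrans Pi (ntrans_id LamLam3) V (g V y)).
  rewrite -[gD V x]/(tensF_ntrans projGbar2 (ntrans_id LamLam3) V (g V y)).
  move: (g V y) => z.
  refine (tensor_ext (f := tensF_ntrans (sub_incl (kerF Pi)) (ntrans_id LamLam3) V
    \o tensF_ntrans projGbar2 (ntrans_id LamLam3) V)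
    (g := idfun \- tensF_ntrans Pi (ntrans_id LamLam3) V) _ z) => {}z t.
  rewrite [LHS](congr1 (tensF_ntrans (sub_incl (kerF Pi)) (ntrans_id LamLam3) V)
    (tensor_mapE _ _ z t)).
  rewrite [LHS]tensor_mapE [RHS](congr1 (fun w => tens z t - w) (tensor_mapE _ _ z t)).
  exact: (linearB (mklin (tens_linl t))).
rewrite -g_Pi; have -> : tensF_ntrans Pi (ntrans_id (Lam n)) V y = 0.
  refine (tensor_ext (f := tensF_ntrans Pi (ntrans_id (Lam n)) V
    \o tensF_ntrans (sub_incl (kerF Pi)) (ntrans_id (Lam n)) V)
    (g := \0) _ x) => p t.
  rewrite [LHS](congr1 (tensF_ntrans Pi (ntrans_id (Lam n)) V)
    (tensor_mapE _ _ p t)) [LHS]tensor_mapE.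
  have /eqP Kp := valP p.
  rewrite -[RHS]/(0 : tensor (LP2 V) (Lam n V)).
  rewrite -[X in tens X _]/(Pi_app V (val p)).
  by rewrite -[Pi_app V _]/(Pi V (val p)) Kp tens0l.
by rewrite linear0 subr0.
Qed.

End GDef.
End Main.

(* The images are taken inside dualF (tensF P21 (Lam n)), which is canonically
   isomorphic to tensF L_2 (Lam n), and similarly for Gbar2. *)
Definition Lsup2 (n : nat) : functor F2 :=
  if n is 0 then L_2 else subF (imF (dualF_ntrans (gL n))).
Definition Dsup2 (n : nat) : functor F2 :=
  if n is 0 then Dbar2 else subF (imF (dualF_ntrans (gD n))).

(* Main.v *)
From HB Require Import structures.
From mathcomp Require Import all_boot all_algebra fingroup perm.
From mathcomp Require Import boolp zify ring.
Require Import Defs.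
Set Implicit Arguments.
Unset Strict Implicit.
Unset Printing Implicit Defensive.
Import GRing.Theory.

(** Evaluating an element of L^2_n(V) or D^2_n(V) at the points
    ([u] /\ [v]) (x) (w_1 /\ ... /\ w_n), where u, v and the w_i are linear forms
    on V, turns it into a function f(u, v; w) with values in F_2. The functions
    obtained in this way form the functor Phi c n, with c = 1 for L and c = 0 for
    D: f is alternating in w, depends on w only modulo u and v, vanishes unless u
    and v are independent, and depends on the basis (u, v) of its plane through
    the Steinberg (c = 1) or the trivial (c = 0) representation of GL_2(F_2). That
    every such f occurs (evaln_onto) is shown by contracting Lambda^3 with a
    2-form chosen for each plane. Since being artinian of some type is a property
    of the lattice of subfunctors (simple_artinianP), it remains to study Phi c n
    (simple_of_Phi), and there two facts are needed.

    A proper subfunctor U of Phi c n is artinian of type 1. Take a functional on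
    some Phi(d0) that vanishes on U but is not zero. Differences in well-chosen
    directions remove from it all points except those over one plane
    (elim_frames), and then its dependence on the parameters w (peel, top_test).
    Because alternating forms make up a simple functor (Alt_simple), what is left
    says that all members of U are killed by a bounded number of differences in
    each of the three nonzero directions of F_2^2 (Phi_proper). The functor of all
    functions with this property is artinian of type 1 (cart_Z). Taking
    differences lowers the bounds until the functions are polynomial except in one
    vector (cart_shift), and functions of one vector are treated by the same
    isolation method (cart_lines), starting from the fact that functions of
    bounded degree form a functor of finite length (cart_killn).

    Phi c n itself is not artinian of type 1 (Phi_not_art). Otherwise it would
    have a proper subfunctor x such that everything between x and a proper
    subfunctor of Phi c n has finite length. Now x is killed by a fixed number M
    of differences in the three directions, while for a suitable M' > M the members
    of Phi c n killed by M' differences have unbounded degree, even modulo the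
    functions killed by M (witness). Filtering them by degree gives an infinite
    ascending chain.

    The lattice arguments rest on art_strict: types pass to intervals, and back
    along strict monotone maps of modular lattices. *)

(** * The Krull filtration of an ordered set *)

Section Preorder.
Variables (T : Type) (le : T -> T -> Prop).

Definition btw a b x := le a x /\ le x b.

(** The interval [a, b] is simple relative to P; for P = art k below it is simple
    artinian of type k. *)
Definition smp (P : T -> T -> Prop) a b :=
  [/\ le a b, ~ P a b & forall y, btw a b y -> ~ le b y -> P a y].

Inductive chain (S : T -> T -> Prop) : T -> T -> Prop :=
| Chain0 a b : le a b -> le b a -> chain S a b
| ChainS a x b : S a x -> chain S x b -> chain S a b.

(** Level 0 consists of the trivial intervals. Hence art k.+1 means artinian of
    type k, and steps k.+1 simple artinian of some type at most k. *)
Fixpoint steps k a b : Prop :=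
  if k is k'.+1 then steps k' a b \/ smp (chain (steps k')) a b else False.

Definition art k := chain (steps k).

Lemma steps_weaken k l a b : k <= l -> steps k a b -> steps l a b.
Proof.
by move=> /subnK <-; elim: (l - k) => //= i IH /IH; left.
Qed.

Lemma chain_mono (S S' : T -> T -> Prop) a b :
  (forall x y, S x y -> S' x y) -> chain S a b -> chain S' a b.
Proof.
by move=> SS'; elim=> [{}a {}b|{}a x {}b /SS' ? _]; [exact: Chain0|exact: ChainS].
Qed.

Lemma art_weaken k l a b : k <= l -> art k a b -> art l a b.
Proof. by move=> kl; apply: chain_mono => x y; exact: steps_weaken. Qed.

Hypotheses (refl : forall x, le x x)
  (trans : forall y x z, le x y -> le y z -> le x z).

Lemma steps_le k a b : steps k a b -> le a b.
Proof. by elim: k => //= k IH [/IH|[]]. Qed.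

Lemma chain_le S a b : (forall x y, S x y -> le x y) -> chain S a b -> le a b.
Proof.
by move=> Sle; elim=> // {}a x {}b /Sle ax _; exact: trans.
Qed.

Lemma art_le k a b : art k a b -> le a b.
Proof. by apply: chain_le => x y; exact: steps_le. Qed.

End Preorder.

(** An isomorphism of intervals of preorders: f and g are inverse to each other
    up to equivalence. *)
Record order_iso (T T' : Type) (le : T -> T -> Prop) (le' : T' -> T' -> Prop)
    (f : T -> T') (g : T' -> T) a b a' b' : Prop := OrderIso {
  iso_f : forall x y, btw le a b x -> btw le a b y -> le x y -> le' (f x) (f y);
  iso_g : forall x y, btw le' a' b' x -> btw le' a' b' y -> le' x y -> le (g x) (g y);
  iso_fb : forall x, btw le a b x -> btw le' a' b' (f x);
  iso_gb : forall x, btw le' a' b' x -> btw le a b (g x);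
  iso_gf : forall x, btw le a b x -> le (g (f x)) x /\ le x (g (f x));
  iso_fg : forall x, btw le' a' b' x -> le' (f (g x)) x /\ le' x (f (g x)) }.

Section Iso.
Variables (T T' : Type) (le : T -> T -> Prop) (le' : T' -> T' -> Prop).
Hypotheses (refl : forall x, le x x)
  (trans : forall y x z, le x y -> le y z -> le x z).
Hypotheses (refl' : forall x, le' x x)
  (trans' : forall y x z, le' x y -> le' y z -> le' x z).
Local Notation iso := (order_iso le le').

Lemma iso_sub f g a b a' b' x y x' y' : iso f g a b a' b' ->
  btw le a b x -> btw le a b y ->
  btw le' a' b' x' -> btw le' a' b' y' ->
  le' (f x) x' -> le' x' (f x) -> le' (f y) y' -> le' y' (f y) ->
  iso f g x y x' y'.
Proof.
move=> [mf mg fb gb gf fg] bx by_ bx' by' xx' x'x yy' y'y.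
have wid z : btw le x y z -> btw le a b z.
  by move=> [xz zy]; split; [apply: trans xz; case: bx|apply: trans zy _; case: by_].
have wid' z : btw le' x' y' z -> btw le' a' b' z.
  by move=> [xz zy]; split; [apply: trans' xz; case: bx'|apply: trans' zy _; case: by'].
split.
- by move=> u v /wid bu /wid bv; exact: mf.
- by move=> u v /wid' bu /wid' bv; exact: mg.
- move=> z bz; have /wid bz' := bz; case: bz => xz zy; split.
    by apply: trans' x'x _; exact: mf.
  by apply: (trans' _ yy'); exact: mf.
- move=> z bz; have /wid' bz' := bz; case: bz => xz zy; split.
    apply: trans (proj2 (gf _ bx)) _; apply: mg => //; first exact: fb.
    exact: trans' xz.
  apply: (trans _ (proj1 (gf _ by_))); apply: mg => //; first exact: fb.
  exact: trans' y'y.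
- by move=> z /wid; exact: gf.
- by move=> z /wid'; exact: fg.
Qed.
End Iso.

Section IsoSym.
Variables (T T' : Type) (le : T -> T -> Prop) (le' : T' -> T' -> Prop).
Lemma iso_sym f g a b a' b' :
  order_iso le le' f g a b a' b' -> order_iso le' le g f a' b' a b.
Proof. by case=> *; split. Qed.
End IsoSym.

Section IsoArt.
Variables (T T' : Type) (le : T -> T -> Prop) (le' : T' -> T' -> Prop).
Hypotheses (refl : forall x, le x x)
  (trans : forall y x z, le x y -> le y z -> le x z).
Hypotheses (refl' : forall x, le' x x)
  (trans' : forall y x z, le' x y -> le' y z -> le' x z).

Lemma smp_iso (P : T -> T -> Prop) (P' : T' -> T' -> Prop) f g a b a' b' :
  (forall x y x' y', order_iso le le' f g x y x' y' -> le' x' y' ->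
     P x y -> P' x' y') ->
  (forall x y x' y', order_iso le le' f g x y x' y' -> le x y ->
     P' x' y' -> P x y) ->
  order_iso le le' f g a b a' b' -> le' a' b' -> smp le P a b -> smp le' P' a' b'.
Proof.
move=> PP' P'P I ab' [ab nP Pp]; split=> //; first by move=> /(P'P _ _ _ _ I ab).
move=> y by_ nby; have gy := iso_gb I by_.
have baa : btw le a b a by split.
have bbb : btw le a b b by split.
have baa' : btw le' a' b' a' by split.
have bbb' : btw le' a' b' b' by split.
have [fgy yfg] := iso_fg I by_.
have fa : le' (f a) a'.
  apply: (trans' _ (proj1 (iso_fg I baa'))).
  by apply: (iso_f I) => //; [exact: (iso_gb I)|case: (iso_gb I baa')].
apply: (PP' a (g y)).
  apply: (iso_sub trans trans' I) => //; first by case: (iso_fb I baa).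
by case: by_.
apply: Pp => // bgy; apply: nby.
apply: (trans' _ fgy); apply: trans' (_ : le' b' (f b)) _.
  apply: trans' (proj2 (iso_fg I bbb')) _; apply: (iso_f I) => //; first exact: (iso_gb I).
  by case: (iso_gb I bbb').
by apply: (iso_f I).
Qed.

Lemma chain_iso S S' f g a b a' b' :
  (forall x y, S x y -> le x y) ->
  (forall x y x' y', order_iso le le' f g x y x' y' -> le' x' y' ->
     S x y -> S' x' y') ->
  order_iso le le' f g a b a' b' -> le' a' b' -> chain le S a b -> chain le' S' a' b'.
Proof.
move=> Sle SS' I ab' c; elim: c a' I ab' => {a b} [a b ab ba|a x b Sax c IH] a' I ab'.
  apply: Chain0 => //.
  have baa : btw le' a' b' a' by split.
  have bbb : btw le' a' b' b' by split.
  have [_ bf] := iso_fg I bbb; have [fa _] := iso_fg I baa.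
  apply: (trans' bf (trans' _ fa)); apply: (iso_f I); try exact: (iso_gb I).
  have [_ gbb] := iso_gb I bbb; have [aga _] := iso_gb I baa.
  exact: (trans gbb (trans ba aga)).
have ax := Sle _ _ Sax.
have xb := chain_le trans Sle c.
have ab : le a b by exact: trans xb.
have baa : btw le a b a by split.
have bbb : btw le a b b by split.
have bx : btw le a b x by split.
have baa' : btw le' a' b' a' by split.
have bbb' : btw le' a' b' b' by split.
have bfx := iso_fb I bx.
have fa : le' (f a) a'.
  apply: (trans' _ (proj1 (iso_fg I baa'))).
  by apply: (iso_f I) => //; [exact: (iso_gb I)|case: (iso_gb I baa')].
have bf : le' b' (f b).
  apply: trans' (proj2 (iso_fg I bbb')) _.
  by apply: (iso_f I) => //; [exact: (iso_gb I)|case: (iso_gb I bbb')].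
apply: (@ChainS _ _ _ _ (f x)).
  apply: SS' Sax; last by case: bfx.
  by apply: (iso_sub trans trans' I) => //; case: (iso_fb I baa).
apply: IH; last by case: bfx.
by apply: (iso_sub trans trans' I) => //; case: (iso_fb I bbb).
Qed.
End IsoArt.

Section IsoArt2.
Variables (T T' : Type) (le : T -> T -> Prop) (le' : T' -> T' -> Prop).
Hypotheses (refl : forall x, le x x)
  (trans : forall y x z, le x y -> le y z -> le x z).
Hypotheses (refl' : forall x, le' x x)
  (trans' : forall y x z, le' x y -> le' y z -> le' x z).

Lemma steps_iso_both k f g :
  (forall a b a' b', order_iso le le' f g a b a' b' -> le' a' b' ->
     steps le k a b -> steps le' k a' b') /\
  (forall a b a' b', order_iso le le' f g a b a' b' -> le a b ->
     steps le' k a' b' -> steps le k a b).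
Proof.
elim: k => //= k [IH IH'].
have cI a b a' b' : order_iso le le' f g a b a' b' -> le' a' b' ->
    chain le (steps le k) a b -> chain le' (steps le' k) a' b'.
  by apply: chain_iso => // x y; exact: steps_le.
have cI' a b a' b' : order_iso le le' f g a b a' b' -> le a b ->
    chain le' (steps le' k) a' b' -> chain le (steps le k) a b.
  move=> I ab; apply: chain_iso (iso_sym I) ab => //.
    by move=> x y; exact: steps_le.
  by move=> x y x' y' J; apply: IH'; exact: iso_sym J.
split=> a b a' b' I ab [s|s]; [left; exact: IH I ab s| right|left; exact: IH' I ab s|right].
  exact: (@smp_iso _ _ le le' refl trans refl' trans' _ _ _ _ _ _ _ _ cI cI' I ab s).
apply: smp_iso (iso_sym I) ab s => // x y x' y' J.
  by apply: cI'; exact: iso_sym J.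
by apply: cI; exact: iso_sym J.
Qed.

Lemma steps_iso k f g a b a' b' : order_iso le le' f g a b a' b' -> le' a' b' ->
  steps le k a b -> steps le' k a' b'.
Proof. by have [IH _] := steps_iso_both k f g; exact: IH. Qed.

Lemma art_iso k f g a b a' b' : order_iso le le' f g a b a' b' -> le' a' b' ->
  art le k a b -> art le' k a' b'.
Proof.
apply: chain_iso => //; first by move=> x y; exact: steps_le.
by move=> x y x' y'; exact: steps_iso.
Qed.
End IsoArt2.

Section Eql.
Variables (T : Type) (le : T -> T -> Prop).
Hypotheses (refl : forall x, le x x)
  (trans : forall y x z, le x y -> le y z -> le x z).

Lemma iso_eql a b a' b' : le a a' -> le a' a -> le b b' -> le b' b ->
  order_iso le le id id a b a' b'.
Proof.
move=> aa' a'a bb' b'b; split=> // x [ax xb]; split=> //.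
- exact: trans ax.
- exact: (trans xb bb').
- exact: trans ax.
- exact: (trans xb b'b).
Qed.

Lemma art_eql k a b a' b' : le a a' -> le a' a -> le b b' -> le b' b ->
  art le k a b -> art le k a' b'.
Proof.
move=> aa' a'a bb' b'b c.
apply: (art_iso refl trans refl trans (iso_eql aa' a'a bb' b'b) _ c).
apply: (trans a'a (trans _ bb')); exact: art_le c.
Qed.

Lemma chain_cat S a b c : (forall x y z, le x y -> le y x -> S x z -> S y z) ->
  chain le S a b -> chain le S b c -> chain le S a c.
Proof.
move=> SE; elim=> {a b} [a b ab ba cbc|a x b Sax _ IH /IH]; last exact: ChainS.
case: cbc ab ba => {b c} [b c bc cb ab ba|b x c Sbx cxc ab ba].
  by apply: Chain0; [exact: trans bc|exact: trans ba].
by apply: ChainS cxc; exact: SE Sbx.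
Qed.

Lemma steps_eql k a a' b : le a a' -> le a' a -> steps le k a b -> steps le k a' b.
Proof.
move=> aa' a'a s; have ab := steps_le s.
apply: (steps_iso refl trans refl trans (iso_eql aa' a'a (refl b) (refl b)) _ s).
exact: trans a'a ab.
Qed.

Lemma art_trans k a b c : art le k a b -> art le k b c -> art le k a c.
Proof. by apply: chain_cat => x y z; exact: steps_eql. Qed.

Lemma art_smp k a b : smp le (art le k) a b -> art le k.+1 a b.
Proof. by move=> s; apply: (@ChainS _ _ _ _ b); [right|exact: Chain0]. Qed.

(** Either [a, b] has level k already, or it is a simple step. *)
Lemma art_proper k a b : le a b ->
  (forall x, btw le a b x -> ~ le b x -> art le k a x) -> art le k.+1 a b.
Proof.
move=> ab H; have [c|nc] := pselect (art le k a b); first exact: art_weaken c.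
by apply: art_smp; split.
Qed.

Lemma art_refl k a b : le a b -> le b a -> art le k a b.
Proof. exact: Chain0. Qed.

(** The step through which a nontrivial chain reaches its end. *)
Lemma chain_last S a b : (forall x y, S x y -> le x y) -> chain le S a b -> ~ le b a ->
  exists x y, [/\ S x y, le a x, le y b, le b y & ~ le b x].
Proof.
move=> Sle; elim=> {a b} [//|a x b Sax c IH nba].
have ax := Sle _ _ Sax; have xb := chain_le trans Sle c.
have [bx|nbx] := pselect (le b x); first by exists a, x.
have [u [v [Suv xu vb bv nbu]]] := IH nbx.
by exists u, v; split=> //; exact: trans xu.
Qed.
End Eql.

(** * Modular lattices *)

(** A modular lattice with a preorder instead of an order, so that no quotient has to
    be taken. *)
Record mlattice := MLattice {
  mcar :> Type;
  mle : mcar -> mcar -> Prop;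
  meet : mcar -> mcar -> mcar;
  join : mcar -> mcar -> mcar;
  mle_refl : forall x, mle x x;
  mle_trans : forall y x z, mle x y -> mle y z -> mle x z;
  meetl : forall x y, mle (meet x y) x;
  meetr : forall x y, mle (meet x y) y;
  meetP : forall x y z, mle z x -> mle z y -> mle z (meet x y);
  joinl : forall x y, mle x (join x y);
  joinr : forall x y, mle y (join x y);
  joinP : forall x y z, mle x z -> mle y z -> mle (join x y) z;
  modular : forall x y z, mle x z -> mle (meet (join x y) z) (join x (meet y z)) }.

Section Strict.
Variable L : mlattice.
Implicit Types a b x y z : L.
Local Notation le := (@mle L).
Local Notation "x <~ y" := (mle x y) (at level 70).

Definition dcc a b := forall P : L -> Prop, (exists2 x, btw le a b x & P x) ->
  exists2 x, btw le a b x /\ P x & forall y, btw le a b y -> P y -> y <~ x -> x <~ y.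

Lemma meet_mono x y z : x <~ y -> meet x z <~ meet y z.
Proof. by move=> xy; apply: meetP; [exact: (mle_trans (meetl _ _) xy)|exact: meetr]. Qed.
Lemma join_mono x y z : x <~ y -> join x z <~ join y z.
Proof. by move=> xy; apply: joinP; [exact: (mle_trans xy (joinl _ _))|exact: joinr]. Qed.

(** Comparable elements with the same meet and the same join with z coincide. *)
Lemma modular_cancel x y z : x <~ y -> meet y z <~ meet x z ->
  join y z <~ join x z -> y <~ x.
Proof.
move=> xy m j.
have yj : y <~ meet (join x z) y.
  by apply: meetP; [exact: (mle_trans (joinl _ _) j)|exact: mle_refl].
apply: (mle_trans yj _); apply: (mle_trans (modular _ xy) _).
apply: joinP; first exact: mle_refl.
apply: (mle_trans _ (meetl x z)); apply: (mle_trans _ m).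
by apply: meetP; [exact: meetr|exact: meetl].
Qed.

(** Minimize first the join with x, then, among the elements so obtained, the
    meet with x. *)
Lemma dcc_cat a x b : a <~ x -> x <~ b -> dcc a x -> dcc x b -> dcc a b.
Proof.
move=> ax xb dax dxb P [y0 [ay0 y0b] Py0].
have [|z [[xz zb] [y1 [ay1 y1b] [Py1 zy1 y1z]]] zmin] := dxb (fun z =>
    exists2 y, btw le a b y & [/\ P y, z <~ join y x & join y x <~ z]).
  exists (join y0 x); first by split; [exact: joinr|exact: joinP].
  by exists y0; split=> //; exact: mle_refl.
have [|w [[aw wx] [y2 [ay2 y2b] [Py2 y2z wy2 y2w]]] wmin] := dax (fun w =>
    exists2 y, btw le a b y & [/\ P y, join y x <~ z, w <~ meet y x & meet y x <~ w]).
  exists (meet y1 x); first by split; [exact: meetP|exact: meetr].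
  by exists y1; split=> //; exact: mle_refl.
exists y2 => // y [ay yb] Py yy2.
have jy := join_mono x yy2.
have zy : z <~ join y x.
  apply: zmin; first by split; [exact: joinr|exact: joinP].
    by exists y; split=> //; exact: mle_refl.
  exact: (mle_trans jy y2z).
apply: (@modular_cancel _ _ x) => //; last exact: (mle_trans y2z zy).
apply: (mle_trans y2w _); apply: wmin.
- by split; [exact: meetP|exact: meetr].
- exists y; split=> //; try exact: mle_refl.
  exact: (mle_trans jy y2z).
- by apply: (mle_trans _ y2w); exact: meet_mono.
Qed.

Lemma dcc_smp (P : L -> L -> Prop) a b : (forall x, a <~ x -> P a x -> dcc a x) ->
  smp le P a b -> dcc a b.
Proof.
move=> Pdcc [ab _ Pp] Q [y0 by0 Qy0].
have [[y by_ [Qy nby]]|nQ] := pselect (exists2 y, btw le a b y & Q y /\ ~ b <~ y).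
  have [] := Pdcc y (proj1 by_) (Pp _ by_ nby) Q.
    by exists y => //; split; [case: by_|exact: mle_refl].
  move=> x [[ax xy] Qx] xmin; exists x.
    by split=> //; split=> //; apply: (mle_trans xy _); case: by_.
  move=> z [az zb] Qz zx; apply: xmin => //; split=> //; exact: (mle_trans zx xy).
have full y : btw le a b y -> Q y -> b <~ y.
  by move=> by_ Qy; apply: contrapT => nby; apply: nQ; exists y.
exists y0 => // y by_ Qy _; by apply: (mle_trans _ (full y by_ Qy)); case: by0.
Qed.

Lemma steps_dcc k a b : steps le k a b -> dcc a b.
Proof.
elim: k a b => //= k IH a b [/IH //|]; apply: dcc_smp => x ax c.
elim: c => {ax a b x} [a b ab ba|a x b s c dxb].
  move=> Q [y0 [ay yb] Qy0]; exists y0 => // y [ay' _] _ _.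
  exact: (mle_trans yb (mle_trans ba ay')).
apply: (dcc_cat _ _ (IH _ _ s) dxb); first exact: steps_le s.
by apply: chain_le c; [exact: mle_trans|move=> u v; exact: steps_le].
Qed.

Lemma chain_steps_dcc k a b : art le k a b -> dcc a b.
Proof.
elim=> {a b} [a b ab ba|a x b s c dxb].
  move=> Q [y0 [ay yb] Qy0]; exists y0 => // y [ay' _] _ _.
  exact: (mle_trans yb (mle_trans ba ay')).
apply: (dcc_cat _ _ (steps_dcc s) dxb); first exact: steps_le s.
by apply: chain_le c; [exact: mle_trans|move=> u v; exact: steps_le].
Qed.

(** At most n of the intervals of any chain from a to b fail to be artinian of
    level k. *)
Fixpoint jumps k n a b : Prop :=
  forall x, btw le a b x ->
    art le k a x \/ (if n is n'.+1 then jumps k n' x b else False).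

(** A minimal x such that [a, x] does not have level k is a simple step, and it
    uses up one jump. *)
Lemma jumps_intro k n a b : dcc a b -> a <~ b -> jumps k n a b -> art le k.+1 a b.
Proof.
elim: n a => [|n IH] a d ab J.
  have [c|//] := J b (conj ab (mle_refl b)); exact: art_weaken c.
have [c|nc] := pselect (art le k a b); first exact: art_weaken c.
have [|x [[ax xb] nax] xmin] := d (fun x => ~ art le k a x).
  by exists b => //; split=> //; exact: mle_refl.
have [//|Jx] := J x (conj ax xb).
have s : smp le (art le k) a x.
  split=> // y [ay yx] nxy; apply: contrapT => nay; apply: nxy; apply: xmin => //.
  by split=> //; exact: (mle_trans yx xb).
apply: (@ChainS _ _ _ _ x); first by right.
apply: IH => // Q [y0 [xy0 y0b] Qy0].
have [|y [[ay yb] [xy Qy]] ymin] := d (fun y => x <~ y /\ Q y).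
  by exists y0 => //; split=> //; exact: (mle_trans ax xy0).
exists y => // z [xz zb] Qz zy; apply: ymin => //; split=> //; exact: (mle_trans ax xz).
Qed.

End Strict.

(** h is monotone, and elements x <= y with equivalent images are equivalent. *)
Definition strict (L L' : mlattice) (h : L -> L') a b a' b' :=
  [/\ forall x, btw (@mle L) a b x -> btw (@mle L') a' b' (h x),
      forall x y, btw (@mle L) a b x -> btw (@mle L) a b y -> mle x y -> mle (h x) (h y)
    & forall x y, btw (@mle L) a b x -> btw (@mle L) a b y ->
        mle x y -> mle (h y) (h x) -> mle y x].

Lemma strict_sub (L L' : mlattice) (h : L -> L') a b a' b' x y x' y' :
  strict h a b a' b' -> btw (@mle L) a b x -> btw (@mle L) a b y ->
  mle x' (h x) -> mle (h y) y' -> strict h x y x' y'.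
Proof.
move=> [hb hm hs] [ax xb] [ay yb] x'x yy'.
have wid z : btw (@mle L) x y z -> btw (@mle L) a b z.
  by move=> [xz zy]; split; [exact: (mle_trans ax xz)|exact: (mle_trans zy yb)].
split.
- move=> z bz; have bz' := wid _ bz; case: bz => xz zy; split.
    by apply: (mle_trans x'x); apply: hm.
  by apply: (mle_trans _ yy'); apply: hm.
- by move=> u v /wid bu /wid bv; exact: hm.
- by move=> u v /wid bu /wid bv; exact: hs.
Qed.

Lemma strict_id (L : mlattice) (a b x y : L) :
  mle a x -> mle y b -> strict id x y a b.
Proof.
move=> ax yb; split=> // z [xz zy].
by split; [exact: (mle_trans ax xz)|exact: (mle_trans zy yb)].
Qed.

Lemma dcc_strict (L L' : mlattice) (h : L -> L') a b a' b' :
  strict h a b a' b' -> dcc a' b' -> dcc a b.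
Proof.
move=> [hb hm hs] d P [x0 bx0 Px0].
have [|z [bz [x bx [Px zx xz]]] zmin] := d (fun z => exists2 x, btw (@mle L) a b x &
    [/\ P x, mle z (h x) & mle (h x) z]).
  by exists (h x0); [exact: hb|exists x0 => //; split=> //; exact: mle_refl].
exists x => // y by_ Py yx; apply: hs => //; apply: (mle_trans xz); apply: zmin.
- exact: hb.
- by exists y => //; split=> //; exact: mle_refl.
- by apply: mle_trans xz; apply: hm.
Qed.

Section Transfer.
Variable k : nat.
Hypothesis IHk : forall (L L' : mlattice) (h : L -> L') a b a' b',
  strict h a b a' b' -> mle a b -> art (@mle L') k a' b' -> art (@mle L) k a b.

Section OneLattice.
Variable L : mlattice.
Implicit Types a b x y z : L.
Local Notation "x <~ y" := (mle x y) (at level 70).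
Local Notation art := (art (@mle L)).

Lemma art_sub_IH a b x y : a <~ x -> x <~ y -> y <~ b -> art k a b -> art k x y.
Proof. by move=> ax xy yb; apply: IHk => //; exact: strict_id. Qed.

Lemma jumps_le n a a' b : a <~ a' -> jumps k n a b -> jumps k n a' b.
Proof.
move=> aa'; have S x : btw (@mle L) a' b x -> art k a x -> art k a' x.
  by case=> ax _; apply: art_sub_IH => //; exact: mle_refl.
have B x : btw (@mle L) a' b x -> btw (@mle L) a b x.
  by case=> ax ?; split=> //; exact: (mle_trans aa').
by case: n => [|n] J x bx; have [/(S _ bx)|] := J x (B _ bx); [left| |left|right].
Qed.

Lemma art_meet_join x y z : y <~ z -> art k (meet y x) (meet z x) ->
  art k (join y x) (join z x) -> art k y z.
Proof.
move=> yz am aj; pose t := join y (meet z x).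
have tz : t <~ z by apply: joinP => //; exact: meetl.
have yt : y <~ t by exact: joinl.
apply: (@art_trans _ _ (@mle_refl L) (@mle_trans L) _ _ t).
- apply: (IHk (h := fun u => meet u x)) am => //; split.
  + move=> u [yu ut]; split; apply: meet_mono => //; exact: (mle_trans ut tz).
  + by move=> u v _ _; exact: meet_mono.
  + move=> u v [yu _] [_ vt] uv vu.
    have vz : v <~ meet (join u (meet z x)) v.
      apply: meetP; last exact: mle_refl.
      apply: (mle_trans vt); apply: joinP; last exact: joinr.
      exact: (mle_trans yu (joinl _ _)).
    apply: (mle_trans vz); apply: (mle_trans (modular _ uv)).
    apply: joinP; first exact: mle_refl.
    apply: (mle_trans _ (meetl u x)); apply: (mle_trans _ vu).
    by apply: meetP; [exact: meetr|exact: (mle_trans (meetl _ _) (meetr _ _))].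
- apply: (IHk (h := fun u => join u x)) aj => //; split.
  + move=> u [tu uz]; split; apply: join_mono => //; exact: (mle_trans yt tu).
  + by move=> u v _ _; exact: join_mono.
  + move=> u v [tu _] [_ vz] uv vu; apply: (modular_cancel uv (z := x)) => //.
    apply: meetP; last exact: meetr.
    apply: mle_trans tu; apply: (mle_trans _ (joinr _ _)).
    exact: meet_mono.
Qed.

(** A jump of a chain in [y, b] produces a jump of its meets with x or of its
    joins with x. *)
Lemma jumps_cat p q x y b : y <~ b -> x <~ b ->
  jumps k p (meet y x) x -> jumps k q (join y x) b -> jumps k (p + q) y b.
Proof.
move=> yb xb; have [n En] := ubnP (p + q).
elim: n p q En y yb => // n IH p q En y yb Jp Jq.
have H z : btw (@mle L) y b z -> art k y z \/
    exists p' q', [/\ p' + q' < p + q, jumps k p' (meet z x) x & jumps k q' (join z x) b]%N.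
  move=> [yz zb].
  have bm : btw (@mle L) (meet y x) x (meet z x) by split; [exact: meet_mono|exact: meetr].
  have bj : btw (@mle L) (join y x) b (join z x) by split; [exact: join_mono|exact: joinP].
  have Jp' := jumps_le (proj1 bm) Jp; have Jq' := jumps_le (proj1 bj) Jq.
  have [am|nam] := pselect (art k (meet y x) (meet z x)).
    have [aj|naj] := pselect (art k (join y x) (join z x)).
      by left; exact: art_meet_join aj.
    right; case: q {En} Jq Jq' => [|q] Jq Jq'; have [//|J] := Jq _ bj; first by [].
    by exists p, q; rewrite addnS.
  right; case: p {En} Jp Jp' => [|p] Jp Jp'; have [//|J] := Jp _ bm; first by [].
  by exists p, q; rewrite addSn.
have Jlt m m' : m <= m' -> forall y', jumps k m y' b -> jumps k m' y' b.
  move=> /subnK <-; elim: (m' - m)%N => //= j IHj y' /IHj J z bz.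
  by right; exact: jumps_le (proj1 bz) J.
have R z : btw (@mle L) y b z -> art k y z \/ exists2 m, (m < p + q)%N & jumps k m z b.
  move=> bz; have [?|[p' [q' [lt Jp' Jq']]]] := H z bz; [by left|right].
  exists (p' + q')%N => //; apply: IH => //; last by case: bz.
  by apply: leq_trans lt _.
case: (p + q)%N R => [|m] R z bz; have [c|[m' lt J]] := R z bz; try by left.
by right; exact: Jlt J.
Qed.

Lemma steps_smp i a b : steps (@mle L) i.+1 a b ->
  exists2 j, (j <= i)%N & smp (@mle L) (art j) a b.
Proof.
elim: i => [[//|s]|i IH [/IH[j ji s]|s]]; first by exists 0%N.
  by exists j => //; exact: leqW.
by exists i.+1.
Qed.

Lemma jumps_smp a b : steps (@mle L) k.+1 a b -> jumps k 1 a b.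
Proof.
move=> /steps_smp[j jk [ab _ Pp]] x [ax xb].
have [bx|nbx] := pselect (b <~ x); last by left; apply: art_weaken jk _; exact: Pp.
right=> y [xy yb]; left; apply: Chain0 => //; exact: (mle_trans yb).
Qed.

Lemma art_jumps a b : art k.+1 a b -> exists n, jumps k n a b.
Proof.
elim=> {a b} [a b ab ba|a x b s c [n J]].
  by exists 0 => x [ax xb]; left; apply: Chain0 => //; exact: (mle_trans xb).
have ax := steps_le s.
have xb : x <~ b by exact: (art_le (@mle_trans L) c).
exists (1 + n)%N; apply: (@jumps_cat _ _ x) => //; first exact: (mle_trans ax).
  by apply: jumps_le (jumps_smp s); apply: meetP => //; exact: mle_refl.
by apply: jumps_le J; exact: joinr.
Qed.
End OneLattice.

Lemma jumps_strict n (L L' : mlattice) (h : L -> L') a b a' b' :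
  strict h a b a' b' -> mle a b -> jumps k n a' b' -> jumps k n a b.
Proof.
elim: n a a' => [|n IH] a a' S ab J x bx;
  have [hb hm _] := S; have [ha _] := hb a (conj (mle_refl a) ab);
  have [c|J'] := J _ (hb _ bx).
- left; apply: IHk c; last by case: bx.
  by apply: (strict_sub S) => //; [split=> //; exact: mle_refl|exact: mle_refl].
- by [].
- left; apply: IHk c; last by case: bx.
  by apply: (strict_sub S) => //; [split=> //; exact: mle_refl|exact: mle_refl].
- right; apply: IH J'; last by case: bx.
  apply: (strict_sub S) => //; try exact: mle_refl.
  + by split=> //; exact: mle_refl.
  + by have [] := hb b (conj ab (mle_refl b)).
Qed.
End Transfer.

(** The class of artinian intervals passes to anything that embeds strictly. *)
(** Level k.+1 amounts to the descending chain condition together with a bound on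
    the number of jumps of level k; both are inherited along strict maps. *)
Theorem art_strict k (L L' : mlattice) (h : L -> L') a b a' b' :
  strict h a b a' b' -> mle a b -> art (@mle L') k a' b' -> art (@mle L) k a b.
Proof.
elim: k L L' h a b a' b' => [|k IH] L L' h a b a' b' S ab c.
  case: c S => {a' b'} // a' b' a'b' b'a' [hb hm hs].
  have aa : btw (@mle L) a b a by split=> //; exact: mle_refl.
  have bb : btw (@mle L) a b b by split=> //; exact: mle_refl.
  apply: Chain0 => //; apply: hs => //.
  by apply: (mle_trans (proj2 (hb _ bb))); apply: (mle_trans b'a'); case: (hb _ aa).
have [n J] := art_jumps IH c.
apply: (@jumps_intro _ _ n) => //; first exact: dcc_strict S (chain_steps_dcc c).
exact: jumps_strict IH _ _ _ _ _ _ _ _ S ab J.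
Qed.

Lemma art_sub (L : mlattice) k (a b x y : L) :
  mle a x -> mle x y -> mle y b -> art (@mle L) k a b -> art (@mle L) k x y.
Proof. by move=> ax xy yb; apply: art_strict => //; exact: strict_id. Qed.

Lemma art0_le (T : Type) (le : T -> T -> Prop) a b : art le 0 a b -> le b a.
Proof. by case. Qed.

(** Ascending sequences in an interval of finite length are stationary. *)
Lemma art1_acc (L : mlattice) (a b : L) (c : nat -> L) : art (@mle L) 1 a b ->
  (forall i, btw (@mle L) a b (c i)) -> (forall i, mle (c i) (c i.+1)) ->
  exists i0, forall i, mle (c i) (c i0).
Proof.
move=> Aab; elim: Aab c => {a b} [a b ab ba|a x b s d IH] c cb cm.
  exists 0 => i; have [_ cib] := cb i; have [ac _] := cb 0.
  exact: (mle_trans cib (mle_trans ba ac)).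
have ax := steps_le s.
have xb : mle x b by exact: (art_le (@mle_trans L) d).
have cm' i j : (i <= j)%N -> mle (c i) (c j).
  by move=> /subnK <-; elim: (j - i)%N => [|l IHl]; [exact: mle_refl|exact: (mle_trans IHl)].
have [i0 Hi0] : exists i0, forall i, mle (join (c i) x) (join (c i0) x).
  apply: (IH (fun i => join (c i) x)) => i; last exact: join_mono.
  by split; [exact: joinr|apply: joinP => //; case: (cb i)].
have [i1 Hi1] : exists i1, forall i, mle (meet (c i) x) (meet (c i1) x).
  case: s => [[]//|[_ _ Pp]].
  have [[i1 xi]|nx] := pselect (exists i, mle x (meet (c i) x)).
    by exists i1 => i; exact: (mle_trans (meetr _ _)).
  exists 0 => i; have ca : mle (meet (c i) x) a.
    apply: (@art0_le _ (@mle L)); apply: Pp; last by move=> H; apply: nx; exists i.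
    by split; [apply: meetP => //; case: (cb i)|exact: meetr].
  by apply: (mle_trans ca); apply: meetP => //; case: (cb 0).
exists (maxn i0 i1) => i.
have [le0 le1] := (cm' i0 (maxn i0 i1) (leq_maxl _ _), cm' i1 (maxn i0 i1) (leq_maxr _ _)).
pose j := maxn i (maxn i0 i1).
apply: (mle_trans (cm' i j (leq_maxl _ _))).
apply: (modular_cancel (z := x)); first exact: cm' (leq_maxr _ _).
  by apply: (mle_trans (Hi1 j)); exact: meet_mono.
by apply: (mle_trans (Hi0 j)); exact: join_mono.
Qed.

Local Open Scope ring_scope.

(** * Subfunctors and the Krull filtration *)

Section Transport.
Variable k : fieldType.
Implicit Types F G : functor k.

Lemma sle_refl F (U : subfunctor F) : subf_le U U. Proof. by []. Qed.
Lemma sle_trans F (W U Z : subfunctor F) : subf_le U W -> subf_le W Z -> subf_le U Z.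
Proof. by move=> UW WZ V x /UW /WZ. Qed.

Definition sbot F : subfunctor F := kerF (ntrans_id F).
Definition stop F : subfunctor F := imF (ntrans_id F).

Lemma mem_sbot F V (x : F V) : (x \in sbot F V) = (x == 0).
Proof. by rewrite mem_kerF. Qed.
Lemma mem_stop F V (x : F V) : x \in stop F V.
Proof. exact: (mem_imF (ntrans_id F) x). Qed.
Lemma sbot_le F (U : subfunctor F) : subf_le (sbot F) U.
Proof. by move=> V x; rewrite mem_sbot => /eqP->; exact: rpred0. Qed.
Lemma stop_ge F (U : subfunctor F) : subf_le U (stop F).
Proof. by move=> V x _; exact: mem_stop. Qed.

Section Maps.
Variables (F G : functor k) (phi : ntrans F G).

Definition pushF (U : subfunctor F) : subfunctor G := imF (ntrans_comp phi (sub_incl U)).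

Lemma mem_pushF (U : subfunctor F) V (y : G V) : reflect (exists2 x, x \in U V & phi V x = y) (y \in pushF U V).
Proof.
apply: (iffP (asboolP _)) => [[x <-]|[x Ux <-]]; first by exists (val x) => //; exact: valP.
by exists (exist _ x Ux).
Qed.

Definition pull_pred (X : subfunctor G) (V : vectType k) : {pred F V} := fun x => phi V x \in X V.
Arguments pull_pred X V _ : clear implicits.
Lemma pull_pred_submod (X : subfunctor G) V : submod_closed (pull_pred X V).
Proof.
split; first by rewrite unfold_in linear0 rpred0.
by move=> a x y Xx Xy; rewrite unfold_in linearP rpredD ?rpredZ.
Qed.
HB.instance Definition _ X V :=
  GRing.isSubmodClosed.Build k (F V) (pull_pred X V) (pull_pred_submod X V).
Lemma pull_pred_map (X : subfunctor G) (V W : vectType k) (f : 'Hom(V, W)) x :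
  x \in pull_pred X V -> fmap F f x \in pull_pred X W.
Proof. by move=> Xx; rewrite unfold_in ntrans_nat; exact: subf_map. Qed.
Definition pullF X : subfunctor F :=
  @SubFunctor k F (fun V => pull_pred X V : submodClosed _) (@pull_pred_map X).
Lemma mem_pullF (X : subfunctor G) V (x : F V) : (x \in pullF X V) = (phi V x \in X V).
Proof. by []. Qed.

Lemma push_mono (U W : subfunctor F) : subf_le U W -> subf_le (pushF U) (pushF W).
Proof. by move=> UW V y /mem_pushF[x /UW Wx <-]; apply/mem_pushF; exists x. Qed.
Lemma pull_mono (X Y : subfunctor G) : subf_le X Y -> subf_le (pullF X) (pullF Y).
Proof. by move=> XY V x; rewrite !mem_pullF => /XY. Qed.

(** The subfunctors of the source of a monomorphism are those of its image. *)
Lemma push_iso (U W : subfunctor F) : (forall V, injective (phi V)) ->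
  order_iso (@subf_le k F) (@subf_le k G) pushF pullF U W (pushF U) (pushF W).
Proof.
move=> inj; have gf X : subf_le (pullF (pushF X)) X /\ subf_le X (pullF (pushF X)).
  split=> V x; rewrite mem_pullF; first by move=> /mem_pushF[y Xy /inj <-].
  by move=> Xx; apply/mem_pushF; exists x.
split=> //.
- by move=> X Y _ _; exact: push_mono.
- by move=> X Y _ _; exact: pull_mono.
- by move=> X [UX XW]; split; exact: push_mono.
- move=> X [UX XW]; split.
    exact: sle_trans (proj2 (gf U)) (pull_mono UX).
  exact: sle_trans (pull_mono XW) (proj1 (gf W)).
- move=> X [UX XW]; split=> V y; first by move=> /mem_pushF[x]; rewrite mem_pullF => Xx <-.
  move=> Xy; have /mem_pushF[x Wx xy] := XW _ _ Xy.
  by apply/mem_pushF; exists x; rewrite ?mem_pullF xy.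
Qed.

(** The subfunctors of a quotient are those containing the kernel. *)
Lemma pull_iso (X Y : subfunctor G) : (forall V y, exists x, phi V x = y) ->
  order_iso (@subf_le k G) (@subf_le k F) pullF pushF X Y (pullF X) (pullF Y).
Proof.
move=> surj; have fg Z : subf_le (pushF (pullF Z)) Z /\ subf_le Z (pushF (pullF Z)).
  split=> V y; first by move=> /mem_pushF[x]; rewrite mem_pullF => Zx <-.
  by have [x <-] := surj V y => Zx; apply/mem_pushF; exists x.
split=> //.
- by move=> ? ? _ _; exact: pull_mono.
- by move=> ? ? _ _; exact: push_mono.
- by move=> Z [XZ ZY]; split; exact: pull_mono.
- move=> Z [XZ ZY]; split.
    exact: sle_trans (proj2 (fg X)) (push_mono XZ).
  exact: sle_trans (push_mono ZY) (proj1 (fg Y)).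
- move=> Z [XZ _]; split=> V x; last by move=> Zx; rewrite mem_pullF; apply/mem_pushF; exists x.
  rewrite mem_pullF => /mem_pushF[y Zy xy].
  rewrite -[x](subrK y) rpredD //; apply: XZ.
  by rewrite mem_pullF linearB xy subrr rpred0.
Qed.
End Maps.

Lemma steps_eq F n (U W U' W' : subfunctor F) : subf_le U U' -> subf_le U' U ->
  subf_le W W' -> subf_le W' W -> steps (@subf_le k F) n U W -> steps (@subf_le k F) n U' W'.
Proof.
move=> UU' U'U WW' W'W s; have UW := steps_le s.
have UW' := sle_trans U'U (sle_trans UW WW').
exact: (steps_iso (@sle_refl F) (@sle_trans F) (@sle_refl F) (@sle_trans F)
  (iso_eql (@sle_refl F) (@sle_trans F) UU' U'U WW' W'W) UW' s).
Qed.

Lemma sub_steps F (U : subfunctor F) n (X Y : subfunctor (subF U)) : subf_le X Y ->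
  steps (@subf_le k (subF U)) n X Y <->
  steps (@subf_le k F) n (pushF (sub_incl U) X) (pushF (sub_incl U) Y).
Proof.
move=> XY; have I := push_iso X Y (fun V => val_inj : injective (sub_incl U V)).
split; apply: (steps_iso (@sle_refl _) (@sle_trans _) (@sle_refl _) (@sle_trans _)).
- exact: I.
- exact: push_mono.
- exact: (iso_sym I).
- exact: XY.
Qed.

Lemma push_stop F (U : subfunctor F) :
  subf_le (pushF (sub_incl U) (stop _)) U /\ subf_le U (pushF (sub_incl U) (stop _)).
Proof.
split=> V y; first by move=> /mem_pushF[x _ <-]; exact: valP.
by move=> Uy; apply/mem_pushF; exists (exist _ y Uy) => //; exact: mem_stop.
Qed.

Lemma push_restr F (U W : subfunctor F) : subf_le U W ->
  subf_le (pushF (sub_incl W) (subf_restr U W)) U /\ subf_le U (pushF (sub_incl W) (subf_restr U W)).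
Proof.
move=> UW; split=> V y; first by move=> /mem_pushF[x Ux <-]; exact: Ux.
move=> Uy; apply/mem_pushF; have Wy := UW _ _ Uy.
by exists (exist _ y Wy).
Qed.

Lemma push_sbot F (U : subfunctor F) :
  subf_le (pushF (sub_incl U) (sbot _)) (sbot _) /\ subf_le (sbot _) (pushF (sub_incl U) (sbot _)).
Proof.
split; last exact: sbot_le.
by move=> V y /mem_pushF[x]; rewrite !mem_sbot => /eqP-> <-.
Qed.

Lemma quot_nat F (U : subfunctor F) (V W : vectType k) (f : 'Hom(V, W)) (x : F V) :
  quotproj (U W) (fmap F f x) = fmap (quotF U) f (quotproj (U V) x).
Proof. by rewrite [RHS]quot_mapE. Qed.
Definition quot_ntrans F (U : subfunctor F) : ntrans F (quotF U) :=
  @NTrans k F (quotF U) (fun V => quotproj (U V)) (@quot_nat F U).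

(** The subfunctors of W / U are those of W containing U, and the subfunctors of W
    are subfunctors of F. *)
Lemma subquot_steps F (U W : subfunctor F) n : subf_le U W ->
  steps (@subf_le k (subquotF U W)) n (sbot _) (stop _) <-> steps (@subf_le k F) n U W.
Proof.
move=> UW; pose q := quot_ntrans (subf_restr U W).
have surj V (y : subquotF U W V) : exists x, q V x = y.
  by exists (quot_repr (y : quotmod _)); exact: quot_reprK.
have I := pull_iso (sbot _) (stop _) surj.
have pb : subf_le (pullF q (sbot _)) (subf_restr U W) /\ subf_le (subf_restr U W) (pullF q (sbot _)).
  split=> V x; rewrite mem_pullF mem_sbot.
    move=> /eqP; rewrite -[RHS](linear0 (quotproj (subf_restr U W V))).
    by move/quotproj_eq; rewrite subr0.
  move=> Ux; apply/eqP; rewrite -[RHS](linear0 (quotproj (subf_restr U W V))).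
  by apply/quotproj_eq; rewrite subr0.
have pt : subf_le (pullF q (stop _)) (stop _) /\ subf_le (stop _) (pullF q (stop _)).
  by split; [exact: stop_ge|move=> V x _; rewrite mem_pullF mem_stop].
have [rU Ur] := push_restr UW; have [tW Wt] := push_stop W.
have RT : subf_le (subf_restr U W) (stop _) by exact: stop_ge.
split=> s.
- have := steps_iso (@sle_refl _) (@sle_trans _) (@sle_refl _) (@sle_trans _) I
    (pull_mono (@stop_ge _ _)) s.
  move/(steps_eq (proj1 pb) (proj2 pb) (proj1 pt) (proj2 pt)).
  by move/(sub_steps _ RT)/(steps_eq rU Ur tW Wt).
- move: s => /(steps_eq Ur rU Wt tW)/(sub_steps _ RT).
  move/(steps_eq (proj2 pb) (proj1 pb) (proj2 pt) (proj1 pt)).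
  apply: (steps_iso (@sle_refl _) (@sle_trans _) (@sle_refl _) (@sle_trans _) (iso_sym I)).
  exact: stop_ge.
Qed.

Lemma chain_seq (T : Type) (le S : T -> T -> Prop) a b :
  (forall x y, S x y -> le x y) -> chain le S a b ->
  exists l (U : nat -> T), [/\ U 0%N = a, le (U l) b, le b (U l) & forall i, (i < l)%N -> S (U i) (U i.+1)].
Proof.
move=> Sle; elim=> {a b} [a b ab ba|a x b Sax _ [l [U [U0 lb bl SU]]]].
  by exists 0%N, (fun=> a).
exists l.+1, (fun i => if i is j.+1 then U j else a); split=> // -[|i] il.
  by rewrite U0.
exact: SU.
Qed.

Lemma seq_chain (T : Type) (le S : T -> T -> Prop) l (U : nat -> T) b :
  le (U l) b -> le b (U l) -> (forall i, (i < l)%N -> S (U i) (U i.+1)) -> chain le S (U 0%N) b.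
Proof.
elim: l U => [|l IH] U lb bl SU; first exact: Chain0.
apply: (@ChainS _ _ _ _ (U 1%N)); first exact: SU.
by apply: (IH (fun i => U i.+1)) => // i il; exact: SU.
Qed.

Lemma artinian_art m F :
  (forall G, simple_artinian_le m G <-> steps (@subf_le k G) m.+1 (sbot G) (stop G)) ->
  artinian m F <-> art (@subf_le k F) m.+1 (sbot F) (stop F).
Proof.
move=> Sm; split=> [[l [U [U0 Ul SU]]]|].
- have b0 : subf_le (U 0%N) (sbot F) by move=> V x /U0 ->; rewrite mem_sbot.
  apply: (art_eql (@sle_refl F) (@sle_trans F) b0 (@sbot_le _ _) (@sle_refl _ _) (@sle_refl _ _)).
  apply: (@seq_chain _ _ _ l U).
  + exact: stop_ge.
  + by move=> V x _; exact: Ul.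
  + by move=> i /SU[Ui /Sm]; apply: (proj1 (subquot_steps _ Ui)).
- move=> /(chain_seq (@steps_le _ _ _))[l [U [U0 lb bl SU]]].
  exists l, U; split.
  + by move=> V x; rewrite U0 mem_sbot => /eqP.
  + by move=> V x; apply: bl; exact: mem_stop.
  + move=> i /SU s; have Ui := steps_le s; split=> //.
    by apply/Sm/subquot_steps.
Qed.

Lemma sub_art F (U : subfunctor F) n :
  art (@subf_le k (subF U)) n (sbot _) (stop _) <-> art (@subf_le k F) n (sbot F) U.
Proof.
have I := push_iso (sbot _) (stop _) (fun V => val_inj : injective (sub_incl U V)).
have [b1 b2] := push_sbot U; have [t1 t2] := push_stop U.
split=> a.
- apply: (art_eql (@sle_refl F) (@sle_trans F) b1 b2 t1 t2).
  apply: (art_iso (@sle_refl _) (@sle_trans _) (@sle_refl _) (@sle_trans _) I _ a).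
  by apply: push_mono; exact: stop_ge.
- apply: (art_iso (@sle_refl _) (@sle_trans _) (@sle_refl _) (@sle_trans _) (iso_sym I) (@stop_ge _ _)).
  apply: (art_eql (@sle_refl F) (@sle_trans F) b2 b1 t2 t1 a).
Qed.

Lemma subf_fullP F (U : subfunctor F) : subf_full U <-> subf_le (stop F) U.
Proof. by split=> H V x; [move=> _; exact: H|apply: H; exact: mem_stop]. Qed.

Lemma simple_steps m F : simple_artinian_le m F <-> steps (@subf_le k F) m.+1 (sbot F) (stop F).
Proof.
elim: m F => [|m IH] F.
- split.
  + move=> [[V [x nx]] sF]; right; split; first exact: stop_ge.
      by move=> a0; have := art0_le a0 V x (mem_stop x); rewrite mem_sbot => /eqP.
    move=> U _ nU; apply: Chain0; first exact: sbot_le.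
    by have [U0|/subf_fullP //] := sF U; move=> V' x' /U0 ->; rewrite mem_sbot.
  + move=> [//|[_ nP sF]]; split.
      apply: contrapT => nx; apply: nP; apply: Chain0; first exact: stop_ge.
      move=> V x _; rewrite mem_sbot; apply/eqP; apply: contrapT => x0.
      by apply: nx; exists V, x.
    move=> U; have [/subf_fullP|nU] := pselect (subf_le (stop F) U); [by right|left].
    have a0 := sF U (conj (@sbot_le _ _) (@stop_ge _ _)) nU.
    by move=> V x /(art0_le a0 V x); rewrite mem_sbot => /eqP.
- have A G := @artinian_art m G IH.
  have E : (~ filtered_by (simple_artinian_le m) F /\
       forall U : subfunctor F, ~ subf_full U -> filtered_by (simple_artinian_le m) (subF U)) <->
     smp (@subf_le k F) (art (@subf_le k F) m.+1) (sbot F) (stop F).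
    split=> [[nF sF]|[_ nF sF]]; split.
    + exact: stop_ge.
    + by move/A.
    + by move=> U _ nU; apply/sub_art/A/sF => /subf_fullP.
    + by move/A.
    + by move=> U nU; apply/A/sub_art/sF; [split; [exact: sbot_le|exact: stop_ge]|move=> /subf_fullP].
  by split=> [[/IH|/E]|[/IH|/E]] H; [left|right|left|right].
Qed.

(** Level m.+1 of the lattice of subfunctors is type m. *)
Theorem simple_artinianP m F : simple_artinian m.+1 F <->
  ~ art (@subf_le k F) m.+1 (sbot F) (stop F) /\
  forall U : subfunctor F, ~ subf_full U -> art (@subf_le k F) m.+1 (sbot F) U.
Proof.
have A G := @artinian_art m G (@simple_steps m).
split=> -[nF sF]; split=> [/A //|U nU]; first by apply/sub_art/A/sF.
by apply/A/sub_art/sF.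
Qed.
End Transport.

(** * Functors of functions *)

Notation F := 'F_2.

Lemma F2_addxx (x : F) : x + x = 0.
Proof. by case: x => [[|[|//]]] i; exact: val_inj. Qed.
Lemma F2_cases (x : F) : x = 0 \/ x = 1.
Proof. by case: x => [[|[|//]]] i; [left|right]; exact: val_inj. Qed.
Lemma F2_neq0 (x : F) : x <> 0 -> x = 1.
Proof. by case: (F2_cases x). Qed.
Lemma mx_addxx m n (x : 'M[F]_(m, n)) : x + x = 0.
Proof. by apply/matrixP => i j; rewrite !mxE F2_addxx. Qed.
Lemma F2_addK (x y : F) : x + y + y = x.
Proof. by rewrite -addrA F2_addxx addr0. Qed.
Lemma mx_addK m n (x y : 'M[F]_(m, n)) : x + y + y = x.
Proof. by rewrite -addrA mx_addxx addr0. Qed.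
Lemma F2_eq (x y : F) : x + y = 0 -> x = y.
Proof. by move=> xy; rewrite -[x](F2_addK x y) xy add0r. Qed.

(** The object and arrow maps of a functor from matrices to sets. *)
Record points := Points {
  pt :> nat -> Type;
  pact : forall d d', 'M[F]_(d, d') -> pt d -> pt d' }.

Definition zfun (T : Type) : T -> F := fun=> 0.
Definition afun (T : Type) (f g : T -> F) : T -> F := fun p => f p + g p.

Lemma afun0 (T : Type) (f : T -> F) : afun f (@zfun T) = f.
Proof. by apply/funext => p; exact: addr0. Qed.
Lemma afunxx (T : Type) (f : T -> F) : afun f f = @zfun T.
Proof. by apply/funext => p; exact: F2_addxx. Qed.
Lemma afunC (T : Type) (f g : T -> F) : afun f g = afun g f.
Proof. by apply/funext => p; exact: addrC. Qed.
Lemma afunA (T : Type) (f g h : T -> F) : afun f (afun g h) = afun (afun f g) h.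
Proof. by apply/funext => p; exact: addrA. Qed.
Lemma afunK (T : Type) (f g : T -> F) : afun (afun f g) g = f.
Proof. by rewrite -afunA afunxx afun0. Qed.

(** A subfunctor of the contravariant functor d |-> (P d -> F_2). *)
Record csub (P : points) := CSub {
  csat :> forall d, (P d -> F) -> Prop;
  cs0 : forall d, csat (@zfun (P d));
  csD : forall d (f g : P d -> F), csat f -> csat g -> csat (afun f g);
  csM : forall d d' (g : 'M[F]_(d, d')) (f : P d' -> F),
    csat f -> csat (f \o pact g) }.

Section CSubLattice.
Variable P : points.
Implicit Types U W Z : csub P.

Definition csle U W := forall d (f : P d -> F), U d f -> W d f.

Lemma csle_refl U : csle U U. Proof. by []. Qed.
Lemma csle_trans W U Z : csle U W -> csle W Z -> csle U Z.
Proof. by move=> UW WZ d f /UW /WZ. Qed.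

Definition csmeet U W : csub P.
refine (@CSub P (fun d f => U d f /\ W d f) _ _ _).
- by move=> d; split; exact: cs0.
- by move=> d f g [? ?] [? ?]; split; exact: csD.
- by move=> d d' g f [? ?]; split; exact: csM.
Defined.

Definition csjoin U W : csub P.
refine (@CSub P (fun d f => exists f1 f2, [/\ U d f1, W d f2 & f = afun f1 f2]) _ _ _).
- by move=> d; exists (@zfun _), (@zfun _); rewrite afun0; split=> //; exact: cs0.
- move=> d _ _ [f1 [f2 [Uf Wf ->]]] [g1 [g2 [Ug Wg ->]]].
  exists (afun f1 g1), (afun f2 g2); split; try exact: csD.
  by apply/funext => p; exact: addrACA.
- move=> d d' g _ [f1 [f2 [Uf Wf ->]]]; exists (f1 \o pact g), (f2 \o pact g).
  by split=> //; exact: csM.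
Defined.

Lemma csmeetP U W Z : csle Z U -> csle Z W -> csle Z (csmeet U W).
Proof. by move=> ZU ZW d f Zf; split; [exact: ZU|exact: ZW]. Qed.
Lemma csjoinl U W : csle U (csjoin U W).
Proof. by move=> d f Uf; exists f, (@zfun _); rewrite afun0; split=> //; exact: cs0. Qed.
Lemma csjoinr U W : csle W (csjoin U W).
Proof.
by move=> d f Wf; exists (@zfun _), f; rewrite afunC afun0; split=> //; exact: cs0.
Qed.
Lemma csjoinP U W Z : csle U Z -> csle W Z -> csle (csjoin U W) Z.
Proof. by move=> UZ WZ d _ [f [g [/UZ ? /WZ ? ->]]]; exact: csD. Qed.
Lemma cs_modular U W Z : csle U Z ->
  csle (csmeet (csjoin U W) Z) (csjoin U (csmeet W Z)).
Proof.
move=> UZ d _ [[f [g [Uf Wg ->]]] Zfg]; exists f, g; split=> //; split=> //.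
by rewrite -[g](afunK g f) (afunC g); apply: csD => //; exact: UZ.
Qed.

Definition cslat : mlattice := @MLattice (csub P) csle csmeet csjoin csle_refl
  csle_trans (fun U W d f => @proj1 _ _) (fun U W d f => @proj2 _ _) csmeetP
  csjoinl csjoinr csjoinP cs_modular.

Definition csbot : csub P.
refine (@CSub P (fun d f => f = @zfun _) _ _ _) => //.
- by move=> d _ _ -> ->; rewrite afun0.
- by move=> d d' g _ ->.
Defined.
Lemma csbot_le U : csle csbot U.
Proof. by move=> d _ ->; exact: cs0. Qed.

Definition cstop : csub P.
by refine (@CSub P (fun d f => True) _ _ _).
Defined.
End CSubLattice.

Notation cart k := (@art (csub _) (@csle _) k).

Record nop (P P' : points) := NOp {
  nopat :> forall d, (P d -> F) -> (P' d -> F);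
  nopD : forall d (f g : P d -> F), nopat (afun f g) = afun (nopat f) (nopat g);
  nop_nat : forall d d' (g : 'M[F]_(d, d')) (f : P d' -> F),
    nopat (f \o pact g) = nopat f \o pact g }.

Section NOp.
Variables (P P' : points) (o : nop P P').

Lemma nop0 d : o d (@zfun _) = @zfun _.
Proof. by rewrite -{1}(afunxx (@zfun (P d))) nopD afunxx. Qed.

Definition csim (U : csub P) : csub P'.
refine (@CSub P' (fun d f => exists2 g, U d g & f = o d g) _ _ _).
- by move=> d; exists (@zfun _); [exact: cs0|rewrite nop0].
- by move=> d _ _ [f Uf ->] [g Ug ->]; exists (afun f g); [exact: csD|rewrite nopD].
- by move=> d d' g _ [f Uf ->]; exists (f \o pact g); [exact: csM|rewrite nop_nat].
Defined.

(** A natural operator whose kernel lies in A makes [A, B] embed in its image. *)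
Lemma art_nop k (A B : csub P) (S : csub P') : csle A B ->
  (forall d f, B d f -> o d f = @zfun _ -> A d f) ->
  (forall d f, B d f -> S d (o d f)) ->
  cart k (csbot P') S -> cart k A B.
Proof.
move=> AB oA oS; apply: (@art_strict _ (cslat P) (cslat P') csim) => //; split.
- move=> U [AU UB]; split; first exact: csbot_le.
  by move=> d _ [f Uf ->]; apply: oS; exact: UB.
- by move=> U W _ _ UW d _ [f Uf ->]; exists f => //; exact: UW.
- move=> U W [AU _] [_ WB] UW WU d f Wf.
  have [g Ug fg] : csim U d (o d f) by apply: WU; exists f.
  rewrite -[f](afunK f g); apply: csD => //; apply: AU; apply: oA.
    by apply: csD; apply: WB => //; exact: UW.
  by rewrite nopD fg afunxx.
Qed.
End NOp.

(** N-tuples of vectors, the rows of a matrix. *)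
Definition mpt N := Points (pt := fun d => 'M[F]_(N, d)) (fun d d' g p => p *m g).

Definition prec N N' (A : 'M[F]_(N, N')) : nop (mpt N) (mpt N').
refine (@NOp (mpt N) (mpt N') (fun d f p => f (A *m p)) _ _) => //.
by move=> d d' g f; apply/funext => p /=; rewrite mulmxA.
Defined.

Definition nopA P P' (o o' : nop P P') : nop P P'.
refine (@NOp P P' (fun d f => afun (o d f) (o' d f)) _ _).
- by move=> d f g; rewrite !nopD; apply/funext => p; exact: addrACA.
- by move=> d d' g f; rewrite !nop_nat.
Defined.

(** * Differences *)
Section Differences.
Variable N : nat.
Implicit Types (s : seq 'cV[F]_N).

Definition dl d (h : 'M[F]_(N, d)) (f : 'M[F]_(N, d) -> F) : 'M[F]_(N, d) -> F :=
  fun p => f (p + h) + f p.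

(** The iterated differences of f vanish along all rank one matrices c *m e, where c
    runs over the word s and the rows e are arbitrary. *)
Fixpoint killw d s (f : 'M[F]_(N, d) -> F) : Prop :=
  if s is c :: s' then forall e : 'rV[F]_d, killw s' (dl (c *m e) f)
  else forall p, f p = 0.

Lemma dlD d h (f g : 'M[F]_(N, d) -> F) : dl h (afun f g) = afun (dl h f) (dl h g).
Proof. by apply/funext => p; exact: addrACA. Qed.
Lemma dlC d h h' (f : 'M[F]_(N, d) -> F) : dl h (dl h' f) = dl h' (dl h f).
Proof. by apply/funext => p; rewrite /dl addrACA (addrAC p). Qed.
Lemma dl0 d h : dl h (@zfun 'M[F]_(N, d)) = @zfun _.
Proof. by apply/funext => p; exact: addr0. Qed.

Lemma killw0 d s : killw s (@zfun 'M[F]_(N, d)).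
Proof. by elim: s => //= c s IH e; rewrite dl0. Qed.
Lemma killwD d s (f g : 'M[F]_(N, d) -> F) :
  killw s f -> killw s g -> killw s (afun f g).
Proof.
elim: s f g => /= [f g f0 g0 p|c s IH f g Kf Kg e].
  by rewrite /afun f0 g0 addr0.
by rewrite dlD; exact: IH.
Qed.

Lemma dl_pull d d' (g : 'M[F]_(d, d')) h (f : 'M[F]_(N, d') -> F) :
  dl h (f \o mulmx^~ g) = dl (h *m g) f \o mulmx^~ g.
Proof. by apply/funext => p; rewrite /dl /= mulmxDl. Qed.

Lemma killw_pull d d' (g : 'M[F]_(d, d')) s (f : 'M[F]_(N, d') -> F) :
  killw s f -> killw s (f \o mulmx^~ g).
Proof.
elim: s f => /= [f f0 p|c s IH f Kf e]; first exact: f0.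
by rewrite dl_pull -mulmxA; exact: IH.
Qed.

Definition shift d (h : 'M[F]_(N, d)) (f : 'M[F]_(N, d) -> F) : 'M[F]_(N, d) -> F :=
  fun p => f (p + h).
Lemma dl_shift d h h' (f : 'M[F]_(N, d) -> F) : dl h (shift h' f) = shift h' (dl h f).
Proof. by apply/funext => p; rewrite /dl /shift addrAC. Qed.
Lemma dlE d h (f : 'M[F]_(N, d) -> F) : dl h f = afun (shift h f) f.
Proof. by []. Qed.
Lemma killw_shift d s h (f : 'M[F]_(N, d) -> F) : killw s f -> killw s (shift h f).
Proof.
elim: s f => /= [f f0 p|c s IH f Kf e]; first exact: f0.
by rewrite dl_shift; exact: IH.
Qed.
Lemma killw_dl d s h (f : 'M[F]_(N, d) -> F) : killw s f -> killw s (dl h f).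
Proof. by move=> K; rewrite dlE; apply: killwD => //; exact: killw_shift. Qed.

Lemma killw_catl d s s' (f : 'M[F]_(N, d) -> F) :
  killw s f -> killw (s' ++ s) f.
Proof. by elim: s' f => //= c s' IH f K e; apply: IH; exact: killw_dl. Qed.

Lemma killw_mid d s1 c s2 (f : 'M[F]_(N, d) -> F) :
  killw (s1 ++ c :: s2) f <-> killw (c :: s1 ++ s2) f.
Proof.
elim: s1 f => //= c' s IH f; split=> K e.
  by move=> e'; rewrite dlC; move: e; apply/IH.
by apply/IH => e'; rewrite dlC; exact: K.
Qed.

Lemma killw_perm d s s' (f : 'M[F]_(N, d) -> F) : perm_eq s s' -> killw s f -> killw s' f.
Proof.
elim: s s' f => [|c s IH] s' f; first by rewrite perm_sym => /perm_nilP ->.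
move=> ps; have cs' : c \in s' by rewrite -(perm_mem ps) mem_head.
case/splitPr: cs' ps => s1 s2 ps K.
apply/killw_mid => e; apply: IH (K e).
rewrite -(perm_cons c); apply: perm_trans ps _.
by rewrite perm_catC /= perm_cons perm_catC.
Qed.

Lemma killw_count d s s' (f : 'M[F]_(N, d) -> F) :
  (forall c, count_mem c s <= count_mem c s')%N -> killw s f -> killw s' f.
Proof.
move=> /count_subseqP[u su pu] /(killw_perm pu) {s pu}.
elim: s' u su f => [|c s IH] u; first by rewrite subseq0 => /eqP->.
case: u => [|c' u] /=.
  move=> _ f f0 e; apply: (IH [::]) => [|p]; first exact: sub0seq.
  by rewrite /dl !f0 addr0.
case: eqP => [->|_] su f K e; first exact: IH (K e).
by apply: IH su _ _; exact: (@killw_dl _ (c' :: u)).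
Qed.

(** For T everything, these are the polynomial functions of degree less than m. *)
Definition killn m (T : {pred 'cV[F]_N}) d (f : 'M[F]_(N, d) -> F) :=
  forall s, size s = m -> {subset s <= T} -> killw s f.
End Differences.

Lemma dl_prec N N' d (A : 'M[F]_(N, N')) h (f : 'M[F]_(N, d) -> F) :
  dl h (fun p => f (A *m p)) = (fun p => dl (A *m h) f (A *m p)).
Proof. by apply/funext => p; rewrite /dl mulmxDr. Qed.

Lemma killw_prec N N' d (A : 'M[F]_(N, N')) s (f : 'M[F]_(N, d) -> F) :
  killw (map (mulmx A) s) f -> killw s (fun p : 'M[F]_(N', d) => f (A *m p)).
Proof.
elim: s f => /= [f f0 p|c s IH f Kf e]; first exact: f0.
by rewrite dl_prec; apply: IH; rewrite mulmxA; exact: Kf.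
Qed.

Section KillSub.
Variable N : nat.

Definition killws (s : seq 'cV[F]_N) : csub (mpt N) :=
  @CSub (mpt N) (fun d f => killw s f) (fun d => killw0 d s)
    (fun d f g => @killwD N d s f g) (fun d d' g f => @killw_pull N d d' g s f).

Definition killns (m : nat) (T : {pred 'cV[F]_N}) : csub (mpt N).
refine (@CSub (mpt N) (fun d f => killn m T f) _ _ _).
- by move=> d s _ _; exact: killw0.
- by move=> d f g Kf Kg s ss sT; apply: killwD; [exact: Kf|exact: Kg].
- by move=> d d' g f Kf s ss sT; apply: killw_pull; exact: Kf.
Defined.

Lemma killn_dl m T d (f : 'M[F]_(N, d) -> F) c e : c \in T -> killn m.+1 T f -> killn m T (dl (c *m e) f).
Proof.
move=> cT K s ss sT; move: e; apply: (K (c :: s)); first by rewrite /= ss.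
by move=> x; rewrite in_cons => /predU1P[->//|]; exact: sT.
Qed.
Lemma killn_shift m T d (f : 'M[F]_(N, d) -> F) h : killn m T f -> killn m T (shift h f).
Proof. by move=> K s ss sT; apply: killw_shift; exact: K. Qed.
Lemma killn_dlw m T d (f : 'M[F]_(N, d) -> F) h : killn m T f -> killn m T (dl h f).
Proof. by move=> K s ss sT; apply: killw_dl; exact: K. Qed.
Lemma killn0 T d (f : 'M[F]_(N, d) -> F) : killn 0 T f -> f = @zfun _.
Proof. by move=> /(_ [::] erefl) K; apply/funext; apply: K. Qed.
End KillSub.

Lemma cart_trans P k (U W Z : csub P) : cart k U W -> cart k W Z -> cart k U Z.
Proof. exact: (art_trans (@csle_refl P) (@csle_trans P)). Qed.
Lemma cart_sub P k (A B U W : csub P) :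
  csle A U -> csle U W -> csle W B -> cart k A B -> cart k U W.
Proof. exact: (@art_sub (cslat P)). Qed.
Lemma cart_weaken P k l (U W : csub P) : (k <= l)%N -> cart k U W -> cart l U W.
Proof. exact: art_weaken. Qed.
Lemma cart_refl P k (U W : csub P) : csle U W -> csle W U -> cart k U W.
Proof. exact: art_refl. Qed.

(** * The shift criterion *)

Lemma const_simple (U : csub (mpt 0)) : ~ csle U (csbot _) -> csle (cstop _) U.
Proof.
move=> /existsNP[d /existsNP[f /not_implyP[Uf nf]]] d' f' _.
have f1 : f = fun=> 1.
  apply/funext => p; apply: F2_neq0 => fp; apply: nf; apply/funext => q.
  by apply: etrans fp; congr f; apply/matrixP => -[].
have [f'0|/F2_neq0 f'0] := pselect (f' 0 = 0).
  suff -> : f' = @zfun _ by exact: cs0.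
  by apply/funext => p; apply: etrans f'0; congr f'; apply/matrixP => -[].
suff -> : f' = f \o pact (p := mpt 0) (0 : 'M_(d', d)) by exact: csM.
apply/funext => p; rewrite f1 -f'0; congr f'; by apply/matrixP => -[].
Qed.

Lemma cart_const : cart 1 (csbot (mpt 0)) (cstop (mpt 0)).
Proof.
apply: art_proper; [exact: csle_refl|exact: csbot_le|move=> U _ nU].
apply: cart_refl; first exact: csbot_le.
by apply: contrapT => /const_simple.
Qed.

Section Shift.
Variables (k N : nat) (G : seq 'cV[F]_N).
Hypothesis Ggen : forall f : 'cV[F]_N -> F,
  (forall c, c \in G -> forall x, f (x + c) = f x) -> forall x, f x = f 0.

(** Points with an additional parameter in F_2^N, on which matrices do not act. *)
Let kpt := Points (pt := fun d => ('cV[F]_N * 'M[F]_(N, d))%type)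
  (fun d d' g q => (q.1, q.2 *m g)).

(** The members of U in dimension d + 1, their last coordinates being taken as the
    parameter. *)
Let Sh (U : csub (mpt N)) : csub kpt.
refine (@CSub kpt (fun d f => exists2 phi, U (d + 1)%N phi &
  f = fun q => phi (row_mx q.2 q.1)) _ _ _).
- by move=> d; exists (@zfun _) => //; exact: cs0.
- move=> d _ _ [f Uf ->] [g Ug ->]; exists (afun f g) => //; exact: csD.
- move=> d d' g _ [f Uf ->].
  exists (f \o pact (p := mpt N) (block_mx g 0 0 1%:M)); first exact: csM.
  apply/funext => -[x p] /=; congr f.
  by rewrite mul_row_block !mulmx0 mulmx1 addr0 add0r.
Defined.

(** The members of U as functions that do not depend on the parameter. *)
Let Pb (U : csub (mpt N)) : csub kpt.
refine (@CSub kpt (fun d f => exists2 phi, U d phi & f = fun q => phi q.2) _ _ _).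
- by move=> d; exists (@zfun _) => //; exact: cs0.
- by move=> d _ _ [f Uf ->] [g Ug ->]; exists (afun f g) => //; exact: csD.
- move=> d d' g _ [f Uf ->]; exists (f \o pact (p := mpt N) g) => //; exact: csM.
Defined.

Let proj d : 'M[F]_(d + 1, d) := col_mx 1%:M 0.
Let inj d : 'M[F]_(d, d + 1) := row_mx 1%:M 0.

Let Pb_Sh U : csle (Pb U) (Sh U).
Proof.
move=> d _ [phi Uphi ->]; exists (phi \o pact (p := mpt N) (proj d)); first exact: csM.
by apply/funext => -[x p] /=; rewrite mul_row_col mulmx1 mulmx0 addr0.
Qed.

Let delta (x c : 'cV[F]_N) : nop kpt (mpt N).
refine (@NOp kpt (mpt N) (fun d f p => f (x + c, p) + f (x, p)) _ _) => //.
by move=> d f g; apply/funext => p; exact: addrACA.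
Defined.

(** The functions unchanged when the parameter moves from x to x + c, for (x, c)
    in L. *)
Let PL (B : csub (mpt N)) (L : seq ('cV[F]_N * 'cV[F]_N)) : csub kpt.
refine (@CSub kpt (fun d f => Sh B d f /\
  forall xc, xc \in L -> delta xc.1 xc.2 d f = @zfun _) _ _ _).
- by move=> d; split=> [|xc _]; [exact: cs0|exact: nop0].
- move=> d f g [Bf Hf] [Bg Hg]; split=> [|xc xcL]; first exact: csD.
  by rewrite nopD Hf // Hg // afun0.
- move=> d d' g f [Bf Hf]; split=> [|xc xcL]; first exact: csM.
  by rewrite nop_nat Hf.
Defined.

Let pos (B : csub (mpt N)) : csub (mpt N).
refine (@CSub (mpt N) (fun d f => B d f /\ f 0 = 0) _ _ _).
- by move=> d; split=> //; exact: cs0.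
- by move=> d f g [? f0] [? g0]; split; [exact: csD|rewrite /afun f0 g0 addr0].
- by move=> d d' g f [? f0]; split; [exact: csM|rewrite /= mul0mx].
Defined.

(** A subfunctor of B is determined by its members in dimension d + 1, seen as
    functions of the last coordinates x, modulo functions not involving x. As G
    generates, these are controlled by their differences x |-> x + c, c in G. *)
Lemma cart_shift (B : csub (mpt N)) :
  (forall c, c \in G -> exists2 S : csub (mpt N), cart k.+1 (csbot _) S &
     forall d (f : 'M[F]_(N, d + 1) -> F), B (d + 1)%N f ->
       forall x, S d (fun p => f (row_mx p (x + c)) + f (row_mx p x))) ->
  cart k.+1 (csbot _) B.
Proof.
move=> HS; apply: (@cart_trans _ _ _ (pos B)); last first.
  apply: (@cart_weaken _ 1) => //.
  apply: (@art_nop _ _ (prec (0 : 'M_(N, 0))) _ _ _ _ _ _ _ cart_const) => //.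
  - by move=> d f [].
  - move=> d f Bf /(congr1 (fun h => h 0)) /= f0; split=> //.
    by rewrite -[RHS]f0 mul0mx.
(* Impose the invariance under the moves x |-> x + c one at a time. *)
have APL L : {subset [seq xc.2 | xc <- L] <= G} ->
    cart k.+1 (PL (pos B) L) (Sh (pos B)).
  elim: L => [_|[x c] L IH LG]; first by apply: cart_refl => [d f []|d f Bf].
  apply: (@cart_trans _ _ _ (PL (pos B) L)); last first.
    by apply: IH => c' c'L; apply: LG; rewrite in_cons c'L orbT.
  have /HS[S AS BS] : c \in G by apply: LG; exact: mem_head.
  apply: (art_nop (o := delta x c) _ _ _ AS) => [d f [Bf Hf]|d f [Bf Hf] f0|d f [[phi [Bphi _] ->] _]].
  - by split=> // xc xcL; apply: Hf; rewrite in_cons xcL orbT.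
  - by split=> // xc; rewrite in_cons => /predU1P[->|/Hf].
  - exact: BS.
pose L := [seq (x, c) | x <- enum 'cV[F]_N, c <- G].
have {APL}APL : cart k.+1 (Pb (pos B)) (Sh (pos B)).
  apply: (cart_sub (A := PL (pos B) L) _ (@Pb_Sh _) (@csle_refl _ _)); last first.
    by apply: APL => _ /mapP[_ /allpairsP[[x c] [_ cG ->]] ->].
  move=> d _ [[phi Bphi ->] Hphi].
  exists (phi \o pact (p := mpt N) (inj d)); first exact: csM.
  apply/funext => -[x p] /=; rewrite mul_mx_row mulmx1 mulmx0.
  apply: (Ggen (f := fun x => phi (row_mx p x))) => c cG y; apply: F2_eq.
  have ycL : (y, c) \in L by apply/allpairsP; exists (y, c); rewrite mem_enum.
  exact: (congr1 (fun h => h p) (Hphi _ ycL)).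
(* Sh is strict modulo Pb (pos B): a member f of W differs from a member of U by a
   function psi of p alone, which is in U by induction on the dimension. The
   constants have been split off for this induction to start. *)
apply: (@art_strict _ (cslat (mpt N)) (cslat kpt)
  (fun U => csjoin (Sh U) (Pb (pos B))) _ _ _ _ _ _ APL); last exact: csbot_le.
split.
- move=> U [_ UB]; split; first exact: csjoinr.
  apply: csjoinP; last exact: Pb_Sh.
  by move=> d _ [phi Uphi ->]; exists phi => //; exact: UB.
- move=> U W _ _ UW; apply: csjoinP; last exact: csjoinr.
  apply: csle_trans (@csjoinl _ _ _) => d _ [phi Uphi ->].
  by exists phi => //; exact: UW.
move=> U W _ [_ WB] UW WU; elim=> [|d IH] f Wf.
  suff -> : f = @zfun _ by exact: cs0.
  apply/funext => p; have [_] := WB _ _ Wf.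
  by apply: etrans; congr f; apply/matrixP => i [].
rewrite -addn1 in f Wf *.
have [_ [_ [[phi Uphi ->] [psi Bpsi ->] E]]] :
  csjoin (Sh U) (Pb (pos B)) d (fun q => f (row_mx q.2 q.1)).
  by apply: WU; apply: csjoinl; exists f.
have Ef x p : f (row_mx p x) = phi (row_mx p x) + psi p.
  exact: (congr1 (fun h => h (x, p)) E).
have Upsi : U d psi.
  apply: IH; have -> : psi = afun f phi \o pact (p := mpt N) (inj d).
    apply/funext => p; rewrite /= /afun mul_mx_row mulmx1 mulmx0 Ef.
    by rewrite addrAC F2_addxx add0r.
  by apply: csM; apply: csD => //; exact: UW.
suff -> : f = afun phi (psi \o pact (p := mpt N) (proj d)).
  by apply: csD => //; exact: csM.
apply/funext => p; rewrite /afun /= -[p]hsubmxK Ef; congr (_ + psi _).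
by rewrite mul_row_col mulmx1 mulmx0 addr0.
Qed.
End Shift.

Lemma killw_restrict N d s (f : 'M[F]_(N, d + 1) -> F) x :
  killw s f -> killw s (fun p => f (row_mx p x)).
Proof.
move=> K; have -> : (fun p => f (row_mx p x)) =
    shift (row_mx 0 x) f \o mulmx^~ (row_mx 1%:M 0).
  apply/funext => p; rewrite /shift /= mul_mx_row mulmx1 mulmx0.
  by rewrite add_row_mx addr0 add0r.
by apply: killw_pull; exact: killw_shift.
Qed.

Lemma row_mx_diff N d (f : 'M[F]_(N, d + 1) -> F) x c :
  (fun p => f (row_mx p (x + c)) + f (row_mx p x)) =
  (fun p => dl (c *m row_mx (0 : 'rV_d) 1%:M) f (row_mx p x)).
Proof.
apply/funext => p.
by rewrite /dl mul_mx_row mulmx0 mulmx1 add_row_mx addr0.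
Qed.

Section KillArt.
Variables (N : nat) (T1 T2 : {pred 'cV[F]_N}).
Hypothesis gen : forall f : 'cV[F]_N -> F,
  (forall c, c \in [predU T1 & T2] -> forall x, f (x + c) = f x) -> forall x, f x = f 0.

(** Functions of bounded degree have finite length: a difference along a column of T1
    or T2 lowers one of the two degrees. *)
Lemma cart_killn m1 m2 :
  cart 1 (csbot _) (csmeet (killns m1 T1) (killns m2 T2)).
Proof.
have [l El] := ubnP (m1 + m2)%N; elim: l m1 m2 El => // l IH [|m1] [|m2] El;
  try (by apply: cart_refl => [|d f [K1 K2]]; [exact: csbot_le|
       by [exact: killn0 K1|exact: killn0 K2]]).
apply: (@cart_shift _ _ (enum [predU T1 & T2])) => [f Hf|c].
  by apply: gen => c cT; apply: Hf; rewrite mem_enum.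
rewrite mem_enum !inE => /orP[cT|cT].
- exists (csmeet (killns m1 T1) (killns m2.+1 T2)); first by apply: IH; rewrite addSn in El.
  move=> d f [K1 K2] x; rewrite row_mx_diff; split=> s ss sT; apply: killw_restrict.
    exact: (killn_dl _ cT K1).
  by apply: killw_dl; exact: K2.
- exists (csmeet (killns m1.+1 T1) (killns m2 T2)); first by apply: IH; rewrite addnS in El.
  move=> d f [K1 K2] x; rewrite row_mx_diff; split=> s ss sT; apply: killw_restrict.
    by apply: killw_dl; exact: K1.
  exact: (killn_dl _ cT K2).
Qed.
End KillArt.

(** * Separation *)

Section Separation.
Variables (T : finType) (U : (T -> F) -> Prop).
Hypotheses (U0 : U (@zfun T)) (UD : forall f g, U f -> U g -> U (afun f g)).

Lemma sum_afun (z : seq T) f g :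
  \sum_(p <- z) afun f g p = \sum_(p <- z) f p + \sum_(p <- z) g p.
Proof. exact: big_split. Qed.

(** A functional that vanishes on the members of U vanishing at s is, on U, a sum of
    evaluations at points of s. Over F_2 a functional is a list of points. *)
Lemma functional_extend (s y : seq T) :
  (forall f, U f -> (forall q, q \in s -> f q = 0) -> \sum_(p <- y) f p = 0) ->
  exists2 x : seq T, {subset x <= s} &
    forall f, U f -> \sum_(p <- y) f p = \sum_(p <- x) f p.
Proof.
elim: s y => [|q s IH] y H.
  by exists [::] => // f Uf; rewrite big_nil; exact: H.
have [H'|] := pselect (forall f, U f -> (forall q, q \in s -> f q = 0) ->
    \sum_(p <- y) f p = 0).
  by have [x xs Hx] := IH _ H'; exists x => // p /xs ps; rewrite in_cons ps orbT.
move=> /existsNP[f1 /not_implyP[Uf1 /not_implyP[f1s f1y]]].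
have f1q : f1 q = 1.
  apply: F2_neq0 => f1q; apply: f1y; apply: H => // p.
  by rewrite in_cons => /predU1P[->|/f1s].
have [|x xs Hx] := IH (q :: y).
  move=> f Uf fs; rewrite big_cons.
  have [fq|/F2_neq0 fq] := pselect (f q = 0).
    rewrite fq add0r; apply: H => // p.
    by rewrite in_cons => /predU1P[->|/fs].
  have := H _ (UD Uf Uf1); rewrite sum_afun (F2_neq0 f1y) fq addrC; apply.
  move=> p; rewrite in_cons /afun => /predU1P[->|ps]; first by rewrite fq f1q F2_addxx.
  by rewrite fs // f1s // addr0.
exists (q :: x) => [p|f Uf].
  by rewrite !in_cons => /orP[->//|/xs ->]; rewrite orbT.
by rewrite big_cons -(Hx _ Uf) big_cons addrA F2_addxx add0r.
Qed.

Lemma separation f0 : ~ U f0 -> exists2 z : seq T,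
  forall f, U f -> \sum_(p <- z) f p = 0 & \sum_(p <- z) f0 p = 1.
Proof.
move=> nU; apply: contrapT => nz.
have agree (s : seq T) : exists2 f, U f & forall q, q \in s -> f q = f0 q.
  elim: s => [|q s [f Uf fs]]; first by exists (@zfun T).
  have [fq|nfq] := pselect (f q = f0 q).
    by exists f => // p; rewrite in_cons => /predU1P[->|/fs].
  have [[f1 Uf1 [f1s f1q]]|n1] := pselect (exists2 f1, U f1 &
      (forall q, q \in s -> f1 q = 0) /\ f1 q = 1).
    exists (afun f f1); first exact: UD.
    move=> p; rewrite in_cons /afun => /predU1P[->|ps]; last by rewrite f1s // addr0 fs.
    rewrite f1q; move: nfq.
    by case: (F2_cases (f q)) => ->; case: (F2_cases (f0 q)) => -> //; rewrite ?add0r ?F2_addxx.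
  have [|x xs Hx] := @functional_extend s [:: q].
    move=> f1 Uf1 f1s; rewrite big_seq1; apply: contrapT => /F2_neq0 f1q.
    by apply: n1; exists f1.
  case: nz; exists (q :: x) => [g Ug|]; rewrite big_cons.
    by rewrite -(Hx _ Ug) big_seq1 F2_addxx.
  have -> : \sum_(p <- x) f0 p = f q.
    rewrite -[RHS](big_seq1 +%R q) (Hx _ Uf).
    by rewrite big_seq [RHS]big_seq; apply: eq_bigr => p /xs /fs ->.
  apply: F2_neq0 => /F2_eq; exact/nesym.
have [f Uf /(_ _ _)ff0] := agree (enum T).
by apply: nU; suff -> : f0 = f by []; apply/funext => q; rewrite ff0 // mem_enum.
Qed.
End Separation.

(** * Isolating one frame *)

Section Core.
Variables (r n : nat).

(** The directions that leave the frame, the first r rows, unchanged. *)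
Definition wcols : {pred 'cV[F]_(r + n)} := [pred c | usubmx c == 0].

Lemma killn_nseq N d m (c : 'cV[F]_N) (T : {pred 'cV[F]_N}) (f : 'M[F]_(N, d) -> F) :
  c \in T -> killn m T f -> killw (nseq m c) f.
Proof.
by move=> cT; apply; [rewrite size_nseq|move=> x /nseqP[->]].
Qed.

Section Elim.
Variables (U : csub (mpt (r + n))) (m : nat).
Hypothesis Um : forall d f, U d f -> killn m wcols f.
Variables (d0 : nat) (z : seq 'M[F]_(r + n, d0)) (b0 : 'M[F]_(r, d0)).
Hypothesis zU : forall f, U d0 f -> \sum_(p <- z) f p = 0.

Definition in_frame (p : 'M[F]_(r + n, d0)) := (b0 <= usubmx p)%MS.

(** If the rows of b0 are not in the span of the frame of p, some column c satisfies
    usubmx p *m c = 0 and b0 *m c != 0. A difference along c moves p in the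
    directions wcols only, so m of them remove the contribution of p. *)
Lemma elim_frames : exists2 s : seq 'cV[F]_d0,
  forall c, c \in s -> b0 *m c != 0 &
  forall d f, U d f ->
    killw s (fun g : 'M[F]_(d0, d) => \sum_(p <- z | in_frame p) f (p *m g)).
Proof.
have [s s0 Ks] : exists2 s : seq 'cV[F]_d0, forall c, c \in s -> b0 *m c != 0 &
    forall d f, U d f ->
      killw s (fun g : 'M[F]_(d0, d) => \sum_(p <- z | ~~ in_frame p) f (p *m g)).
  elim: z => [|p z' [s s0 Ks]].
    by exists [::] => // d f _ g /=; rewrite big_nil.
  have [pb|] := boolP (in_frame p).
    exists s => // d f Uf; under eq_fun do rewrite big_cons pb /=; exact: Ks.
  rewrite /in_frame => npb; move: (npb); rewrite submxE.
  move=> /eqP/matrixP/existsNP[i /existsNP[j /eqP]]; rewrite [_ _ _ in X in _ != X]mxE => bij.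
  pose c := col j (cokermx (usubmx p)).
  have uc : usubmx p *m c = 0 by rewrite /c colE mulmxA mulmx_coker mul0mx.
  have bc : b0 *m c != 0.
    apply: contraNneq bij => bc0; rewrite /c colE mulmxA -colE in bc0.
    by have /matrixP/(_ i 0) := bc0; rewrite !mxE => /eqP.
  exists (nseq m c ++ s) => [c'|d f Uf].
    by rewrite mem_cat => /orP[/nseqP[->]|/s0].
  have -> : (fun g : 'M[F]_(d0, d) => \sum_(q <- p :: z' | ~~ in_frame q) f (q *m g))
      = afun (fun g => f (p *m g)) (fun g => \sum_(q <- z' | ~~ in_frame q) f (q *m g)).
    by apply/funext => g; rewrite big_cons /in_frame npb.
  apply: killwD; last by apply: killw_catl; exact: Ks.
  apply: (@killw_perm _ _ (s ++ nseq m c)); first by rewrite perm_catC.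
  apply: killw_catl; apply: killw_prec; rewrite map_nseq.
  apply: killn_nseq (Um Uf); rewrite inE.
  by rewrite -mul_usub_mx uc.
exists s => // d f Uf; suff -> : (fun g : 'M[F]_(d0, d) => \sum_(p <- z | in_frame p) f (p *m g))
  = (fun g => \sum_(p <- z | ~~ in_frame p) f (p *m g)) by exact: Ks.
apply/funext => g; apply: F2_eq.
by have := zU (csM g Uf); rewrite (bigID in_frame).
Qed.
End Elim.

Section Peel.
Variables (U : csub (mpt (r + n))).
Hypothesis Uinv : forall d (f : 'M[F]_(r + n, d) -> F), U d f ->
  forall b w (x : 'M[F]_(n, r)), f (col_mx b (w + x *m b)) = f (col_mx b w).
Variables (d0 : nat) (z : seq 'M[F]_(r + n, d0)) (b0 : 'M[F]_(r, d0)) (sec : 'M[F]_(d0, r)).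
Hypothesis b0sec : b0 *m sec = 1%:M.
Local Notation pr := (1%:M + sec *m b0).

(** Under the substitution g = sec *m b + pr *m a the point p gets the frame
    usubmx p *m sec *m b, and the invariance of f absorbs the multiples of the
    frame in the parameters. *)
Lemma peel_point p d (f : 'M[F]_(r + n, d) -> F) (b : 'M[F]_(r, d)) (a : 'M[F]_(d0, d)) :
  in_frame b0 p -> U d f ->
  f (p *m (sec *m b + pr *m a)) =
  f (col_mx (usubmx p *m sec *m b) (dsubmx p *m pr *m a)).
Proof.
move=> pb Uf; have [B Eb] := submxP pb.
have [A EA] : exists A : 'M_r, usubmx p = A *m b0.
  have /submxP[A ->] : (usubmx p <= b0)%MS; last by exists A.
  rewrite -(geq_leqif (mxrank_leqif_sup pb)); apply: leq_trans (rank_leq_row _) _.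
  by have /eqP-> : row_free b0 by apply/row_freeP; exists sec.
have BA : B *m A = 1%:M.
  have : B *m A *m b0 *m sec = 1%:M by rewrite -(mulmxA B) -EA -Eb.
  by rewrite -mulmxA b0sec mulmx1.
have AB := mulmx1C BA.
have Egm : usubmx p *m sec = A by rewrite EA -mulmxA b0sec mulmx1.
have b0pr : b0 *m pr = 0 by rewrite mulmxDr mulmx1 mulmxA b0sec mul1mx mx_addxx.
rewrite Egm -{1}[p]vsubmxK mul_col_mx EA !mulmxDr -!(mulmxA A) !(mulmxA b0).
rewrite b0sec b0pr mul1mx mul0mx mulmx0 addr0 [dsubmx p *m _ + _]addrC.
rewrite -[RHS](Uinv Uf (A *m b) _ (dsubmx p *m sec *m B)); congr (f (col_mx _ (_ + _))).
  by rewrite mulmxA mulmxDr.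
by rewrite -!mulmxA (mulmxA B) BA mul1mx.
Qed.

Variable s : seq 'cV[F]_d0.
Hypothesis sU : forall d f, U d f ->
    killw s (fun g : 'M[F]_(d0, d) => \sum_(p <- z | in_frame b0 p) f (p *m g)).

Lemma peel d f : U d f ->
  killw [seq col_mx (b0 *m c) c | c <- s] (fun q : 'M[F]_(r + d0, d) =>
    \sum_(p <- z | in_frame b0 p)
       f (col_mx (usubmx p *m sec *m usubmx q) (dsubmx p *m pr *m dsubmx q))).
Proof.
move=> Uf; have -> : (fun q : 'M[F]_(r + d0, d) => \sum_(p <- z | in_frame b0 p)
      f (col_mx (usubmx p *m sec *m usubmx q) (dsubmx p *m pr *m dsubmx q))) =
    (fun q => (fun g => \sum_(p <- z | in_frame b0 p) f (p *m g)) (row_mx sec pr *m q)).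
  apply/funext => q; apply: eq_bigr => p pb.
  by rewrite -(peel_point _ _ pb Uf) -[in RHS](vsubmxK q) mul_row_col.
apply: (killw_prec (A := row_mx sec pr)
  (f := fun g => \sum_(p <- z | in_frame b0 p) f (p *m g))).
rewrite -map_comp (_ : map _ s = s); first exact: sU.
rewrite -[RHS]map_id; apply: eq_map => c /=; rewrite mul_row_col mulmxDl mul1mx.
by rewrite -!mulmxA addrCA mx_addxx addr0.
Qed.
End Peel.

Section Top.
Variables (q : nat) (A : 'I_q -> 'M[F]_r).
Variables (U : csub (mpt (r + n))) (C C' : csub (mpt n)).
Hypothesis UC' : forall d f, U d f -> forall b : 'M[F]_(r, d), C' d (fun w => f (col_mx b w)).

(** A test is a list of pairs: an index, telling which of the frames A is meant, and n
    vectors. *)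
Section Test.
Variable D : nat.
Implicit Type t : seq ('I_q * 'M[F]_(n, D)).

Definition pairing t k d (psi : 'M[F]_(n, d) -> F) (a : 'M[F]_(D, d)) : F :=
  \sum_(x <- t | x.1 == k) psi (x.2 *m a).

Definition total t d (f : 'M[F]_(r + n, d) -> F) (p : 'M[F]_(r + D, d)) : F :=
  \sum_(x <- t) f (col_mx (A x.1 *m usubmx p) (x.2 *m dsubmx p)).

Lemma totalE t d f p : @total t d f p =
  \sum_k pairing t k (fun w => f (col_mx (A k *m usubmx p) w)) (dsubmx p).
Proof.
rewrite /total (partition_big (fun x => x.1) xpredT) //=.
by apply: eq_bigr => k _; apply: eq_bigr => x /eqP->.
Qed.

Definition separates t :=
  (forall k d psi a, C d psi -> @pairing t k d psi a = 0) /\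
  (exists k d psi a, C' d psi /\ @pairing t k d psi a <> 0).
End Test.

(** The parameter parts of the directions can be removed if f is invariant under
    them. *)
Lemma killw_inv D d (s : seq 'cV[F]_(r + D)) (f : 'M[F]_(r + D, d) -> F) :
  (forall c e, c \in s -> shift (col_mx 0 (dsubmx c) *m e) f = f) ->
  killw s f -> killw [seq col_mx (usubmx c) 0 | c <- s] f.
Proof.
elim: s f => //= c s IH f inv K e.
have -> : dl (col_mx (usubmx c) 0 *m e) f = dl (c *m e) f.
  apply/funext => p; rewrite /dl; congr (_ + _).
  rewrite -[in LHS](inv c e (mem_head _ _)) /shift; congr f.
  by rewrite -addrA -mulmxDl add_col_mx addr0 add0r vsubmxK.
apply: IH => // c' e' c's; rewrite -dl_shift inv // in_cons c's orbT //.
Qed.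

Lemma killw_lift D d (la : 'cV[F]_D) s (f : 'M[F]_(D, d) -> F) :
  (forall e : 'rV_d, killw s (dl (la *m e) f)) ->
  killw [seq col_mx c (0 : 'cV_1) | c <- s]
    (fun a : 'M[F]_(D + 1, d) => dl (la *m dsubmx a) f (usubmx a)).
Proof.
elim: s f => [|c s IH] f K /=; first by move=> a; exact: K.
move=> e; have -> : dl (col_mx c 0 *m e) (fun a : 'M[F]_(D + 1, d) =>
     dl (la *m dsubmx a) f (usubmx a)) =
   (fun a => dl (la *m dsubmx a) (dl (c *m e) f) (usubmx a)).
  apply/funext => a; rewrite [in RHS]dlC /dl mul_col_mx mul0mx.
  by rewrite -[X in X + col_mx _ _]vsubmxK add_col_mx !col_mxKu !col_mxKd addr0.
by apply: IH => e'; rewrite dlC; exact: K.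
Qed.

(** If the pairings change along some parameter direction of s, the difference in
    that direction is a new separating test, with one more vector and lower degree.
    When this stops, the word s acts through its frame part only. *)
Lemma top_test m D (t : seq ('I_q * 'M[F]_(n, D))) (s : seq 'cV[F]_(r + D)) :
  separates t ->
  (forall d f, U d f -> killw s (@total D t d f)) ->
  (forall k d psi, C' d psi -> killn m (mem [seq dsubmx c | c <- s]) (@pairing D t k d psi)) ->
  exists D' (t' : seq ('I_q * 'M[F]_(n, D'))), separates t' /\
    forall d f, U d f -> killw [seq col_mx (usubmx c) 0 | c <- s] (@total D' t' d f).
Proof.
elim: m D t s => [|m IH] D t s sept Ks Km.
  have [_ [k [d [psi [a [Cpsi []]]]]]] := sept.
  by rewrite (killn0 (Km k d psi Cpsi)).
have [inv|] := pselect (forall k d psi c (e : 'rV_d) a, C' d psi -> c \in s ->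
    pairing t k psi (a + dsubmx c *m e) = pairing t k psi a).
  exists D, t; split=> // d f Uf; apply: killw_inv (Ks _ _ Uf) => c e cs.
  apply/funext => p; rewrite /shift !totalE; apply: eq_bigr => k _.
  rewrite mul_col_mx mul0mx -[p]vsubmxK add_col_mx !col_mxKu !col_mxKd addr0.
  by apply: inv => //; exact: UC'.
move=> /existsNP[k0 /existsNP[d0 /existsNP[psi0 /existsNP[c0 /existsNP[e0]]]]].
move=> /existsNP[a0 /not_implyP[Cpsi0 /not_implyP[c0s nE]]].
pose la := dsubmx c0.
pose M1 : 'M[F]_(D, D + 1) := row_mx 1%:M la; pose M2 : 'M[F]_(D, D + 1) := row_mx 1%:M 0.
pose ext M (x : 'I_q * 'M[F]_(n, D)) : 'I_q * 'M[F]_(n, D + 1) := (x.1, x.2 *m M).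
pose t' := map (ext M1) t ++ map (ext M2) t.
pose s' := [seq col_mx (usubmx c) (col_mx (dsubmx c) (0 : 'cV_1)) | c <- s].
have pE k d psi (a : 'M[F]_(D + 1, d)) : pairing t' k psi a =
    dl (la *m dsubmx a) (pairing t k psi) (usubmx a).
  rewrite /pairing big_cat !big_map /= /dl; congr (_ + _); apply: eq_bigr => x _;
    by rewrite -mulmxA -[a in LHS]vsubmxK mul_row_col mul1mx ?mul0mx ?addr0.
have tE d f p : @total _ t' d f p =
    total t f (block_mx 1%:M 0 0 M1 *m p) + total t f (block_mx 1%:M 0 0 M2 *m p).
  rewrite /total big_cat !big_map /=; congr (_ + _); apply: eq_bigr => x _;
  by rewrite -[p in RHS]vsubmxK mul_block_col !mul0mx mul1mx addr0 add0r col_mxKu col_mxKd mulmxA.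
have [|||D' [t'' [sep'' K'']]] := IH _ t' s'.
- split=> [k d psi a Cpsi|].
    by rewrite pE /dl !(proj1 sept) // addr0.
  exists k0, d0, psi0, (col_mx a0 e0); split=> //.
  by rewrite pE /dl col_mxKu col_mxKd => /F2_eq.
- move=> d f Uf; have -> : @total _ t' d f =
    afun (fun p => total t f (block_mx 1%:M 0 0 M1 *m p))
         (fun p => total t f (block_mx 1%:M 0 0 M2 *m p)).
    by apply/funext => p; exact: tE.
  have E (M : 'M[F]_(D, D + 1)) : (forall v : 'cV[F]_D, M *m col_mx v 0 = v) ->
      [seq block_mx 1%:M 0 0 M *m c | c <- s'] = s.
    move=> HM; rewrite -map_comp -[RHS]map_id; apply: eq_map => c /=.
    by rewrite mul_block_col !mul0mx mul1mx addr0 add0r HM vsubmxK.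
  have HM1 (v : 'cV[F]_D) : M1 *m col_mx v 0 = v.
    by rewrite mul_row_col mul1mx mulmx0 addr0.
  have HM2 (v : 'cV[F]_D) : M2 *m col_mx v 0 = v.
    by rewrite mul_row_col mul1mx mulmx0 addr0.
  by apply: killwD; apply: (killw_prec (f := total t f)); rewrite E //; exact: Ks.
- move=> k d psi Cpsi u su us.
  have -> : pairing t' k psi = (fun a => dl (la *m dsubmx a) (pairing t k psi) (usubmx a)).
    by apply/funext => a; exact: pE.
  have -> : u = [seq col_mx c (0 : 'cV_1) | c <- [seq usubmx c | c <- u]].
    rewrite -map_comp -[LHS]map_id; apply/eq_in_map => c /us /mapP[_ /mapP[c' _ ->] ->] /=.
    by rewrite col_mxKd col_mxKu.
  apply: killw_lift => e; have /killn_dl := Km k d psi Cpsi; apply.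
  + by apply: map_f.
  + by rewrite size_map.
  + move=> _ /mapP[_ /us /mapP[_ /mapP[c cs ->] ->] ->].
    by rewrite col_mxKd col_mxKu; apply: map_f.
exists D', t''; split=> // d f /K''; rewrite -map_comp.
by under eq_map do rewrite /= col_mxKu.
Qed.
End Top.
End Core.

Lemma killw_sum N d s (I : Type) (l : seq I) (P : pred I) (f : I -> 'M[F]_(N, d) -> F) :
  (forall i, P i -> killw s (f i)) -> killw s (fun p => \sum_(i <- l | P i) f i p).
Proof.
move=> K; elim: l => [|i l IH].
  have -> : (fun p => \sum_(i <- [::] | P i) f i p) = @zfun _; last exact: killw0.
  by apply/funext => p; rewrite big_nil.
have [Pi|nPi] := boolP (P i).
  have -> : (fun p => \sum_(j <- i :: l | P j) f j p) =
      afun (f i) (fun p => \sum_(j <- l | P j) f j p).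
    by apply/funext => p; rewrite big_cons Pi.
  by apply: killwD => //; exact: K.
suff -> : (fun p => \sum_(j <- i :: l | P j) f j p) = (fun p => \sum_(j <- l | P j) f j p) by [].
by apply/funext => p; rewrite big_cons (negbTE nPi).
Qed.

Section Isolate.
Variables (r n q m : nat) (A : 'I_q -> 'M[F]_r) (S : 'M[F]_r -> {set 'I_q}).
Variables (B U : csub (mpt (r + n))) (C C' : csub (mpt n)).
Hypothesis UB : csle U B.
Hypothesis Bm : forall d f, B d f -> killn m (@wcols r n) f.
Hypothesis Binv : forall d (f : 'M[F]_(r + n, d) -> F), B d f ->
  forall b w (x : 'M[F]_(n, r)), f (col_mx b (w + x *m b)) = f (col_mx b w).
Hypothesis BC' : forall d f, B d f -> forall b : 'M[F]_(r, d), C' d (fun w => f (col_mx b w)).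
Hypothesis Bfree : forall d (f : 'M[F]_(r + n, d) -> F), B d f ->
  forall b w, ~~ row_free b -> f (col_mx b w) = 0.
Hypothesis Bred : forall d (f : 'M[F]_(r + n, d) -> F), B d f ->
  forall g b w, f (col_mx (g *m b) w) = \sum_(k in S g) f (col_mx (A k *m b) w).
Hypothesis C'm : forall d psi, C' d psi -> killn m predT psi.
Hypothesis UC : forall k d0 (b0 : 'M[F]_(r, d0)) sec d psi (a : 'M_(d0, d)),
  b0 *m sec = 1%:M -> C d psi -> U d0 (fun p =>
    if in_frame b0 p && (k \in S (usubmx p *m sec))
    then psi (dsubmx p *m (1%:M + sec *m b0) *m a) else 0).

(** A functional on some B(d0) that is orthogonal to U but not zero is concentrated on
    one plane by differences. What remains is a relation satisfied by all of U. *)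
Theorem isolate : ~ csle B U ->
  exists (s : seq 'cV[F]_r) D (t : seq ('I_q * 'M[F]_(n, D))),
    [/\ forall c, c \in s -> c != 0, separates C C' t &
     forall d f, U d f -> killw [seq col_mx c 0 | c <- s] (@total r n q A D t d f)].
Proof.
move=> /existsNP[d0 /existsNP[f0 /not_implyP[Bf0 nUf0]]].
have [z zU zf0] := separation (@cs0 _ U d0) (@csD _ U d0) nUf0.
have [j Hj] : exists j, \sum_(p <- z | <<usubmx p>>%MS == j) f0 p != 0.
  apply/existsP; rewrite -negb_forall; apply/forallP => H.
  have : 0 = 1 :> F by rewrite -zf0 (partition_big (fun p => <<usubmx p>>%MS) xpredT) //=
    big1 // => j _; exact/eqP.
  by move/eqP.
have [p0 /eqP Ep0 f0p0] : exists2 p0, <<usubmx p0>>%MS == j & f0 p0 != 0.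
  apply: contrapT => nx; move: Hj; rewrite big1 ?eqxx // => p pj.
  by apply/eqP; apply: contrapT => fp; apply: nx; exists p => //; exact/negP.
pose b0 := usubmx p0.
have b0free : row_free b0.
  by apply: contraNT f0p0 => nb0; rewrite -[p0]vsubmxK (Bfree Bf0) // nb0.
have [sec b0sec] := row_freeP b0free.
have frameE p : in_frame b0 p = (<<usubmx p>>%MS == j).
  rewrite -Ep0 /in_frame -/b0; apply/idP/eqP => [pb|/esym/genmxP/eqmxP E]; last by rewrite E.
  apply/esym/genmxP; rewrite pb /= -(geq_leqif (mxrank_leqif_sup pb)).
  by rewrite (eqP b0free) rank_leq_row.
have [s s0 Ks] := elim_frames (fun d f Uf => Bm (UB Uf)) b0 zU.
have Kp := peel (fun d f Uf => Binv (UB Uf)) b0sec Ks.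
pose pr := 1%:M + sec *m b0.
pose t : seq ('I_q * 'M[F]_(n, d0)) := flatten [seq [seq (k, dsubmx p *m pr) |
  k <- enum (S (usubmx p *m sec))] | p <- [seq p <- z | in_frame b0 p]].
have bigt (G : 'I_q * 'M[F]_(n, d0) -> F) (P : pred 'I_q) :
    \sum_(x <- t | P x.1) G x = \sum_(p <- z | in_frame b0 p)
       \sum_(k in S (usubmx p *m sec) | P k) G (k, dsubmx p *m pr).
  rewrite big_flatten big_map big_filter; apply: eq_bigr => p _.
  by rewrite big_map big_enum_cond.
have tE d f (q' : 'M[F]_(r + d0, d)) : B d f -> @total _ _ _ A _ t d f q' =
    \sum_(p <- z | in_frame b0 p)
       f (col_mx (usubmx p *m sec *m usubmx q') (dsubmx p *m pr *m dsubmx q')).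
  move=> Bf; rewrite /total (bigt _ xpredT) /=; apply: eq_bigr => p _.
  rewrite (Bred Bf); apply: eq_bigl => k; by rewrite andbT.
have pE k d psi (a : 'M_(d0, d)) : pairing t k psi a =
    \sum_(p <- z) (if in_frame b0 p && (k \in S (usubmx p *m sec))
       then psi (dsubmx p *m pr *m a) else 0).
  rewrite /pairing (bigt _ (fun k' => k' == k)) /= big_mkcond; apply: eq_bigr => p _.
  case: ifP => //= _; case: ifP => kS.
    by rewrite (big_pred1 k) // => k' /=; case: eqP => [->|_]; rewrite ?kS ?andbF.
  by rewrite big_pred0 // => k' /=; case: eqP => [->|_]; rewrite ?kS ?andbF.
have total0 : @total _ _ _ A _ t _ f0 (col_mx b0 1%:M) <> 0.
  rewrite tE //; apply/eqP; apply: contraNneq Hj => E0; rewrite -[X in _ == X]E0; apply/eqP.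
  under eq_bigl do rewrite -frameE; apply: eq_bigr => p pb.
  rewrite col_mxKu col_mxKd -(peel_point Binv) //.
  by rewrite mulmx1 addrCA mx_addxx addr0 mulmx1.
have Csep : separates C C' t.
  split=> [k d psi a Cpsi|]; first by rewrite pE zU //; exact: UC.
  apply: contrapT => nx; apply: total0.
  rewrite totalE big1 // => k _; apply: contrapT => nz.
  by apply: nx; do 4 eexists; split; last exact: nz; exact: BC'.
have [|||D [t' [sep' K']]] := top_test (A := A) (U := U) (C := C) (C' := C') (m := m)
    (s := [seq col_mx (b0 *m c) c | c <- s]) _ Csep.
- by move=> d f /UB Bf; exact: BC'.
- move=> d f Uf; have -> : @total _ _ _ A _ t d f = (fun q' : 'M[F]_(r + d0, d) =>
    \sum_(p <- z | in_frame b0 p)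
       f (col_mx (usubmx p *m sec *m usubmx q') (dsubmx p *m pr *m dsubmx q'))).
    by apply/funext => q'; rewrite tE //; exact: UB.
  exact: Kp.
- move=> k d psi Cpsi u su _; rewrite /pairing.
  apply: killw_sum => x _; apply: killw_prec; apply: (C'm Cpsi) => //.
  by rewrite size_map.
exists (map (mulmx b0) s), D, t'; split=> //.
  by move=> _ /mapP[c cs ->]; exact: s0.
move=> d f /K'; rewrite -!map_comp.
by under eq_map do rewrite /= col_mxKu.
Qed.
End Isolate.

Section Fibers.
Variables (r n : nat).

Lemma killw_fiber d (b : 'M[F]_(r, d)) s (f : 'M[F]_(r + n, d) -> F) :
  killw [seq col_mx (0 : 'cV_r) c | c <- s] f -> killw s (fun w => f (col_mx b w)).
Proof.
elim: s f => /= [f f0 p|c s IH f K e]; first exact: f0.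
have -> : dl (c *m e) (fun w => f (col_mx b w)) =
    (fun w => dl (col_mx (0 : 'cV_r) c *m e) f (col_mx b w)).
  by apply/funext => w; rewrite /dl mul_col_mx mul0mx add_col_mx addr0.
exact: IH.
Qed.

Lemma killn_fiber m d (b : 'M[F]_(r, d)) (f : 'M[F]_(r + n, d) -> F) :
  killn m (@wcols r n) f -> killn m predT (fun w => f (col_mx b w)).
Proof.
move=> K s ss _; apply: killw_fiber; apply: K; first by rewrite size_map.
by move=> _ /mapP[c _ ->]; rewrite inE /= col_mxKu.
Qed.

Lemma killw_indicator d (P : pred 'M[F]_(r, d)) s (h : 'M[F]_(n, d) -> F) :
  {subset s <= @wcols r n} -> killw [seq dsubmx c | c <- s] h ->
  killw s (fun p : 'M[F]_(r + n, d) => if P (usubmx p) then h (dsubmx p) else 0).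
Proof.
elim: s h => [|c s IH] h sw /=; first by move=> h0 p; case: ifP.
move=> K e; have /eqP c0 := sw c (mem_head _ _).
have -> : dl (c *m e) (fun p : 'M[F]_(r + n, d) => if P (usubmx p) then h (dsubmx p) else 0) =
   (fun p => if P (usubmx p) then dl (dsubmx c *m e) h (dsubmx p) else 0).
  apply/funext => p; rewrite /dl -[c in LHS]vsubmxK c0 mul_col_mx mul0mx.
  rewrite -[p in X in X + _]vsubmxK add_col_mx addr0 col_mxKu col_mxKd.
  by case: ifP => // _; rewrite addr0.
by apply: IH => // c' c's; apply: sw; rewrite in_cons c's orbT.
Qed.

Lemma killw_along d (x : 'M[F]_(n, r)) s (f : 'M[F]_(r + n, d) -> F) :
  {subset s <= @wcols r n} ->
  (forall e : 'M[F]_(r, d), killw s (dl (col_mx (0 : 'M_r) x *m e) f)) ->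
  killw s (fun p => dl (col_mx (0 : 'M_r) x *m usubmx p) f p).
Proof.
elim: s f => [|c s IH] f sw K /=; first by move=> p; exact: K.
move=> e; have /eqP c0 := sw c (mem_head _ _).
have -> : dl (c *m e) (fun p => dl (col_mx (0 : 'M_r) x *m usubmx p) f p) =
   (fun p => dl (col_mx (0 : 'M_r) x *m usubmx p) (dl (c *m e) f) p).
  apply/funext => p; rewrite [in RHS]dlC /dl.
  suff -> : usubmx (p + c *m e) = usubmx p by [].
  by rewrite linearD /= -mul_usub_mx c0 mul0mx addr0.
apply: IH => [c' c's|e']; first by apply: sw; rewrite in_cons c's orbT.
by rewrite dlC; exact: K.
Qed.

Definition totalop q (A : 'I_q -> 'M[F]_r) D (t : seq ('I_q * 'M[F]_(n, D))) :
  nop (mpt (r + n)) (mpt (r + D)).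
refine (@NOp (mpt (r + n)) (mpt (r + D)) (fun d f => @total r n q A D t d f) _ _).
- by move=> d f g; apply/funext => p; rewrite /total /afun -big_split.
- move=> d d' g f; apply/funext => p; rewrite /total /=; apply: eq_bigr => x _.
  by rewrite mul_col_mx -!mulmxA mul_usub_mx mul_dsub_mx.
Defined.

Lemma killn_total m q (A : 'I_q -> 'M[F]_r) D (t : seq ('I_q * 'M[F]_(n, D))) d f :
  killn m (@wcols r n) f -> killn m (@wcols r D) (@total r n q A D t d f).
Proof.
move=> K s ss sw; rewrite /total; apply: killw_sum => x _.
have -> : (fun p : 'M[F]_(r + D, d) => f (col_mx (A x.1 *m usubmx p) (x.2 *m dsubmx p))) =
   (fun p => f (block_mx (A x.1) 0 0 x.2 *m p)).
  apply/funext => p; rewrite -[p in RHS]vsubmxK mul_block_col !mul0mx addr0 add0r //.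
apply: killw_prec; apply: K; first by rewrite size_map.
move=> _ /mapP[c /sw /eqP c0 ->]; rewrite inE /= -[c]vsubmxK mul_block_col c0.
by rewrite col_mxKu mulmx0 mul0mx addr0.
Qed.
End Fibers.

Lemma cart_pol n m : cart 1 (csbot (mpt n)) (killns (N := n) m predT).
Proof.
apply: cart_sub (cart_killn (T1 := predT) (T2 := predT) _ m m).
- exact: csle_refl.
- exact: csbot_le.
- by [].
by move=> f Hf x; rewrite -[x]add0r Hf.
Qed.

(** * Functions of one vector and of polynomial parameters *)

Section Lines.
Variable n : nat.

Definition invariant r d (f : 'M[F]_(r + n, d) -> F) :=
  forall b w (x : 'M[F]_(n, r)), f (col_mx b (w + x *m b)) = f (col_mx b w).

Definition Einv (m : nat) : csub (mpt (1 + n)).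
refine (@CSub (mpt (1 + n)) (fun d f => killn m (@wcols 1 n) f /\ invariant f) _ _ _).
- by move=> d; split=> //; exact: (@cs0 _ (killns m _)).
- move=> d f g [Kf If] [Kg Ig]; split; first exact: (@csD _ (killns m _)).
  by move=> b w x; rewrite /afun If Ig.
- move=> d d' g f [Kf If]; split; first exact: (@csM _ (killns m _)).
  by move=> b w x; rewrite /= !mul_col_mx mulmxDl -mulmxA If.
Defined.

(** Invariant functions of (b; w) that vanish at b = 0 and whose fibres over b are
    in C. They fill the gap between 0 and the members of Einv that vanish at b = 0
    when C goes from 0 to all functions of degree less than m. *)
Definition Efib (m : nat) (C : csub (mpt n)) : csub (mpt (1 + n)).
refine (@CSub (mpt (1 + n)) (fun d f => [/\ Einv m d f,
  forall w, f (col_mx 0 w) = 0 & forall b : 'rV_d, C d (fun w => f (col_mx b w))]) _ _ _).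
- by move=> d; split=> // [|b]; exact: cs0.
- move=> d f g [Ef f0 Cf] [Eg g0 Cg]; split; first exact: csD.
    by move=> w; rewrite /afun f0 g0 addr0.
  by move=> b; exact: (csD (Cf b) (Cg b)).
- move=> d d' g f [Ef f0 Cf]; split; first exact: csM.
    by move=> w; rewrite /= mul_col_mx mul0mx f0.
  move=> b; have -> : (fun w => (f \o pact (p := mpt (1 + n)) g) (col_mx b w)) =
    (fun w => f (col_mx (b *m g) w)) \o pact (p := mpt n) g.
    by apply/funext => w; rewrite /= mul_col_mx.
  exact: csM.
Defined.

Lemma Efib_mono m (C C' : csub (mpt n)) : csle C C' -> csle (Efib m C) (Efib m C').
Proof. by move=> CC' d f [? ? Cf]; split=> // b; apply: CC'. Qed.

Lemma cV1_cases (c : 'cV[F]_1) : c != 0 -> c = 1%:M.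
Proof.
move=> c0; apply/matrixP => i j; rewrite !ord1 !mxE eqxx /=; apply: F2_neq0 => c00.
by case/eqP: c0; apply/matrixP => u v; rewrite !ord1 c00 mxE.
Qed.

(** If C' covers C, a proper subfunctor U of Efib C' containing Efib C has finite
    length modulo Efib C: the test of isolate maps U to functions of bounded degree,
    and its kernel on U is Efib C since nothing lies between C and C'. *)
Lemma Efib_proper m (C C' : csub (mpt n)) (U : csub (mpt (1 + n))) :
  csle C' (killns m predT) -> smp (@csle _) (art (@csle _) 0) C C' ->
  csle (Efib m C) U -> csle U (Efib m C') -> ~ csle (Efib m C') U ->
  cart 1 (Efib m C) U.
Proof.
move=> C'm [CC' nC' Cmin] EU UE nU.
pose S (g : 'M[F]_1) : {set 'I_1} := if g == 0 then set0 else setT.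
have [] := @isolate 1 n 1 m (fun=> 1%:M) S (Efib m C') U C C' UE _ _ _ _ _ _ _ nU.
- by move=> d f [[]].
- by move=> d f [[]].
- by move=> d f [].
- move=> d f [_ f0 _] b w; rewrite /row_free rank_rV.
  by have [->|] := eqVneq b 0.
- move=> d f [_ f0 _] g b w; rewrite /S; case: eqP => [->|/eqP g0].
    by rewrite mul0mx f0 big_set0.
  by rewrite (cV1_cases g0) !mul1mx big_const cardsT card_ord /= addr0.
- by move=> d psi /C'm.
- move=> k d0 b0 sec d psi a b0sec Cpsi; apply: EU.
  pose P (b : 'rV[F]_d0) := (b0 <= b)%MS && (k \in S (b *m sec)).
  pose h (w : 'M[F]_(n, d0)) := psi (w *m ((1%:M + sec *m b0) *m a)).
  have Ch : C d0 h by exact: (@csM _ C _ _ ((1%:M + sec *m b0) *m a)).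
  have -> : (fun p : mpt (1 + n) d0 => if in_frame b0 p && (k \in S (usubmx p *m sec))
      then psi (dsubmx p *m (1%:M + sec *m b0) *m a) else 0) =
      (fun p : 'M[F]_(1 + n, d0) => if P (usubmx p) then h (dsubmx p) else 0).
    by apply/funext => p; rewrite /P /h mulmxA.
  split; first split.
  + move=> s ss sw; apply: killw_indicator => //.
    by apply: (C'm _ _ (CC' _ _ Ch)); rewrite ?size_map.
  + move=> b w x; rewrite !col_mxKu !col_mxKd; case: ifP => // /andP[/submxP[B EB] _].
    have B1 : B = 1%:M.
      apply: cV1_cases; apply/eqP => B0; move: b0sec.
      by rewrite EB B0 !mul0mx => /matrixP/(_ 0 0)/eqP; rewrite !mxE.
    have -> : b = b0 by rewrite EB B1 mul1mx.
    rewrite /h mulmxDl -(mulmxA x) (mulmxA b0) (mulmxDr b0) mulmx1 (mulmxA b0 sec) b0sec mul1mx.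
    by rewrite mx_addxx mul0mx mulmx0 addr0.
  + move=> w; rewrite col_mxKu; case: ifP => // /andP[/submxP[B EB] _].
    move: b0sec; rewrite EB mulmx0 mul0mx => /matrixP/(_ 0 0)/eqP; by rewrite !mxE.
  + move=> b; under eq_fun do rewrite col_mxKu col_mxKd.
    by case: (P b); [exact: Ch|exact: cs0].
move=> s [D [t [s1 [tC [k [d0 [psi0 [a0 [Cpsi0 nz]]]]]] K]]].
pose N : csub (mpt n) := @CSub (mpt n)
  (fun d psi => C' d psi /\ forall k (a : 'M_(D, d)), pairing t k psi a = 0)
  (fun d => conj (cs0 C' d) (fun k a => big1 _ _ _ (fun _ _ => erefl)))
  (fun d f g Nf Ng => conj (csD (proj1 Nf) (proj1 Ng)) (fun k a =>
     etrans (big_split _ _ _ _ _) (etrans (congr2 _ (proj2 Nf k a) (proj2 Ng k a)) (addr0 0))))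
  (fun d d' g f Nf => conj (csM g (proj1 Nf)) (fun k a => etrans
     (eq_bigr _ (fun x _ => congr1 f (esym (mulmxA x.2 a g)))) (proj2 Nf k (a *m g)))).
have NC : csle N C.
  have CN : csle C N by move=> d psi Cpsi; split=> [|k' a]; [exact: CC'|exact: tC].
  apply: (@art0_le _ (@csle _)); apply: Cmin; first by split=> // d psi [].
  by move=> /(_ _ _ Cpsi0)[_ /(_ k a0)].
pose T1 : {pred 'cV[F]_(1 + D)} := pred1 (col_mx 1%:M 0).
apply: (art_nop (o := totalop (fun=> 1%:M) t) EU _ _
  (cart_killn (T1 := T1) (T2 := @wcols 1 D) _ (size s) m)).
- move=> d f Uf f0; have [Ef f00 Cf] := UE _ _ Uf; split=> // b; apply: NC; split=> // k' a.
  have := congr1 (fun h => h (col_mx b a)) f0; rewrite /= totalE big_ord1.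
  by rewrite col_mxKu col_mxKd mul1mx (ord1 k').
- move=> d f Uf; split; last by apply: killn_total; case: (UE _ _ Uf) => -[].
  move=> s' ss' s'T; have -> : s' = [seq col_mx c (0 : 'cV_D) | c <- s]; last exact: K.
  apply: (@eq_from_nth _ 0); first by rewrite size_map.
  move=> i is'; rewrite (nth_map 0) -?ss' //.
  have /s1/cV1_cases -> : nth 0 s i \in s by rewrite mem_nth // -ss'.
  by apply/eqP; apply: s'T; exact: mem_nth.
move=> f Hf x.
have Hw y c : f (c + col_mx 0 y) = f c by apply: Hf; rewrite !inE col_mxKu eqxx orbT.
have H1 c : f (c + col_mx 1%:M 0) = f c by apply: Hf; rewrite !inE eqxx.
have -> : x = col_mx (usubmx x) 0 + col_mx 0 (dsubmx x).
  by rewrite add_col_mx addr0 add0r vsubmxK.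
rewrite Hw; have [->|/eqP/cV1_cases->] := pselect (usubmx x = 0); first by rewrite col_mx0.
by rewrite -[col_mx _ _]add0r H1.
Qed.

Lemma Efib_chain m (C C' : csub (mpt n)) : csle C' (killns m predT) ->
  cart 1 C C' -> cart 2 (Efib m C) (Efib m C').
Proof.
move=> C'm c; elim: c C'm => {C C'} [C C' CC' C'C _|C C1 C' s c IH C'm].
  by apply: cart_refl; exact: Efib_mono.
apply: cart_trans (IH C'm); case: s => [[]|s].
have C1C' : csle C1 C' by exact: (art_le (@csle_trans _) (k := 1) c).
have [CC1 _ _] := s.
apply: art_proper; [exact: csle_refl|exact: Efib_mono|move=> U [EU UE] nU].
apply: Efib_proper s EU UE nU; exact: csle_trans C'm.
Qed.

(** The difference of f under w |-> w + x *m b; the invariant functions are the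
    common kernel of these operators. *)
Definition along (x : 'cV[F]_n) : nop (mpt (1 + n)) (mpt (1 + n)) :=
  nopA (prec (block_mx 1%:M 0 x 1%:M)) (prec 1%:M).

Lemma alongE x d f p : along x d f p = dl (col_mx 0 x *m usubmx p) f p.
Proof.
rewrite /= /afun /dl mul1mx; congr (f _ + _); rewrite -[p]vsubmxK.
rewrite mul_block_col !mul1mx mul0mx addr0 col_mxKu.
by rewrite mul_col_mx mul0mx add_col_mx addr0 addrC.
Qed.

(** The differences under w |-> w + x *m b lower the degree in w. Their common kernel
    is filtered by the fibres, polynomial functions having finite length. *)
Lemma cart_lines m : cart 2 (csbot _) (killns m (@wcols 1 n)).
Proof.
elim: m => [|m IH].
  by apply: cart_refl => [|d f /killn0]; [exact: csbot_le|].
pose Pol : csub (mpt n) := killns m.+1 predT.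
apply: (@cart_trans _ _ _ (Efib m.+1 (csbot _))).
  apply: cart_refl; first exact: csbot_le.
  move=> d f [_ _ Cf]; apply/funext => p; rewrite -[p]vsubmxK.
  exact: (congr1 (fun h => h (dsubmx p)) (Cf (usubmx p))).
apply: (@cart_trans _ _ _ (Efib m.+1 Pol)).
  by apply: Efib_chain => //; exact: cart_pol.
apply: (@cart_trans _ _ _ (Einv m.+1)).
  apply: (@cart_weaken _ 1) => //.
  apply: (art_nop (o := prec (col_mx 0 1%:M : 'M_(1 + n, n))) _ _ _ (cart_pol n m.+1)).
  - by move=> d f [].
  - move=> d f [Kf If] f0; split=> // [w|b]; last exact: killn_fiber Kf.
    by have := congr1 (fun h => h w) f0; rewrite /= mul_col_mx mul0mx mul1mx.
  - move=> d f [Kf _]; rewrite /=; under eq_fun do rewrite mul_col_mx mul0mx mul1mx.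
    exact: killn_fiber Kf.
pose PL (L : seq 'cV[F]_n) : csub (mpt (1 + n)) := @CSub (mpt (1 + n))
  (fun d f => killn m.+1 (@wcols 1 n) f /\ forall x, x \in L -> along x d f = @zfun _)
  (fun d => conj (@cs0 _ (killns _ _) d) (fun x _ => nop0 (along x) d))
  (fun d f g Pf Pg => conj (@csD _ (killns _ _) _ _ _ (proj1 Pf) (proj1 Pg)) (fun x xL =>
     etrans (nopD (along x) f g) (etrans (congr2 (@afun _) (proj2 Pf x xL) (proj2 Pg x xL))
       (afun0 _))))
  (fun d d' g f Pf => conj (@csM _ (killns _ _) _ _ g _ (proj1 Pf)) (fun x xL =>
     etrans (nop_nat (along x) g f) (congr1 (fun h => h \o pact (p := mpt (1 + n)) g) (proj2 Pf x xL)))).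
have APL L : cart 2 (PL L) (killns m.+1 (@wcols 1 n)).
  elim: L => [|x L IHL]; first by apply: cart_refl => [d f []|d f Kf].
  apply: cart_trans IHL; apply: (art_nop (o := along x) _ _ _ IH) => d f [Kf Hf].
  - by split=> // y yL; apply: Hf; rewrite in_cons yL orbT.
  - move=> f0; split; first exact: Kf.
    by move=> y; rewrite in_cons => /predU1P[->|/Hf]; [exact: f0|].
  - move=> s ss sw; have -> : along x d f = (fun p => dl (col_mx 0 x *m usubmx p) f p).
      by apply/funext => p; exact: alongE.
    apply: killw_along => // e; apply: (killn_dl _ _ Kf) => //.
    by rewrite inE col_mxKu.
apply: cart_sub (APL (enum 'cV[F]_n)) => [d f [Kf Hf]|d f []//|//].
split=> // b w x; have xe : x \in enum 'cV[F]_n by rewrite mem_enum.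
have := congr1 (fun h => h (col_mx b w)) (Hf x xe); rewrite alongE /dl => /F2_eq <-.
by rewrite col_mxKu mul_col_mx mul0mx add_col_mx addr0.
Qed.
End Lines.

(** * Functions of two vectors *)

Lemma span_pair (c1 c2 : 'cV[F]_2) d (b : 'M[F]_(2, d)) : c1 != 0 -> c2 != 0 -> c1 != c2 ->
  exists t s : 'rV[F]_d, b = c1 *m t + c2 *m s.
Proof.
move=> n1 n2 n12; pose M : 'M[F]_(1 + 1, 2) := col_mx c1^T c2^T.
have Mfree : row_free M.
  apply: inj_row_free => v; rewrite -[v]hsubmxK mul_row_col.
  have s1 (u : 'M[F]_1) : u = 0 \/ u = 1%:M.
    by have [->|/cV1_cases ->] := eqVneq u 0; [left|right].
  case: (s1 (lsubmx v)) => ->; case: (s1 (rsubmx v)) => ->;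
    rewrite ?mul0mx ?mul1mx ?addr0 ?add0r ?row_mx0 // => /(congr1 trmx).
  - by rewrite trmxK trmx0 => E; rewrite E eqxx in n2.
  - by rewrite trmxK trmx0 => E; rewrite E eqxx in n1.
  - rewrite linearD /= !trmxK trmx0 => /(congr1 (fun x => x + c2)).
    by rewrite mx_addK add0r => E; rewrite E eqxx in n12.
have /row_fullP[B BM] : row_full M by rewrite /row_full; exact: Mfree.
have E : b = M^T *m (B^T *m b) by rewrite mulmxA -trmx_mul BM trmx1 mul1mx.
exists (usubmx (B^T *m b)), (dsubmx (B^T *m b)).
by rewrite {1}E -[B^T *m b in LHS]vsubmxK tr_col_mx !trmxK mul_row_col.
Qed.

(** Up to a shift, the difference along c0 + y is the sum of those along c0 and y.
    Hence a word of length a + m contains a factors c0 or m factors in T, after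
    expansion. *)
Lemma killw_mix N d (T : {pred 'cV[F]_N}) c0 s a m (f : 'M[F]_(N, d) -> F) :
  size s = (a + m)%N -> (forall x, x \in s -> x \in T \/ exists2 y, y \in T & x = c0 + y) ->
  killw (nseq a c0) f -> killn m T f -> killw s f.
Proof.
elim: s a m f => [|x s IH] [|a] [|m] f //=; try (by move=> _ _ _ /killn0 ->; exact: (killw0 _ (x :: s)));
  try (by move=> _ _ f0; have -> : f = @zfun _ by [apply/funext]; move=> _; exact: (killw0 _ (x :: s))).
move=> [ss] sT K Km e; have sT' y : y \in s -> y \in T \/ exists2 z, z \in T & y = c0 + z.
  by move=> ys; apply: sT; rewrite in_cons ys orbT.
have [xT|[y yT ->]] := sT x (mem_head _ _).
  apply: (IH a.+1 m) => //; first by rewrite ss addnS.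
    by exact: (@killw_dl _ _ (nseq a.+1 c0)).
  exact: killn_dl Km.
have -> : dl ((c0 + y) *m e) f = afun (shift (y *m e) (dl (c0 *m e) f)) (dl (y *m e) f).
  apply/funext => p; rewrite /dl /shift /afun mulmxDl !addrA F2_addK.
  by congr (f _ + _); rewrite -!addrA [y *m e + _]addrC.
apply: killwD.
  apply: (IH a m.+1) => //; first by apply: killw_shift; exact: K.
  by apply: killn_shift; exact: killn_dlw.
apply: (IH a.+1 m) => //; first by rewrite ss addnS.
  by exact: (@killw_dl _ _ (nseq a.+1 c0)).
exact: killn_dl Km.
Qed.

Section Planes.
Variable n : nat.
Local Notation bcol c := (col_mx (c : 'cV[F]_2) (0 : 'cV[F]_n)).

(** Functions of two vectors and n parameters, killed by the word s in the first two
    and of degree less than m in the parameters. *)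
Definition Zsub (s : seq 'cV[F]_2) (m : nat) : csub (mpt (2 + n)) :=
  csmeet (killws [seq bcol c | c <- s]) (killns m (@wcols 2 n)).

(** In a basis of F_2^2 containing c, the coordinate along c becomes one more
    polynomial parameter, and one vector remains. *)
Lemma cart_Z1 (c : 'cV[F]_2) a m : c != 0 -> cart 2 (csbot _) (Zsub (nseq a c) m).
Proof.
move=> c0; pose c' : 'cV[F]_2 := if c == delta_mx 0 0 then delta_mx 1 0 else delta_mx 0 0.
have d0 (i : 'I_2) : delta_mx i 0 != 0 :> 'cV[F]_2.
  by apply/eqP => /matrixP/(_ i 0)/eqP; rewrite !mxE !eqxx.
have c'0 : c' != 0 by rewrite /c'; case: ifP => _; exact: d0.
have c'c : c' != c.
  rewrite /c'; case: ifP => [/eqP->|]; last by rewrite eq_sym => ->.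
  by apply/eqP => /matrixP/(_ 0 0)/eqP; rewrite !mxE !eqxx.
pose A : 'M[F]_(2 + n, 1 + (1 + n)) :=
  col_mx (row_mx c' (row_mx c 0)) (row_mx 0 (row_mx 0 1%:M)).
have AE d (t s : 'rV_d) (w : 'M_(n, d)) : A *m col_mx t (col_mx s w) = col_mx (c' *m t + c *m s) w.
  by rewrite mul_col_mx !mul_row_col !mul0mx addr0 !add0r mul1mx.
apply: (art_nop (o := prec A) _ _ _ (cart_lines (1 + n) (a + m))).
- exact: csbot_le.
- move=> d f _ f0; apply/funext => p; rewrite -[p]vsubmxK.
  have [t [s ->]] := span_pair (usubmx p) c'0 c0 c'c.
  by rewrite -AE; exact: (congr1 (fun h => h (col_mx t (col_mx s (dsubmx p)))) f0).
- move=> d f [K Km] s ss sw; apply: killw_prec.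
  rewrite map_nseq in K; apply: (@killw_mix _ _ (@wcols 2 n) (bcol c) _ a m) => //.
    by rewrite size_map.
  move=> _ /mapP[x /sw /eqP x0 ->].
  rewrite -[x]vsubmxK x0 -[dsubmx x]vsubmxK AE mulmx0 add0r.
  have [->|/cV1_cases ->] := eqVneq (usubmx (dsubmx x)) 0.
    by left; rewrite inE mulmx0 col_mxKu.
  right; exists (col_mx 0 (dsubmx (dsubmx x))); first by rewrite inE col_mxKu.
  by rewrite add_col_mx mulmx1 addr0 add0r.
Qed.

(** If two different columns occur in s, they generate F_2^2, and a difference along
    either of them shortens the word, so that the shift criterion applies. *)
Lemma cart_Z s m : (forall c, c \in s -> c != 0) -> cart 2 (csbot _) (Zsub s m).
Proof.
have [l El] := ubnP (size s + m)%N; elim: l s m El => // l IH s m El s0.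
case: m El => [|m] El.
  by apply: cart_refl => [|d f [_ /killn0]]; [exact: csbot_le|].
case: s El s0 => [|c s] El s0.
  by apply: cart_refl => [|d f [K _]]; [exact: csbot_le|apply/funext].
have c0 := s0 c (mem_head _ _).
have [/all_pred1P ->|] := boolP (all (pred1 c) (c :: s)); first exact: cart_Z1.
move=> /allPn[c2 c2s c2c]; have c20 := s0 c2 c2s.
pose G := [:: bcol c; bcol c2] ++ enum (@wcols 2 n).
apply: (@cart_shift _ _ G) => [f Hf x|g].
  have Hw y z : f (z + col_mx 0 y) = f z.
    by apply: Hf; rewrite mem_cat mem_enum; apply/orP; right; rewrite inE col_mxKu.
  have Hc z : f (z + bcol c) = f z by apply: Hf; rewrite !inE eqxx.
  have Hc2 z : f (z + bcol c2) = f z by apply: Hf; rewrite !inE eqxx orbT.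
  have -> : x = col_mx (usubmx x) 0 + col_mx 0 (dsubmx x).
    by rewrite add_col_mx addr0 add0r vsubmxK.
  rewrite Hw; have [|t [u ->]] := span_pair (usubmx x) c0 c20; first by rewrite eq_sym.
  have s1 (v : 'M[F]_1) : v = 0 \/ v = 1%:M.
    by have [->|/cV1_cases ->] := eqVneq v 0; [left|right].
  have -> : col_mx (c *m t + c2 *m u) 0 = bcol (c *m t) + bcol (c2 *m u).
    by rewrite add_col_mx addr0.
  case: (s1 t) => ->; case: (s1 u) => ->; rewrite ?mulmx0 ?mulmx1 ?col_mx0.
  - by rewrite addr0.
  - by rewrite Hc2.
  - by rewrite addr0 -[bcol c]add0r Hc.
  - by rewrite Hc2 -[bcol c]add0r Hc.
have red c' : c' \in c :: s -> cart 2 (csbot _) (Zsub (rem c' (c :: s)) m.+1).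
  move=> c's; apply: IH => [|x /mem_rem /s0 //].
  by rewrite size_rem //= in El *.
have redK c' d (f : 'M[F]_(2 + n, d + 1) -> F) x : c' \in c :: s ->
    Zsub (c :: s) m.+1 (d + 1)%N f ->
    Zsub (rem c' (c :: s)) m.+1 d (fun p => f (row_mx p (x + bcol c')) + f (row_mx p x)).
  move=> c's [K Km]; rewrite row_mx_diff; split.
    apply: killw_restrict; move: (row_mx _ _) => e.
    have /killw_perm/(_ K) : perm_eq [seq bcol c | c <- c :: s]
       (bcol c' :: [seq bcol c | c <- rem c' (c :: s)]).
      by rewrite -(map_cons (fun c : 'cV_2 => bcol c)) perm_map // perm_to_rem.
    exact.
  move=> u su uw; apply: killw_restrict; apply: killw_dl; exact: Km.
rewrite mem_cat !inE mem_enum => /orP[/orP[/eqP->|/eqP->]|gw].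
- by exists (Zsub (rem c (c :: s)) m.+1); [apply: red|move=> d f Zf x; apply: redK] => //; exact: mem_head.
- by exists (Zsub (rem c2 (c :: s)) m.+1); [apply: red|move=> d f Zf x; apply: redK].
exists (Zsub (c :: s) m) => [|d f [K Km] x]; first by apply: IH => //; rewrite addnS in El.
rewrite row_mx_diff; split.
  by apply: killw_restrict; exact: killw_dl.
by move=> u su uw; apply: killw_restrict; exact: (killn_dl _ gw Km).
Qed.
End Planes.

(** * Alternating forms *)

Section RowSet.
Variables (n d : nat).
Implicit Types (p : 'M[F]_(n, d)) (x y : 'rV[F]_d).

Definition rset p (i : 'I_n) x : 'M[F]_(n, d) :=
  \matrix_(k, l) if k == i then x 0 l else p k l.

Lemma row_rset p i x j : row j (rset p i x) = if j == i then x else row j p.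
Proof. by apply/rowP => l; rewrite !mxE; case: ifP => //; rewrite mxE. Qed.
Lemma rset_row p i : rset p i (row i p) = p.
Proof. by apply/matrixP => k l; rewrite !mxE; case: eqP => // ->. Qed.
Lemma rset_rset p i x y : rset (rset p i x) i y = rset p i y.
Proof. by apply/matrixP => k l; rewrite !mxE; case: eqP. Qed.
Lemma rsetC p i j x y : i != j -> rset (rset p i x) j y = rset (rset p j y) i x.
Proof.
move=> ij; apply/matrixP => k l; rewrite !mxE.
by case: (eqVneq k i) => // ->; rewrite (negbTE ij).
Qed.
End RowSet.

Lemma rset_mul n d d' (p : 'M[F]_(n, d)) i x (g : 'M[F]_(d, d')) :
  rset p i x *m g = rset (p *m g) i (x *m g).
Proof.
apply/row_matrixP => k; rewrite row_mul !row_rset.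
by case: eqP => // _; rewrite row_mul.
Qed.

Section Alternating.

Definition altform n d (f : 'M[F]_(n, d) -> F) :=
  (forall p i x y, f (rset p i (x + y)) = f (rset p i x) + f (rset p i y)) /\
  (forall p i j, i != j -> row i p = row j p -> f p = 0).

Definition Altc n : csub (mpt n).
refine (@CSub (mpt n) (fun d f => altform f) _ _ _).
- by move=> d; split=> // *; rewrite /zfun addr0.
- move=> d f g [fa fe] [ga ge]; split=> [p i x y|p i j ij pij].
    by rewrite /afun fa ga addrACA.
  by rewrite /afun (fe _ _ _ ij) // (ge _ _ _ ij) // addr0.
- move=> d d' g f [fa fe]; split=> [p i x y|p i j ij pij] /=.
    by rewrite !rset_mul mulmxDl fa.
  by apply: (fe _ _ _ ij); rewrite !row_mul pij.
Defined.

Variables (n d : nat) (f : 'M[F]_(n, d) -> F).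
Hypothesis altf : altform f.

Lemma alt0 p i : f (rset p i 0) = 0.
Proof. by have := (proj1 altf) p i 0 0; rewrite addr0 F2_addxx. Qed.

Lemma alt_transvection p i j : i != j -> f (rset p i (row i p + row j p)) = f p.
Proof.
move=> ij; rewrite (proj1 altf) rset_row [X in _ + X](proj2 altf _ i j ij) ?addr0 //.
by rewrite !row_rset eqxx eq_sym (negbTE ij).
Qed.

Lemma alt_swap p i j : i != j -> f (rset (rset p j (row i p)) i (row j p)) = f p.
Proof.
move=> ij; have ji : j != i by rewrite eq_sym.
rewrite -[RHS](alt_transvection p ij) -[RHS](alt_transvection _ ji).
rewrite -[RHS](alt_transvection _ ij) !row_rset !eqxx ?(negbTE ij) ?(negbTE ji).
rewrite [row j p + (_ + _)]addrCA mx_addxx addr0 [_ + row j p]addrC mx_addK.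
by rewrite (rsetC _ _ _ ij) rset_rset.
Qed.
End Alternating.

(** A form additive in each row which vanishes when a row is the last basis vector
    does not depend on the last coordinates. *)
Lemma additive_last n d (f : 'M[F]_(n, d + 1) -> F) :
  (forall p i x y, f (rset p i (x + y)) = f (rset p i x) + f (rset p i y)) ->
  (forall p i, f (rset p i (row_mx 0 1%:M)) = 0) ->
  forall p, f p = f (row_mx (lsubmx p) 0).
Proof.
move=> fa fe p; pose clr (L : seq 'I_n) : 'M[F]_(n, d + 1) :=
  \matrix_(k, l) if k \in L then row_mx (lsubmx p) 0 k l else p k l.
have clrE L k l : clr L k l = if k \in L then row_mx (lsubmx p) 0 k l else p k l.
  by rewrite /clr mxE.
have step L : f p = f (clr L).
  elim: L => [|i L ->].
    by congr f; apply/matrixP => k l; rewrite clrE.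
  have -> : clr (i :: L) = rset (clr L) i (row i (row_mx (lsubmx p) 0)).
    apply/matrixP => k l; rewrite clrE in_cons [RHS]mxE clrE.
    by case: (eqVneq k i) => [->|//]; rewrite [RHS]mxE.
  have [iL|iL] := boolP (i \in L).
    rewrite -{1}[clr L](rset_row _ i); congr (f (rset _ _ _)).
    by apply/rowP => l; rewrite [LHS]mxE [RHS]mxE clrE iL.
  have Ei : row i (clr L) = row i (row_mx (lsubmx p) 0) + row_mx 0 (row i (rsubmx p)).
    transitivity (row i p); first by apply/rowP => l; rewrite [LHS]mxE [RHS]mxE clrE (negbTE iL).
    by rewrite -{1}[p]hsubmxK !row_row_mx row0 add_row_mx addr0 add0r.
  rewrite -{1}[clr L](rset_row _ i) Ei fa.
  have [->|/cV1_cases ->] := eqVneq (row i (rsubmx p)) 0; last by rewrite fe addr0.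
  by rewrite row_mx0; have := fa (clr L) i 0 0; rewrite addr0 F2_addxx => ->; rewrite addr0.
rewrite (step (enum 'I_n)); congr f; apply/matrixP => k l.
by rewrite clrE mem_enum.
Qed.

(** Induction on n. Contracting with a new basis vector e maps U onto a nonzero
    subfunctor of the forms of lower degree, that is onto all of them. So a form can
    be changed by a member of U to vanish when an argument is e, and then it comes
    from a space of smaller dimension. *)
Lemma Alt_simple n (U : csub (mpt n)) :
  csle U (Altc n) -> ~ csle U (csbot _) -> csle (Altc n) U.
Proof.
elim: n U => [|n IH] U UA nU.
  exact: csle_trans (const_simple nU).
pose e d : 'rV[F]_(d + 1) := row_mx 0 1%:M.
pose con d (f : 'M[F]_(1 + n, d + 1) -> F) : 'M[F]_(n, d) -> F :=
  fun w => f (col_mx (e d) (row_mx w 0)).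
have con_pull d d' (g : 'M[F]_(d, d')) (f : 'M[F]_(1 + n, d' + 1) -> F) :
    con d' f \o mulmx^~ g = con d (f \o mulmx^~ (block_mx g 0 0 1%:M)).
  apply/funext => w; rewrite /con /= mul_col_mx !mul_row_block.
  by rewrite !mulmx0 !mul0mx mulmx1 !addr0 !add0r.
pose U' : csub (mpt n) := @CSub (mpt n)
  (fun d f => exists2 f', U (d + 1)%N f' & f = con d f')
  (fun d => ex_intro2 _ _ (@zfun _) (cs0 U _) erefl)
  (fun d f g Uf Ug => let: ex_intro2 f' Uf' Ef := Uf in let: ex_intro2 g' Ug' Eg := Ug in
     ex_intro2 _ _ (afun f' g') (csD Uf' Ug') (congr2 (@afun _) Ef Eg))
  (fun d d' g f Uf => let: ex_intro2 f' Uf' Ef := Uf in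
     ex_intro2 _ _ (f' \o pact (p := mpt n.+1) (block_mx g 0 0 1%:M)) (csM _ Uf')
       (etrans (congr1 (fun h => h \o mulmx^~ g) Ef) (con_pull d d' g f'))).
have lift_rset d (w : 'M_(n, d)) i x : col_mx (e d) (row_mx (rset w i x) 0) =
    rset (col_mx (e d) (row_mx w 0)) (rshift 1 i) (row_mx x 0).
  apply/row_matrixP => k; rewrite row_rset; case: (split_ordP k) => [j ->|j ->].
    by rewrite eq_lrshift !rowKu.
  by rewrite eq_rshift !rowKd !row_row_mx row_rset; case: eqP => // _; rewrite row0.
have rowE d (w : 'M_(n, d)) i : row (rshift 1 i) (col_mx (e d) (row_mx w 0)) = row_mx (row i w) 0.
  by rewrite rowKd row_row_mx row0.
have U'A : csle U' (Altc n).
  move=> d _ [f /UA[fa fe] ->]; split=> [w i x y|w i j ij wij].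
    by rewrite /con !lift_rset -fa add_row_mx addr0.
  apply: (fe _ (rshift 1 i) (rshift 1 j)).
    by apply: contra_neq ij; exact: (@rshift_inj 1 n).
  by apply: etrans (rowE _ w i) _; rewrite wij -rowE.
have AU' : csle (Altc n) U'.
  apply: IH => // U'0; apply: nU => d f Uf; apply/funext => p.
  pose g : 'M[F]_(d + 1, d) := col_mx 1%:M (usubmx (p : 'M_(1 + n, d))).
  have Eg : col_mx (e d) (row_mx (dsubmx (p : 'M_(1 + n, d))) 0) *m g = p.
    rewrite /g mul_col_mx !mul_row_col !mul0mx mul1mx mulmx1 addr0 add0r.
    exact: vsubmxK.
  have : U' d (con d (f \o mulmx^~ g)) by exists (f \o mulmx^~ g) => //; exact: (csM g Uf).
  move=> /U'0/(congr1 (fun h => h (dsubmx (p : 'M_(1 + n, d))))).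
  exact: etrans (congr1 f (esym Eg)).
elim=> [f [fa fe]|d IHd f Af].
  suff -> : f = @zfun _ by exact: cs0.
  apply/funext => p; apply: etrans (alt0 (conj fa fe) p ord0); congr f.
  by apply/matrixP => i [].
move: f Af; rewrite -(addn1 d) => f Af; have [fa fe] := Af.
have [f1 Uf1 Ef1] : U' d (con d f).
  apply: AU'; split=> [w i x y|w i j ij wij].
    by rewrite /con !lift_rset -fa add_row_mx addr0.
  apply: (fe _ (rshift 1 i) (rshift 1 j)).
    by apply: contra_neq ij; exact: (@rshift_inj 1 n).
  by apply: etrans (rowE _ w i) _; rewrite wij -rowE.
pose h := afun f f1.
have Ah : Altc n.+1 _ h by apply: csD => //; exact: UA.
have [ha he] := Ah.
have h0 w : h (col_mx (e d) (row_mx w 0)) = 0.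
  by have := congr1 (fun h => h w) Ef1; rewrite /con /h /afun => ->; exact: F2_addxx.
have hfirst w : h (col_mx (e d) w) = 0.
  rewrite (@additive_last _ _ (fun w => h (col_mx (e d) w))) ?h0 // => [{}w i x y|{}w i].
    have E x' : col_mx (e d) (rset w i x') = rset (col_mx (e d) w) (rshift 1 i) x'.
      apply/row_matrixP => k; rewrite row_rset; case: (split_ordP k) => [j ->|j ->].
        by rewrite eq_lrshift !rowKu.
      by rewrite eq_rshift !rowKd row_rset.
    by rewrite !E ha.
  have E0 : row (lshift n (ord0 : 'I_1)) (col_mx (e d) (rset w i (e d))) =
      row (rshift 1 i) (col_mx (e d) (rset w i (e d))).
    by rewrite rowKu rowKd row_rset eqxx row_id.
  by apply: (he _ (lshift n (ord0 : 'I_1)) (rshift 1 i) _ E0); apply/eqP => /(congr1 val).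
have hlast p (i : 'I_(1 + n)) : h (rset p i (e d)) = 0.
  have hrow0 q : row (lshift n (ord0 : 'I_1)) (q : 'M_(1 + n, d + 1)) = e d -> h q = 0.
    move=> q0; rewrite -[q]vsubmxK (_ : usubmx q = e d) // -q0.
    by apply/rowP => l; rewrite !mxE; congr (q _ _); exact: val_inj.
  have [->|i0] := eqVneq i (lshift n (ord0 : 'I_1)); first by apply: hrow0; rewrite row_rset eqxx.
  rewrite -(alt_swap Ah _ i0); apply: hrow0.
  by rewrite !row_rset eq_sym (negbTE i0) eqxx eqxx.
have hE := additive_last ha hlast.
suff -> : f = afun f1 (h \o mulmx^~ (col_mx 1%:M 0 *m row_mx 1%:M 0)).
  apply: csD => //; have -> : h \o mulmx^~ (col_mx 1%:M 0 *m row_mx 1%:M 0) =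
      (h \o mulmx^~ (row_mx 1%:M 0)) \o mulmx^~ (col_mx 1%:M (0 : 'M_(1, d))).
    by apply/funext => p /=; rewrite mulmxA.
  by apply: csM; apply: IHd; exact: (csM (row_mx 1%:M 0) Ah).
apply/funext => p; rewrite /afun /= mulmxA -{3}[p]hsubmxK mul_row_col mulmx1 mulmx0 addr0.
rewrite mul_mx_row mulmx1 mulmx0 -hE /h /afun addrC F2_addK //.
Qed.

(** * Degrees of products *)

Section Products.
Variables (N d : nat) (T : {pred 'cV[F]_N}).
Implicit Types f g : 'M[F]_(N, d) -> F.

(** Leibniz rule. *)
Lemma killn_mul a b f g : killn a.+1 T f -> killn b.+1 T g ->
  killn (a + b).+1 T (fun p => f p * g p).
Proof.
move=> Kf Kg s; elim: s a b f g Kf Kg => [|x s IH] a b f g Kf Kg //= [ss] sT e.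
have xT : x \in T by apply: sT; exact: mem_head.
have sT' : {subset s <= T} by move=> y ys; apply: sT; rewrite in_cons ys orbT.
have -> : dl (x *m e) (fun p => f p * g p) =
   afun (fun p => dl (x *m e) f p * shift (x *m e) g p) (fun p => f p * dl (x *m e) g p).
  apply/funext => p; rewrite /dl /shift /afun mulrDl mulrDr !addrA.
  by rewrite F2_addK.
have Df : killn a T (dl (x *m e) f) by exact: killn_dl.
have Dg : killn b T (dl (x *m e) g) by exact: killn_dl.
apply: killwD.
- case: a {Kf} ss Df => [|a] ss Df.
    have -> : (fun p => dl (x *m e) f p * shift (x *m e) g p) = @zfun _.
      by apply/funext => p; rewrite (killn0 Df) mul0r.
    exact: killw0.
  by apply: (IH a b) => //; exact: killn_shift.
- case: b {Kg} ss Dg => [|b] ss Dg.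
    have -> : (fun p => f p * dl (x *m e) g p) = @zfun _.
      by apply/funext => p; rewrite (killn0 Dg) mulr0.
    exact: killw0.
  by apply: (IH a b) => //; rewrite ss addnS.
Qed.

Lemma killn_const (c : F) : killn 1 T (fun _ : 'M[F]_(N, d) => c).
Proof.
by case=> [|x []] // _ _ e p; rewrite /dl F2_addxx.
Qed.

Lemma killn_ge a b f : (a <= b)%N -> killn a T f -> killn b T f.
Proof.
move=> ab K s ss sT; rewrite -(cat_take_drop (b - a) s); apply: killw_catl.
by apply: K => [|x /mem_drop /sT //]; rewrite size_drop ss subKn.
Qed.

Lemma killn_prod (I : Type) (l : seq I) (P : pred I) k (f : I -> 'M[F]_(N, d) -> F) :
  (forall i, P i -> killn k.+1 T (f i)) ->
  killn (size l * k).+1 T (fun p => \prod_(i <- l | P i) f i p).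
Proof.
move=> K; elim: l => [|i l IH].
  by rewrite (_ : (fun p => _) = fun=> 1); [exact: killn_const|apply/funext => p; rewrite big_nil].
have [Pi|nPi] := boolP (P i).
  rewrite (_ : (fun p => _) = fun p => f i p * \prod_(j <- l | P j) f j p).
    by rewrite mulSn; apply: killn_mul => //; exact: K.
  by apply/funext => p; rewrite big_cons Pi.
rewrite (_ : (fun p => _) = fun p => \prod_(j <- l | P j) f j p).
  by apply: killn_ge IH; rewrite ltnS mulSn leq_addl.
by apply/funext => p; rewrite big_cons (negbTE nPi).
Qed.

Lemma killn_linear f : (forall p q, f (p + q) = f p + f q) -> killn 2 T f.
Proof.
move=> fD; case=> [|x [|y []]] // _ _ e e' p.
rewrite /dl !fD; move: (f p) (f (x *m e)) (f (y *m e')) => a b c.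
by case: (F2_cases a) => ->; case: (F2_cases b) => ->; case: (F2_cases c) => ->; exact: val_inj.
Qed.
End Products.

Lemma F2_sign (b : nat) : (-1) ^+ b = 1 :> F.
Proof. by have -> : -1 = 1 :> F; [exact: val_inj|exact: expr1n]. Qed.

Lemma killn_det N d n (T : {pred 'cV[F]_N}) (G : 'M[F]_(N, d) -> 'M[F]_n) :
  (forall p q, G (p + q) = G p + G q) -> killn n.+1 T (fun p => \det (G p)).
Proof.
move=> GD s ss sT; rewrite /determinant.
apply: (@killw_sum _ _ _ _ _ _ (fun (sg : 'S_n) p => (-1) ^+ sg * \prod_i G p i (sg i))) => sg _.
have -> : (fun p => (-1) ^+ sg * \prod_i G p i (sg i)) =
    (fun p => \prod_(i <- enum 'I_n) G p i (sg i)).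
  by apply/funext => p; rewrite F2_sign mul1r big_enum.
have := @killn_prod N d T _ (enum 'I_n) xpredT 1 (fun i p => G p i (sg i)).
rewrite muln1 size_enum_ord; apply=> // i _; apply: killn_linear => p q.
by rewrite GD mxE.
Qed.

Lemma det_altform n : altform (fun p : 'M[F]_n => \det p).
Proof.
have row'_rset p i (x : 'rV_n) : row' i (rset p i x) = row' i p.
  by apply/matrixP => k l; rewrite !mxE eq_sym (negbTE (neq_lift _ _)).
split=> [p i x y|p i j ij pij].
  rewrite (@determinant_multilinear _ _ (rset p i (x + y)) (rset p i x) (rset p i y) i 1 1).
  - by rewrite !mul1r.
  - by rewrite !row_rset eqxx !scale1r.
  - by rewrite !row'_rset.
  - by rewrite !row'_rset.
by apply: (determinant_alternate ij) => k; move/rowP: pij => /(_ k); rewrite !mxE.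
Qed.

(** By simplicity, one nonzero alternating form of bounded degree is enough: the
    determinant. *)
Lemma Alt_degree n : csle (Altc n) (killns n.+1 predT).
Proof.
apply: (@csle_trans _ (csmeet (Altc n) (killns n.+1 predT))) => [|d f []//].
apply: Alt_simple => [d f []//|].
move=> /(_ n (fun p => \det p)) H; have /H : csmeet (Altc n) (killns n.+1 predT) n (fun p => \det p).
  by split; [exact: det_altform|exact: killn_det].
by move=> /(congr1 (fun h => h 1%:M)); rewrite det1.
Qed.

(** * Functions of planes *)

Section Phi.
Variables (c : F) (n : nat).

Definition pt3 d (u v : 'rV[F]_d) (w : 'M[F]_(n, d)) : 'M[F]_(2 + n, d) :=
  col_mx (col_mx u v : 'M_(1 + 1, d)) w.

(** The functions on triples (u, v, w) that are alternating in w modulo u and v and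
    transform under changes of the basis (u, v) by the trivial representation of GL_2
    (c = 0) or by the Steinberg representation (c = 1). *)
Record in_Phi d (f : 'M[F]_(2 + n, d) -> F) : Prop := InPhi {
  PhiA : forall b : 'M_(2, d), Altc n d (fun w => f (col_mx b w));
  PhiI : forall b w (x : 'M_(n, 2)), f (col_mx b (w + x *m b)) = f (col_mx b w);
  PhiFree : forall b w, ~~ row_free b -> f (col_mx b w) = 0;
  PhiS : forall u v w, f (pt3 v u w) = f (pt3 u v w);
  PhiR : forall u v w, c * f (pt3 u v w) = f (pt3 u (u + v) w) + f (pt3 v (u + v) w) }.

Definition Phi : csub (mpt (2 + n)).
refine (@CSub (mpt (2 + n)) (fun d f => in_Phi f) _ _ _).
- by move=> d; split=> // [b|u v w]; [exact: cs0|rewrite /zfun mulr0 addr0].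
- move=> d f g [fA fI fF fS fR] [gA gI gF gS gR]; split.
  + by move=> b; exact: (csD (fA b) (gA b)).
  + by move=> b w x; rewrite /afun fI gI.
  + by move=> b w nb; rewrite /afun fF // gF // addr0.
  + by move=> u v w; rewrite /afun fS gS.
  + by move=> u v w; rewrite /afun mulrDr fR gR addrACA.
- move=> d d' g f [fA fI fF fS fR].
  have pt3M u v w : pt3 u v w *m g = pt3 (u *m g) (v *m g) (w *m g).
    by rewrite /pt3 mul_col_mx; congr col_mx; exact: (mul_col_mx u v g).
  split.
  + move=> b; have -> : (fun w => (f \o pact (p := mpt (2 + n)) g) (col_mx b w)) =
      (fun w => f (col_mx (b *m g) w)) \o pact (p := mpt n) g.
      by apply/funext => w; rewrite /= mul_col_mx.
    exact: csM (fA _).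
  + by move=> b w x; rewrite /= !mul_col_mx mulmxDl -mulmxA fI.
  + move=> b w nb; rewrite /= mul_col_mx fF //; apply: contra nb => fb.
    rewrite /row_free eqn_leq rank_leq_row /=; apply: leq_trans (mxrankM_maxl b g).
    by rewrite (eqP fb).
  + by move=> u v w; rewrite /= !pt3M fS.
  + by move=> u v w; rewrite /= !pt3M fR mulmxDl.
Defined.
End Phi.

Definition row_u N d (p : 'M[F]_(2 + N, d)) : 'rV[F]_d := usubmx (usubmx p : 'M_(1 + 1, d)).
Definition row_v N d (p : 'M[F]_(2 + N, d)) : 'rV[F]_d := dsubmx (usubmx p : 'M_(1 + 1, d)).

Lemma pt3P N d (p : 'M[F]_(2 + N, d)) : p = pt3 (row_u p) (row_v p) (dsubmx p).
Proof. by rewrite /pt3 /row_u /row_v !vsubmxK. Qed.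
Lemma row_u_pt N d u v (w : 'M[F]_(N, d)) : row_u (pt3 u v w) = u.
Proof. by rewrite /row_u /pt3 !col_mxKu. Qed.
Lemma row_v_pt N d u v (w : 'M[F]_(N, d)) : row_v (pt3 u v w) = v.
Proof. by rewrite /row_v /pt3 col_mxKu col_mxKd. Qed.
Lemma pt3_mul N d d' u v (w : 'M[F]_(N, d)) (g : 'M[F]_(d, d')) :
  pt3 u v w *m g = pt3 (u *m g) (v *m g) (w *m g).
Proof. by rewrite /pt3 mul_col_mx; congr col_mx; exact: (mul_col_mx u v g). Qed.

(** The nonzero columns of F_2^2: the differences along k1, k2 and k3 leave v, u and
    u + v unchanged, respectively. *)
Definition k1 : 'cV[F]_2 := col_mx (1%:M : 'M_1) (0 : 'M_1).
Definition k2 : 'cV[F]_2 := col_mx (0 : 'M_1) (1%:M : 'M_1).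
Definition k3 : 'cV[F]_2 := col_mx (1%:M : 'M_1) (1%:M : 'M_1).
Definition word3 M := nseq M k1 ++ nseq M k2 ++ nseq M k3.

Lemma M1_cases (a : 'M[F]_1) : a = 0 \/ a = 1%:M.
Proof. by have [->|/cV1_cases ->] := eqVneq a 0; [left|right]. Qed.

Lemma cV2_cases (c : 'cV[F]_2) : c != 0 -> [\/ c = k1, c = k2 | c = k3].
Proof.
pose c' : 'cV[F]_(1 + 1) := c; have -> : c = col_mx (usubmx c') (dsubmx c') by rewrite vsubmxK.
case: (M1_cases (usubmx c')) => ->; case: (M1_cases (dsubmx c')) => ->; by
  [rewrite col_mx0 eqxx|constructor 2|constructor 1|constructor 3].
Qed.

Lemma M1_neq0 : (1%:M : 'M[F]_1) <> 0.
Proof. by move/matrixP/(_ 0 0)/eqP; rewrite !mxE. Qed.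

Lemma k_neq0 : [/\ k1 != 0, k2 != 0 & k3 != 0].
Proof.
have E (a b : 'M[F]_1) : a = 1%:M \/ b = 1%:M -> (col_mx a b : 'cV_2) != 0.
  move=> ab; apply/eqP; rewrite -[RHS](@col_mx0 _ 1 1 1) => E.
  have [a0 b0] := @eq_col_mx _ 1 1 1 _ _ _ _ E.
  by case: ab => [|]; rewrite ?a0 ?b0 => /esym; exact: M1_neq0.
by split; apply: E; [left|right|left].
Qed.

Lemma word3_neq0 M c : c \in word3 M -> c != 0.
Proof.
have [n1 n2 n3] := k_neq0.
by rewrite !mem_cat => /or3P[] /nseqP[->].
Qed.

Lemma killw_fibers r n d s (f : 'M[F]_(r + n, d) -> F) : {subset s <= @wcols r n} ->
  (forall b, killw [seq dsubmx x | x <- s] (fun w => f (col_mx b w))) -> killw s f.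
Proof.
elim: s f => [f _ f0 p|x s IH f sw K e] /=.
  by rewrite -[p]vsubmxK; exact: f0.
have /eqP x0 := sw x (mem_head _ _).
apply: IH => [y ys|b]; first by apply: sw; rewrite in_cons ys orbT.
have -> : (fun w => dl (x *m e) f (col_mx b w)) = dl (dsubmx x *m e) (fun w => f (col_mx b w)).
  by apply/funext => w; rewrite /dl -{1}[x]vsubmxK x0 mul_col_mx mul0mx add_col_mx addr0.
exact: K.
Qed.

Section PhiFacts.
Variables (c : F) (n : nat).
Variables (d : nat) (f : 'M[F]_(2 + n, d) -> F).
Hypothesis Pf : Phi c n d f.

Lemma not_free (y : 'rV[F]_2) (b : 'M[F]_(2, d)) : y != 0 -> y *m b = 0 -> ~~ row_free b.
Proof. by move=> y0 yb; apply: contra y0 => fb; rewrite -(mulmx_free_eq0 _ fb) yb. Qed.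

Lemma row_neq0 (a : 'M[F]_1) : (row_mx (1%:M : 'M_1) a : 'rV_2) != 0.
Proof.
apply/eqP; rewrite -[RHS](@row_mx0 _ 1 1 1) => E.
by have [/M1_neq0] := @eq_row_mx _ 1 1 1 _ _ _ _ E.
Qed.

Lemma Phi0l v w : f (pt3 0 v w) = 0.
Proof.
apply: (PhiFree Pf); apply: (not_free (row_neq0 0)).
apply: etrans (mul_row_col (1%:M : 'M_1) (0 : 'M_1) (0 : 'M_(1, d)) v) _.
by rewrite mulmx0 mul0mx addr0.
Qed.
Lemma Phi0r u w : f (pt3 u 0 w) = 0.
Proof. by rewrite (PhiS Pf) Phi0l. Qed.
Lemma Phixx u w : f (pt3 u u w) = 0.
Proof.
apply: (PhiFree Pf); apply: (not_free (row_neq0 1%:M)).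
apply: etrans (mul_row_col (1%:M : 'M_1) (1%:M : 'M_1) u u) _.
by rewrite mul1mx mx_addxx.
Qed.

Lemma Phi_uv u v w : f (pt3 v (u + v) w) = c * f (pt3 u v w) + f (pt3 u (u + v) w).
Proof. by rewrite (PhiR Pf) addrAC F2_addxx add0r. Qed.

Lemma Phi_wdegree : killn n.+1 (@wcols 2 n) f.
Proof.
move=> s ss sw; apply: killw_fibers => // b; apply: (Alt_degree (PhiA Pf b)) => //.
by rewrite size_map.
Qed.
End PhiFacts.

(** tau sends the frame (u, v) to (u, u + v), and swp sends it to (v, u). *)
Definition tau : 'M[F]_2 := block_mx (1%:M : 'M_1) (0 : 'M_1) (1%:M : 'M_1) (1%:M : 'M_1).
Definition swp : 'M[F]_2 := block_mx (0 : 'M_1) (1%:M : 'M_1) (1%:M : 'M_1) (0 : 'M_1).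

Lemma tauE d (u v : 'rV[F]_d) : tau *m (col_mx u v : 'M_(1 + 1, d)) = (col_mx u (u + v) : 'M_(1 + 1, d)).
Proof.
apply: etrans (mul_block_col (1%:M : 'M_1) (0 : 'M_1) (1%:M : 'M_1) (1%:M : 'M_1) u v) _.
by rewrite !mul1mx mul0mx addr0.
Qed.
Lemma swpE d (u v : 'rV[F]_d) : swp *m (col_mx u v : 'M_(1 + 1, d)) = (col_mx v u : 'M_(1 + 1, d)).
Proof.
apply: etrans (mul_block_col (0 : 'M_1) (1%:M : 'M_1) (1%:M : 'M_1) (0 : 'M_1) u v) _.
by rewrite !mul1mx !mul0mx addr0 add0r.
Qed.

(** The values at all frames of the plane of (u, v) are determined by the one at (u, v)
    when c = 0, and by those at (u, v) and (u, u + v) when c = 1, the Steinberg representation having dimension two. *)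
Lemma frame_red n (g : 'M[F]_2) :
  (exists S : {set 'I_1}, forall d (f : 'M[F]_(2 + n, d) -> F), Phi 0 n d f ->
     forall b w, f (col_mx (g *m b) w) = \sum_(k in S) f (col_mx (1%:M *m b) w)) /\
  (exists S : {set 'I_2}, forall d (f : 'M[F]_(2 + n, d) -> F), Phi 1 n d f ->
     forall b w, f (col_mx (g *m b) w) =
       \sum_(k in S) f (col_mx ((if k == 0 then 1%:M else tau) *m b) w)).
Proof.
pose g' : 'M[F]_(1 + 1, 1 + 1) := g.
have Eg : g = block_mx (ulsubmx g') (ursubmx g') (dlsubmx g') (drsubmx g') by rewrite submxK.
have gE d (u v : 'rV[F]_d) : g *m (col_mx u v : 'M_(1 + 1, d)) = (col_mx
   (ulsubmx g' *m u + ursubmx g' *m v) (dlsubmx g' *m u + drsubmx g' *m v) : 'M_(1 + 1, d)).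
  rewrite Eg.
  exact: (mul_block_col (ulsubmx g') (ursubmx g') (dlsubmx g') (drsubmx g') u v).
have bE d (b : 'M[F]_(2, d)) : exists u v : 'rV_d, b = (col_mx u v : 'M_(1 + 1, d)).
  by exists (usubmx (b : 'M_(1 + 1, d))), (dsubmx (b : 'M_(1 + 1, d))); rewrite vsubmxK.
have big2 d (f : 'M[F]_(2 + n, d) -> F) b w :
  \sum_(k in [set (0 : 'I_2); 1]) f (col_mx ((if k == 0 then 1%:M else tau) *m b) w) =
  f (col_mx b w) + f (col_mx (tau *m b) w).
  rewrite big_setU1 ?inE //= big_set1 /= mul1mx //.
have sum1 d (f : 'M[F]_(2 + n, d) -> F) b w :
  \sum_(k in [set: 'I_1]) f (col_mx (1%:M *m b) w) = f (col_mx b w).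
  by rewrite mul1mx big_const cardsT card_ord /= addr0.
have E00 d (u v : 'rV[F]_d) : 0 *m u + 0 *m v = 0 :> 'rV_d by rewrite !mul0mx addr0.
have E01 d (u v : 'rV[F]_d) : 0 *m u + 1%:M *m v = v by rewrite mul0mx mul1mx add0r.
have E10 d (u v : 'rV[F]_d) : 1%:M *m u + 0 *m v = u by rewrite mul0mx mul1mx addr0.
have E11 d (u v : 'rV[F]_d) : 1%:M *m u + 1%:M *m v = u + v by rewrite !mul1mx.
have pE d (u v : 'rV[F]_d) w : col_mx (col_mx u v : 'M_(1 + 1, d)) w = pt3 u v w :> 'M_(2 + n, d) by [].
have R0 d (f : 'M[F]_(2 + n, d) -> F) u v w : Phi 0 n d f ->
    f (pt3 u (u + v) w) = f (pt3 u v w) /\ f (pt3 v (u + v) w) = f (pt3 u v w).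
  move=> Pf; have RR u' v' : f (pt3 v' (u' + v') w) = f (pt3 u' (u' + v') w).
    by rewrite (Phi_uv Pf) mul0r add0r.
  have E := RR (u + v) v; rewrite mx_addK in E.
  have E1 : f (pt3 u (u + v) w) = f (pt3 u v w) by rewrite (PhiS Pf (u + v) u) -E (PhiS Pf u v).
  by rewrite RR E1.
move: (ulsubmx g') (ursubmx g') (dlsubmx g') (drsubmx g') gE => a1 a2 a3 a4 gE {Eg g'}.
split.
- case: (M1_cases a1) gE => -> gE; case: (M1_cases a2) gE => -> gE;
  case: (M1_cases a3) gE => -> gE; case: (M1_cases a4) gE => -> gE;
  first [exists set0 => d f Pf b w; have [u [v ->]] := bE d b; rewrite gE ?E00 ?E01 ?E10 ?E11 pE big_set0;
           by rewrite ?(Phi0l Pf) ?(Phi0r Pf) ?(Phixx Pf)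
        |exists setT => d f Pf b w; have [u [v ->]] := bE d b; rewrite sum1 gE ?E00 ?E01 ?E10 ?E11 !pE;
           have [H1 H2] := R0 d f u v w Pf; by rewrite ?(PhiS Pf u (u + v)) ?(PhiS Pf v (u + v)) ?(PhiS Pf u v) ?H1 ?H2].
- case: (M1_cases a1) gE => -> gE; case: (M1_cases a2) gE => -> gE;
  case: (M1_cases a3) gE => -> gE; case: (M1_cases a4) gE => -> gE;
  first [exists set0 => d f Pf b w; have [u [v ->]] := bE d b; rewrite gE ?E00 ?E01 ?E10 ?E11 pE big_set0;
           by rewrite ?(Phi0l Pf) ?(Phi0r Pf) ?(Phixx Pf)
        |exists [set 0] => d f Pf b w; have [u [v ->]] := bE d b; rewrite gE ?E00 ?E01 ?E10 ?E11 big_set1 /= mul1mx !pE;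
           by rewrite ?(PhiS Pf u v)
        |exists [set 1] => d f Pf b w; have [u [v ->]] := bE d b; rewrite gE ?E00 ?E01 ?E10 ?E11 big_set1 /= tauE !pE;
           by rewrite ?(PhiS Pf u (u + v))
        |exists [set 0; 1] => d f Pf b w; have [u [v ->]] := bE d b; rewrite gE ?E00 ?E01 ?E10 ?E11 big2 tauE !pE;
           by rewrite ?(PhiS Pf v (u + v)) (Phi_uv Pf) mul1r].
Qed.

(** * Proper subfunctors of Phi *)

Definition bcol D (c : 'cV[F]_2) : 'cV[F]_(2 + D) := col_mx c 0.

Lemma killw_submap (I : eqType) N d (g : I -> 'cV[F]_N) (s s' : seq I) (f : 'M[F]_(N, d) -> F) :
  (forall c, count_mem c s <= count_mem c s')%N -> killw (map g s) f -> killw (map g s') f.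
Proof.
move=> /count_subseqP[u su pu] K; have := killw_perm (perm_map g pu) K.
by apply: killw_count => c; apply: leq_count_subseq; exact: map_subseq.
Qed.

Lemma count_word3 s c : (forall c, c \in s -> c != 0) ->
  (count_mem c s <= count_mem c (word3 (size s)))%N.
Proof.
move=> s0; have [cs|/count_memPn -> //] := boolP (c \in s).
apply: leq_trans (count_size _ _) _; rewrite !count_cat !count_nseq.
have E : pred1 c c = true := eqxx c.
have [Ec|Ec|Ec] := cV2_cases (s0 c cs); rewrite -Ec E mul1n.
- exact: leq_addr.
- by rewrite addnCA; exact: leq_addr.
- by rewrite addnA; exact: leq_addl.
Qed.

Section Extract.
Variables (n q D : nat) (t : seq ('I_q * 'M[F]_(n, D))).
Hypothesis sept : separates (csbot _) (Altc n) t.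

Definition pairing0 : csub (mpt n).
refine (@CSub (mpt n) (fun d f => forall k a, pairing t k f a = 0) _ _ _).
- by move=> d k a; rewrite /pairing big1.
- move=> d f g f0 g0 k a.
  by rewrite -[RHS](addr0 0) -{1}(f0 k a) -(g0 k a) /pairing -big_split.
- move=> d d' g f f0 k a; rewrite -[RHS](f0 k (a *m g)).
  by apply: eq_bigr => x _; rewrite /= mulmxA.
Defined.

(** The forms with vanishing pairings make up a subfunctor, proper since t separates,
    hence zero since Altc n is simple. *)
Lemma pairing_detects d (psi : 'M[F]_(n, d) -> F) : Altc n d psi ->
  (forall k a, pairing t k psi a = 0) -> psi = @zfun _.
Proof.
pose N := csmeet (Altc n) pairing0.
have N0 : csle N (csbot _).
  apply: contrapT => /Alt_simple AN; have [_ [k [d' [psi' [a [Apsi nz]]]]]] := sept.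
  by apply: nz; have [|_] := AN _ d' psi' Apsi; [move=> ? ? []|exact].
by move=> Apsi psi0; apply: N0.
Qed.

Definition fpairing k d (f : 'M[F]_(2 + n, d) -> F) (p : 'M[F]_(2 + D, d)) :=
  pairing t k (fun w => f (col_mx (usubmx p) w)) (dsubmx p).

(** Induction on the word, the empty word being the case of pairing_detects. *)
Lemma killw_extract s d (f : 'M[F]_(2 + n, d) -> F) :
  (forall b : 'M[F]_(2, d), Altc n d (fun w => f (col_mx b w))) ->
  (forall k, killw (map (bcol D) s) (fpairing k f)) ->
  killw (map (bcol n) s) f.
Proof.
elim: s f => [|c s IH] f Af K /=.
  move=> p; rewrite -[p]vsubmxK.
  apply: (congr1 (fun h => h (dsubmx p)) (pairing_detects (Af (usubmx p)) _)) => k a.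
  by have := K k (col_mx (usubmx p) a); rewrite /fpairing col_mxKu col_mxKd.
move=> e; apply: IH => [b|k].
  have -> : (fun w => dl (bcol n c *m e) f (col_mx b w)) =
      afun (fun w => f (col_mx (b + c *m e) w)) (fun w => f (col_mx b w)).
    by apply/funext => w; rewrite /dl /afun mul_col_mx mul0mx add_col_mx addr0.
  by apply: csD; exact: Af.
have -> : fpairing k (dl (bcol n c *m e) f) = dl (bcol D c *m e) (fpairing k f).
  apply/funext => p; rewrite /fpairing /pairing /dl big_split /=.
  rewrite !linearD /= !mul_col_mx !mul0mx !col_mxKu !col_mxKd addr0.
  by congr (_ + _); apply: eq_bigr => x _; rewrite add_col_mx addr0.
exact: K.
Qed.
End Extract.

Lemma swp_k : [/\ swp *m k1 = k2, swp *m k2 = k1 & swp *m k3 = k3].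
Proof. by split; exact: swpE. Qed.
Lemma tau_k : [/\ tau *m k1 = k3, tau *m k2 = k2 & tau *m k3 = k1].
Proof.
split; apply: (etrans (tauE _ _)); rewrite ?addr0 ?add0r //.
by rewrite mx_addxx.
Qed.

Lemma killw_word3 D M (A : 'M[F]_2) d (f : 'M[F]_(2 + D, d) -> F) : A = swp \/ A = tau ->
  killw (map (bcol D) (word3 M)) f ->
  killw (map (bcol D) (word3 M)) (fun p => f (block_mx A 0 0 1%:M *m p)).
Proof.
move=> EA K; apply: killw_prec; apply: killw_perm K.
have -> : [seq block_mx A 0 0 1%:M *m i | i <- map (bcol D) (word3 M)] =
   map (bcol D) (map (mulmx A) (word3 M)).
  rewrite -!map_comp; apply: eq_map => c /=.
  by rewrite mul_block_col !mul0mx mulmx0 !addr0.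
apply: perm_map; rewrite !map_cat !map_nseq.
have [s1 s2 s3] := swp_k; have [t1 t2 t3] := tau_k.
case: EA => ->.
  by rewrite s1 s2 s3 /word3 perm_catCA.
by rewrite t1 t2 t3 /word3 perm_catC -catA perm_catCA.
Qed.

(** The relation provided by isolate involves f(u, v) alone when c = 0, and both
    f(u, v) and f(u, u + v) when c = 1. In the second case, adding the relation with
    u and v exchanged leaves one pairing, because
    f(u, u + v) + f(v, u + v) = f(u, v). *)
Lemma Phi_proper (c : F) n (U : csub (mpt (2 + n))) : csle U (Phi c n) -> ~ csle (Phi c n) U ->
  exists M, csle U (Zsub n (word3 M) n.+1).
Proof.
move=> UP nPU.
have iso q (A : 'I_q -> 'M[F]_2) :
  (forall g : 'M[F]_2, exists S : {set 'I_q}, forall d (f : 'M[F]_(2 + n, d) -> F), Phi c n d f ->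
     forall b w, f (col_mx (g *m b) w) = \sum_(k in S) f (col_mx (A k *m b) w)) ->
  exists M D (t : seq ('I_q * 'M[F]_(n, D))), separates (csbot _) (Altc n) t /\
     forall d f, U d f -> killw [seq bcol D c | c <- word3 M] (total A t f).
  move=> /choice[S HS].
  have [|||||||s [D [t [s0 sept K]]]] := @isolate 2 n q n.+1 A S (Phi c n) U (csbot _) (Altc n)
      UP _ _ _ _ _ _ _ nPU.
  - by move=> d f; exact: Phi_wdegree.
  - by move=> d f Pf; exact: (PhiI Pf).
  - by move=> d f Pf; exact: (PhiA Pf).
  - by move=> d f Pf; exact: (PhiFree Pf).
  - by move=> d f Pf g; exact: HS.
  - by move=> d f; exact: Alt_degree.
  - move=> k d0 b0 sec d psi a _ ->.
    by rewrite (_ : (fun _ => _) = @zfun _); [exact: cs0|apply/funext => p; case: ifP].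
  exists (size s), D, t; split=> // d f /K; apply: killw_submap => x.
  exact: count_word3.
have fin M q D (t : seq ('I_q * 'M[F]_(n, D))) : separates (csbot _) (Altc n) t ->
   (forall d f, U d f -> forall k, killw (map (bcol D) (word3 M)) (fpairing t k f)) ->
   csle U (Zsub n (word3 M) n.+1).
  move=> sept K d f Uf; split; last exact: Phi_wdegree (UP _ _ Uf).
  apply: (killw_extract sept) => [b|k]; last exact: K.
  exact: (PhiA (UP _ _ Uf)).
case: (F2_cases c) => Ec; rewrite {}Ec in UP nPU iso.
  have [|M [D [t [sept K]]]] := iso 1 (fun=> 1%:M); first by move=> g; exact: (proj1 (frame_red n g)).
  exists M; apply: fin sept _ => d f Uf k.
  have := K d f Uf; congr killw; apply/funext => p.
  rewrite totalE big_ord1 /fpairing (ord1 k).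
  by congr (pairing t _ _ _); apply/funext => w; rewrite mul1mx.
have [|M [D [t [sept K]]]] := iso 2 (fun k => if k == 0 then 1%:M else tau).
  by move=> g; exact: (proj2 (frame_red n g)).
exists M; apply: fin sept _ => d f Uf.
have Pf := UP _ _ Uf; have KG := K d f Uf.
pose bl A : 'M[F]_(2 + D) := block_mx A 0 0 1%:M.
have blE A (p : 'M_(2 + D, d)) : bl A *m p = col_mx (A *m usubmx p) (dsubmx p).
  by rewrite -[p in LHS]vsubmxK mul_block_col !mul0mx mul1mx addr0 add0r.
have pE (p : 'M_(2 + D, d)) : exists u v w, p = pt3 u v w.
  exists (usubmx (usubmx p : 'M_(1 + 1, d))), (dsubmx (usubmx p : 'M_(1 + 1, d))), (dsubmx p).
  by rewrite /pt3 !vsubmxK.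
have blT u v (w : 'M_(D, d)) : bl tau *m pt3 u v w = pt3 u (u + v) w.
  by rewrite blE /pt3 col_mxKu col_mxKd tauE.
have blS u v (w : 'M_(D, d)) : bl swp *m pt3 u v w = pt3 v u w.
  by rewrite blE /pt3 col_mxKu col_mxKd swpE.
have HE k u v (w : 'M_(D, d)) : fpairing t k f (pt3 u v w) = pairing t k (fun w => f (pt3 u v w)) w.
  by rewrite /fpairing /pt3 col_mxKu col_mxKd.
pose H0 := fpairing t 0 f; pose H1 := fpairing t 1 f.
have GE p : total (fun k => if k == 0 then 1%:M else tau) t f p = H0 p + H1 (bl tau *m p).
  rewrite totalE big_ord_recl big_ord1 /=; congr (_ + _).
    by rewrite /H0 /fpairing; congr (pairing t _ _ _); apply/funext => w; rewrite mul1mx.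
  by rewrite /H1 /fpairing blE col_mxKu col_mxKd.
set G := total _ t f in GE KG.
have H1E : H1 = afun G (fun p => G (bl swp *m p)).
  apply/funext => p; have [u [v [w ->]]] := pE p; rewrite /afun !GE !blT blS blT.
  rewrite /H0 /H1 !HE (_ : (fun w => f (pt3 v u w)) = (fun w => f (pt3 u v w))); last first.
    by apply/funext => w'; exact: (PhiS Pf).
  rewrite addrACA F2_addxx add0r (addrC v u) /pairing -big_split /=; apply: eq_bigr => x _.
  by rewrite -(PhiR Pf) mul1r.
have K1 : killw (map (bcol D) (word3 M)) H1.
  by rewrite H1E; apply: killwD => //; apply: killw_word3 => //; left.
have H0E : H0 = afun G (fun p => H1 (bl tau *m p)).
  by apply/funext => p; rewrite /afun GE F2_addK.
have K0 : killw (map (bcol D) (word3 M)) H0.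
  by rewrite H0E; apply: killwD => //; apply: killw_word3 => //; right.
by move=> k; case: k => [[|[|//]] ik]; [have -> : Ordinal ik = 0|have -> : Ordinal ik = 1];
  try exact: val_inj.
Qed.

(** An iterated difference whose proper partial sums are zeros of f
    reduces to its leading term. *)
Lemma killw_top N d (I : eqType) (l : seq I) (cc : I -> 'cV[F]_N) (ee : I -> 'rV[F]_d)
    (f : 'M[F]_(N, d) -> F) p : uniq l -> killw (map cc l) f ->
  (forall (J : pred I) i, i \in l -> ~~ J i -> f (p + \sum_(j <- l | J j) cc j *m ee j) = 0) ->
  f (p + \sum_(j <- l) cc j *m ee j) = 0.
Proof.
elim: l f p => [|i l IH] f p /=; first by move=> _ f0 _; exact: f0.
move=> /andP[il ul] K f0.
have eqJ (J J' : pred I) : {in l, J =1 J'} ->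
    \sum_(j <- l | J j) cc j *m ee j = \sum_(j <- l | J' j) cc j *m ee j.
  by move=> JJ; rewrite big_seq_cond [RHS]big_seq_cond; apply: eq_bigl => j; apply: andb_id2l => /JJ.
have := IH (dl (cc i *m ee i) f) p ul (K (ee i)) _.
rewrite /dl big_cons => H; have {}H := H _.
have -> : f (p + (cc i *m ee i + \sum_(j <- l) cc j *m ee j)) =
    f (p + \sum_(j <- l) cc j *m ee j).
  rewrite addrCA [_ + (p + _)]addrC; apply: F2_eq; apply: H => J k kl nJ.
  have ki : k != i by apply: contraNneq il => <-.
  have := f0 (fun j => (j == i) || J j) k; rewrite in_cons kl orbT (negbTE ki) /= => /(_ isT nJ).
  rewrite big_cons eqxx /= [X in p + X]addrC addrA (eqJ _ J) => [->|j jl]; last first.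
    by rewrite (_ : j == i = false) //; apply/eqP => ji; rewrite -ji jl in il.
  have := f0 (fun j => (j != i) && J j) i; rewrite mem_head eqxx /= => /(_ isT isT).
  rewrite big_cons eqxx /= (eqJ _ J) => [->|j jl]; first by rewrite addr0.
  by rewrite (_ : j != i) //; apply/eqP => ji; rewrite -ji jl in il.
have := f0 (fun j => j != i) i; rewrite mem_head eqxx => /(_ isT isT).
rewrite big_cons eqxx /= -(eqJ predT) => [->//|j jl].
by rewrite (_ : j != i) //; apply/eqP => ji; rewrite -ji jl in il.
Qed.

Lemma killn_fixed N d (T : {pred 'cV[F]_N}) (f : 'M[F]_(N, d) -> F) :
  (forall c e p, c \in T -> f (p + c *m e) = f p) -> killn 1 T f.
Proof.
move=> fT; case=> [|x []] // _ sT e p.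
by rewrite /dl fT ?F2_addxx //; apply: sT; exact: mem_head.
Qed.

(** * The witnesses *)

Section Witness.
Variables (c : F) (n N k : nat).
Let L := (N + k)%N.
Let d := (L + 2 + n)%N.
Implicit Types u v : 'rV[F]_d.

(** Monomials: fA in the first N coordinates, gA in the next k ones. The rest of the
    coordinates is used by the determinant. *)
Definition mon m (h : 'I_m -> 'I_d) u : F := \prod_(i <- enum 'I_m) u 0 (h i).
Definition fI (i : 'I_N) : 'I_d := lshift n (lshift 2 (lshift k i)).
Definition gI (i : 'I_k) : 'I_d := lshift n (lshift 2 (rshift N i)).
Definition fA u := mon fI u.
Definition gA u := mon gI u.
Definition alp u v := fA u * gA v + fA v * gA u.
Definition sel : 'M[F]_(d, 2 + n) := block_mx (col_mx (0 : 'M_(L, 2)) 1%:M) 0 0 1%:M.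
(** The symmetric function alp, made to satisfy the relation of Phi between the
    three frames of a plane. *)
Definition phi0 u v := alp u (u + v) + alp v (u + v) + (c + 1) * alp u v.
Definition wit p := phi0 (row_u p) (row_v p) * \det (p *m sel).

Lemma row_uD (p q : 'M[F]_(2 + n, d)) : row_u (p + q) = row_u p + row_u q.
Proof. by rewrite /row_u !linearD. Qed.
Lemma row_vD (p q : 'M[F]_(2 + n, d)) : row_v (p + q) = row_v p + row_v q.
Proof. by rewrite /row_v !linearD. Qed.
Lemma row_u_dir y (e : 'rV[F]_d) : row_u (bcol n y *m e) = usubmx (y : 'cV_(1 + 1)) *m e.
Proof. by rewrite /row_u mul_col_mx col_mxKu -[y in LHS](@vsubmxK _ 1 1) [_ *m e](mul_col_mx (usubmx (y : 'cV_(1 + 1)))) col_mxKu. Qed.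
Lemma row_v_dir y (e : 'rV[F]_d) : row_v (bcol n y *m e) = dsubmx (y : 'cV_(1 + 1)) *m e.
Proof. by rewrite /row_v mul_col_mx col_mxKu -[y in LHS](@vsubmxK _ 1 1) [_ *m e](mul_col_mx (usubmx (y : 'cV_(1 + 1)))) col_mxKd. Qed.

Lemma alpC u v : alp u v = alp v u. Proof. exact: addrC. Qed.

Lemma det_col_sum (b : 'M_(2, d)) w (x : 'M_(n, 2)) :
  \det (col_mx b (w + x *m b) *m sel) = \det (col_mx b w *m sel).
Proof.
have -> : col_mx b (w + x *m b) = block_mx 1%:M 0 x 1%:M *m col_mx b w.
  by rewrite mul_block_col mul0mx !mul1mx addr0 addrC.
by rewrite -mulmxA det_mulmx det_lblock !det1 !mul1r.
Qed.

Lemma det_block_left A (p : 'M_(2 + n, d)) :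
  \det (col_mx (A *m usubmx p) (dsubmx p) *m sel) = \det A * \det (p *m sel).
Proof.
have -> : col_mx (A *m usubmx p) (dsubmx p) = block_mx A 0 0 1%:M *m p.
  by rewrite -[p in RHS]vsubmxK mul_block_col !mul0mx mul1mx addr0 add0r.
by rewrite -mulmxA det_mulmx det_ublock det1 mulr1.
Qed.

Lemma det_tau : \det tau = 1.
Proof. by rewrite (@det_lblock _ 1 1) !det1 mulr1. Qed.
Lemma det_swp : \det swp = 1.
Proof.
have E : swp *m swp = 1%:M.
  apply: etrans (mulmx_block (0 : 'M_1) (1%:M : 'M_1) (1%:M : 'M_1) (0 : 'M_1) 0 1%:M 1%:M 0) _.
  by rewrite !mul1mx !mulmx1 !mulmx0 !addr0 !add0r; apply: esym; exact: (@scalar_mx_block _ 1 1).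
apply: F2_neq0 => d0; have := congr1 determinant E; rewrite det_mulmx d0 mul0r det1.
by move/eqP.
Qed.

Lemma wit_pt u v w : wit (pt3 u v w) = phi0 u v * \det (pt3 u v w *m sel).
Proof. by rewrite /wit row_u_pt row_v_pt. Qed.

Lemma wit_Phi : Phi c n d wit.
Proof.
have dS u v w : \det (pt3 v u w *m sel) = \det (pt3 u v w *m sel).
  have := det_block_left swp (pt3 u v w); rewrite det_swp mul1r => <-.
  by rewrite /pt3 col_mxKu col_mxKd swpE.
have dT u v w : \det (pt3 u (u + v) w *m sel) = \det (pt3 u v w *m sel).
  have := det_block_left tau (pt3 u v w); rewrite det_tau mul1r => <-.
  by rewrite /pt3 col_mxKu col_mxKd tauE.
have p0C u v : phi0 v u = phi0 u v.
  by rewrite /phi0 (addrC v u) (alpC v u) [in LHS](addrC (alp v _)).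
have witE b w : wit (col_mx b w) = phi0 (usubmx (b : 'M_(1 + 1, d)))
     (dsubmx (b : 'M_(1 + 1, d))) * \det (col_mx b w *m sel).
  by rewrite /wit /row_u /row_v col_mxKu.
split=> [b|b w x|b w nb|u v w|u v w].
- have rs (w : 'M[F]_(n, d)) i (x : 'rV_d) : col_mx b (rset w i x) *m sel = rset (col_mx b w *m sel) (rshift 2 i) (x *m sel).
    rewrite -rset_mul; congr (_ *m _); apply/row_matrixP => j; rewrite row_rset.
    case: (split_ordP j) => j' ->.
      by rewrite !rowKu eq_lrshift.
    by rewrite !rowKd row_rset eq_rshift.
  have [dA dE] := det_altform (2 + n).
  split=> [p i x y|p i j ij pij]; rewrite !witE.
    by rewrite !rs mulmxDl dA mulrDr.
  rewrite (dE _ (rshift 2 i) (rshift 2 j)) ?mulr0 ?eq_rshift //.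
  by rewrite !row_mul !rowKd pij.
- by rewrite !witE det_col_sum.
- rewrite witE; apply/eqP; rewrite mulf_eq0 orbC; apply/orP; left.
  apply: contraNT nb => nd.
  have : row_free (col_mx b w *m sel) by rewrite row_free_unit unitmxE unitfE.
  rewrite mul_col_mx => fb.
  rewrite /row_free eqn_leq rank_leq_row /=; apply: leq_trans (mxrankM_maxl b sel).
  have := eqP fb; have := mxrank_adds_leqif (b *m sel) (w *m sel).
  move=> [le _] E; rewrite addsmxE E in le.
  have := leq_trans le (leq_add (leqnn _) (rank_leq_row _)).
  by rewrite leq_add2r.
- by rewrite !wit_pt p0C dS.
- have E (x y : 'rV[F]_d) : x + (x + y) = y by rewrite addrA mx_addxx add0r.
  have E' (x y : 'rV[F]_d) : y + (x + y) = x by rewrite addrCA mx_addxx addr0.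
  have dT' : \det (pt3 v (u + v) w *m sel) = \det (pt3 u v w *m sel).
    by rewrite (dS v u w) -(dT v u w) (addrC v).
  rewrite !wit_pt dT dT' mulrA -mulrDl; congr (_ * _).
  rewrite /phi0 E E' (alpC v u) (alpC (u + v) u) (alpC (u + v) v).
  move: (alp u v) (alp u (u + v)) (alp v (u + v)) => a x y.
  by case: (F2_cases c) => ->; case: (F2_cases a) => ->; case: (F2_cases x) => ->;
    case: (F2_cases y) => ->; exact: val_inj.
Qed.

Lemma killn_mon m (h : 'I_m -> 'I_d) T (l : 'M[F]_(2 + n, d) -> 'rV[F]_d) :
  (forall p q, l (p + q) = l p + l q) -> killn m.+1 T (fun p => mon h (l p)).
Proof.
move=> lD; have := @killn_prod _ d T _ (enum 'I_m) xpredT 1 (fun i p => l p 0 (h i)).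
rewrite muln1 size_enum_ord; apply=> i _; apply: killn_linear => p q.
by rewrite lD mxE.
Qed.

Lemma killn_fixed_mon m (h : 'I_m -> 'I_d) (T : {pred 'cV[F]_(2 + n)}) (l : 'M[F]_(2 + n, d) -> 'rV[F]_d) :
  (forall p q, l (p + q) = l p + l q) -> (forall c e, c \in T -> l (c *m e) = 0) ->
  killn 1 T (fun p => mon h (l p)).
Proof.
by move=> lD lT; apply: killn_fixed => c0 e p cT; rewrite lD lT // addr0.
Qed.

Lemma killn_detsel (T : {pred 'cV[F]_(2 + n)}) : killn (2 + n).+1 T (fun p : 'M[F]_(2 + n, d) => \det (p *m sel)).
Proof. by apply: killn_det => p q; rewrite mulmxDl. Qed.

Definition rows (a : 'I_3) : 'M[F]_(2 + n, d) -> 'rV[F]_d :=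
  if a == 0 then @row_u n d else if a == 1 then @row_v n d else fun p => row_u p + row_v p.
Definition term a b (p : 'M[F]_(2 + n, d)) := fA (rows a p) * gA (rows b p) * \det (p *m sel).

Lemma rowsD a p q : rows a (p + q) = rows a p + rows a q.
Proof.
rewrite /rows; case: ifP => _; first exact: row_uD.
by case: ifP => _; [exact: row_vD|rewrite row_uD row_vD addrACA].
Qed.

Lemma wit_ind (P : ('M[F]_(2 + n, d) -> F) -> Prop) :
  (forall f g, P f -> P g -> P (afun f g)) -> (forall a b, P (term a b)) -> P wit.
Proof.
move=> PD Pt.
have E f : (forall p, wit p = f p) -> P f -> P wit by move=> wf; rewrite (_ : wit = f) //; exact/funext.
have P1 : P (afun (afun (term 0 2) (term 2 0)) (afun (term 1 2) (term 2 1))).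
  by apply: (PD); apply: (PD); apply: (Pt).
case: (F2_cases c) => Ec.
  apply: (E (afun _ (afun (term 0 1) (term 1 0)))) => [p|]; last first.
    by apply: (PD _ _ P1); apply: (PD); apply: (Pt).
  by rewrite /wit /phi0 Ec add0r mul1r /afun /term /rows /= /alp !mulrDl.
apply: E P1 => p.
by rewrite /wit /phi0 Ec F2_addxx mul0r addr0 /afun /term /rows /= /alp !mulrDl.
Qed.

Lemma wit_degree T : killn (N + k + (2 + n)).+1 T wit.
Proof.
apply: wit_ind => [f g|a b]; first exact: (@csD _ (killns _ T)).
apply: killn_mul; last exact: killn_detsel.
by apply: killn_mul; apply: killn_mon; exact: rowsD.
Qed.

Lemma rows_kill (a : 'I_3) : exists2 y, y \in [:: k1; k2; k3] & forall e, rows a (bcol n y *m e) = 0.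
Proof.
have U (x y : 'cV[F]_1) : usubmx (col_mx x y : 'cV_(1 + 1)) = x by exact: col_mxKu.
have D (x y : 'cV[F]_1) : dsubmx (col_mx x y : 'cV_(1 + 1)) = y by exact: col_mxKd.
case: a => [[|[|[|//]]] ia]; rewrite /rows /=.
- by exists k2; rewrite ?inE ?eqxx ?orbT // => e; rewrite row_u_dir U mul0mx.
- by exists k1; rewrite ?inE ?eqxx ?orbT // => e; rewrite row_v_dir D mul0mx.
- exists k3; rewrite ?inE ?eqxx ?orbT // => e.
  by rewrite row_u_dir row_v_dir U D mx_addxx.
Qed.

(** In a term fA l * gA l' * det, with l and l' among u, v and u + v, the factor fA l
    does not change along the column that annihilates l. The other two factors have
    degrees k and n + 2, independent of N. *)
Lemma wit_word : killw (map (bcol n) (word3 (k + (2 + n)).+1)) wit.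
Proof.
apply: wit_ind => [f g|a b]; first exact: killwD.
have [y yk ya] := rows_kill a.
have K : killn (0 + k + (2 + n)).+1 (pred1 (bcol n y)) (term a b).
  apply: killn_mul; last exact: killn_detsel.
  apply: killn_mul; last by apply: killn_mon; exact: rowsD.
  apply: killn_fixed_mon => [|c' e /eqP->]; [exact: rowsD|exact: ya].
have := K (nseq (k + (2 + n)).+1 (bcol n y)); rewrite size_nseq => /(_ erefl) {}K.
rewrite -map_nseq in K; apply: killw_submap (K _) => [x|x]; last by rewrite map_nseq => /nseqP[-> _]; rewrite inE.
rewrite /word3 !count_cat !count_nseq; set m := (k + (2 + n)).+1.
have [<-|nxy] := eqVneq y x; last by rewrite (_ : pred1 x y = false) //; exact: negbTE.
move: yk; rewrite !inE => /or3P[] /eqP Ey; rewrite -Ey eqxx mul1n.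
- exact: leq_addr.
- by rewrite addnCA; exact: leq_addr.
- by rewrite addnA; exact: leq_addl.
Qed.

(** The test point: a frame with columns ks in the first L + 2 coordinates, and the
    remaining n coordinate vectors as parameters. *)
Section Test.
Variable ks : 'I_(L + 2) -> 'cV[F]_2.
Let w0 : 'M[F]_(n, d) := row_mx 0 1%:M.
Let bJ (J : pred 'I_(L + 2)) : 'M[F]_(2, L + 2) := \matrix_(i, j) if J j then ks j i 0 else 0.

Lemma test_point J : (col_mx (0 : 'M_(2, d)) w0) +
    \sum_(j <- enum 'I_(L + 2) | J j) bcol n (ks j) *m delta_mx 0 (lshift n j) =
  col_mx (row_mx (bJ J) 0) w0.
Proof.
have -> : \sum_(j <- enum 'I_(L + 2) | J j) bcol n (ks j) *m delta_mx 0 (lshift n j) =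
    col_mx (row_mx (bJ J) 0) 0 :> 'M[F]_(2 + n, d).
  have -> : row_mx (bJ J) 0 = \sum_(j | J j) ks j *m delta_mx 0 (lshift n j) :> 'M[F]_(2, d).
    apply/matrixP => a b; rewrite summxE; case: (split_ordP b) => b' ->.
      rewrite row_mxEl mxE (bigID (pred1 b')) /= [X in _ + X]big1 ?addr0 => [|j /andP[_ jb]].
        case: ifP => Jb; last by rewrite big1 // => j /andP[Jj /eqP jb]; rewrite jb Jb in Jj.
        rewrite (big_pred1 b') => [|j]; last by rewrite /=; case: eqP => [->|]; rewrite ?Jb ?andbF.
        by rewrite mxE big_ord1 !mxE !eqxx mulr1.
      by rewrite mxE big_ord1 !mxE eq_lshift [b' == j]eq_sym (negbTE jb) andbF mulr0.
    rewrite row_mxEr mxE big1 // => j _.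
    by rewrite mxE big_ord1 !mxE eq_rlshift andbF mulr0.
  rewrite big_enum_cond; elim/big_rec2: _ => [|j x y _ ->]; first by rewrite col_mx0.
  rewrite [bcol _ _ *m _]mul_col_mx mul0mx. by rewrite [LHS]add_col_mx addr0.
by rewrite add_col_mx add0r addr0.
Qed.

Lemma det_test J : \det (col_mx (row_mx (bJ J) 0) w0 *m sel) = \det (rsubmx (bJ J)).
Proof.
have -> : col_mx (row_mx (bJ J) 0) w0 = block_mx (bJ J) 0 0 1%:M by [].
rewrite mulmx_block !mul0mx !mulmx0 !addr0 mulmx1 ?add0r det_lblock det1 mulr1.
by rewrite -[X in X *m _]hsubmxK mul_row_col mulmx0 add0r mulmx1.
Qed.

Lemma rows_test a J j : rows a (col_mx (row_mx (bJ J) 0) w0) 0 (lshift n j) =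
  if J j then \sum_(i < 2) (if (a == i :> nat) || (a == 2) then ks j i 0 else 0) else 0.
Proof.
have U (b : 'M[F]_(2, d)) (w : 'M_(n, d)) : row_u (col_mx b w) = row 0 b.
  rewrite /row_u col_mxKu; apply/rowP => i; rewrite !mxE; congr (b _ _); exact: val_inj.
have V (b : 'M[F]_(2, d)) (w : 'M_(n, d)) : row_v (col_mx b w) = row 1 b.
  rewrite /row_v col_mxKu; apply/rowP => i; rewrite !mxE; congr (b _ _); exact: val_inj.
have W i : (row_mx (bJ J) 0 : 'M_(2, d)) i (lshift n j) = if J j then ks j i 0 else 0.
  by rewrite row_mxEl mxE.
rewrite big_ord_recl big_ord1; case: a => [[|[|[|//]]] ia]; rewrite /rows /=.
- by rewrite U mxE; apply: etrans (W _) _; rewrite addr0.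
- by rewrite V mxE; apply: etrans (W _) _; rewrite add0r; congr (if _ then ks j _ 0 else _); exact: val_inj.
- rewrite mxE U V mxE [X in _ + X]mxE; apply: (etrans (congr2 +%R (W _) (W _))).
  case: ifP => _; last by rewrite addr0.
  by congr (_ + ks j _ 0); exact: val_inj.
Qed.

(** Each column of the frame enters as a factor, either of a monomial or of the
    determinant. *)
Lemma wit_partial J i : ~~ J i -> wit (col_mx (row_mx (bJ J) 0) w0) = 0.
Proof.
move=> nJ; have R0 a : rows a (col_mx (row_mx (bJ J) 0) w0) 0 (lshift n i) = 0.
  by rewrite rows_test (negbTE nJ).
have mon0 m (h : 'I_m -> 'I_d) a i' : h i' = lshift n i -> mon h (rows a (col_mx (row_mx (bJ J) 0) w0)) = 0.
  move=> hi; rewrite /mon big_enum /=; apply/eqP/prodf_eq0; exists i' => //.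
  by rewrite hi R0.
apply: (wit_ind (P := fun f => f _ = 0)) => [f g f0 g0|a b]; first by rewrite /afun f0 g0 addr0.
rewrite /term; case: (split_ordP i) => i' Ei.
  case: (split_ordP i') => j Ej.
    by rewrite /fA (mon0 _ _ _ j) ?mul0r // Ei Ej.
  by rewrite /gA (mon0 _ _ _ j) ?mulr0 ?mul0r // Ei Ej.
rewrite det_test (_ : \det _ = 0) ?mulr0 //.
rewrite -det_tr (expand_det_row _ i') big1 // => j _.
by rewrite !mxE -Ei (negbTE nJ) mul0r.
Qed.

Definition ev3 (a : 'I_3) (y : 'cV[F]_2) : F := \sum_(i < 2) (if (a == i :> nat) || (a == 2) then y i 0 else 0).
Lemma ev3E : (forall a, ev3 a k1 = (a != 1)%:R) * (forall a, ev3 a k2 = (a != 0)%:R) * (forall a, ev3 a k3 = (a != 2)%:R).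
Proof.
have E (x y : 'M[F]_1) a : ev3 a (col_mx x y : 'cV_2) =
    (if (a == 0) || (a == 2) then x 0 0 else 0) + (if (a == 1) || (a == 2) then y 0 0 else 0).
  have -> : x 0 0 = (col_mx x y : 'cV_2) ord0 0.
    by rewrite -(col_mxEu x y) -[LHS]/((col_mx x y : 'cV_2) _ 0); congr (_ _ 0); exact: val_inj.
  have -> : y 0 0 = (col_mx x y : 'cV_2) (lift ord0 ord0) 0.
    by rewrite -(col_mxEd x y) -[LHS]/((col_mx x y : 'cV_2) _ 0); congr (_ _ 0); exact: val_inj.
  by rewrite /ev3 big_ord_recl big_ord1.
split; first split=> a; try (move=> a); rewrite E !mxE; case: a => [[|[|[|//]]] ia] /=; rewrite ?addr0 ?add0r ?F2_addxx //.
Qed.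

(** Only the term fA u * gA (u + v) is nonzero: fA v and fA (u + v) vanish since k1
    and k3 occur in the first block, gA u and gA v since k2 and k1 occur in the
    second one. *)
Lemma wit_full : (exists i : 'I_N, ks (lshift 2 (lshift k i)) = k3) ->
  (exists i : 'I_N, ks (lshift 2 (lshift k i)) = k1) ->
  (forall i : 'I_N, ks (lshift 2 (lshift k i)) \in [:: k1; k3]) ->
  (exists i : 'I_k, ks (lshift 2 (rshift N i)) = k2) ->
  (exists i : 'I_k, ks (lshift 2 (rshift N i)) = k1) ->
  (forall i : 'I_k, ks (lshift 2 (rshift N i)) \in [:: k1; k2]) ->
  ks (rshift L 0) = k1 -> ks (rshift L 1) = k2 ->
  wit (col_mx (row_mx (bJ predT) 0) w0) = 1.
Proof.
move=> [i3 E3] [i1 E1] n2 [j2 F2] [j1 F1] F12 D1 D2.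
have RE a j : rows a (col_mx (row_mx (bJ predT) 0) w0) 0 (lshift n j) = ev3 a (ks j).
  by rewrite rows_test.
have fE a : fA (rows a (col_mx (row_mx (bJ predT) 0) w0)) = (a == 0)%:R.
  rewrite /fA /mon big_enum /=; case: eqP => [->|/eqP a0].
    apply: big1 => i _; rewrite RE; have := n2 i; rewrite !inE => /orP[]/eqP->; by rewrite ev3E.
  apply/eqP/prodf_eq0; case: a a0 => [[|[|[|//]]] ia] // _.
    by exists i1 => //; rewrite RE E1 ev3E.
  by exists i3 => //; rewrite RE E3 ev3E.
have gE a : gA (rows a (col_mx (row_mx (bJ predT) 0) w0)) = (a == 2)%:R.
  rewrite /gA /mon big_enum /=; case: eqP => [->|/eqP a0].
    apply: big1 => i _; rewrite RE; have := F12 i; rewrite !inE => /orP[]/eqP->; by rewrite ev3E.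
  apply/eqP/prodf_eq0; case: a a0 => [[|[|[|//]]] ia] // _.
    by exists j2 => //; rewrite RE F2 ev3E.
  by exists j1 => //; rewrite RE F1 ev3E.
have dE : \det (rsubmx (bJ predT)) = 1.
  have B i j : rsubmx (bJ predT) i j = ks (rshift L j) i 0 by rewrite !mxE.
  have V i : (ks (rshift L 0) i 0 = (i == 0)%:R) /\ (ks (rshift L 1) i 0 = (i == 1)%:R).
    have := (ev3E.1.1 (widen_ord (isT : (2 <= 3)%N) i), ev3E.1.2 (widen_ord (isT : (2 <= 3)%N) i)).
    rewrite /ev3 !big_ord_recl !big_ord0 D1 D2.
    case: i => [[|[|//]] ii] /= [H1 H2]; rewrite ?add0r ?addr0 in H1 H2.
      by rewrite (_ : Ordinal ii = ord0); [split|exact: val_inj].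
    by rewrite (_ : Ordinal ii = lift ord0 ord0); [split|exact: val_inj].
  rewrite (_ : rsubmx _ = 1%:M) ?det1 //; apply/matrixP => i j; rewrite B mxE.
  have [-> | ->] : j = 0 \/ j = 1 by case: j => [[|[|//]] ij]; [left|right]; exact: val_inj.
    exact: (proj1 (V i)).
  exact: (proj2 (V i)).
rewrite /wit det_test dE mulr1 /phi0 /alp.
have := (fE 0, fE 1, fE 2, (gE 0, gE 1, gE 2)); rewrite /rows /= => -[[[f0 f1] f2] [[g0 g1] g2]].
rewrite f0 f1 f2 g0 g1 g2 !mulr0 !mul0r !addr0 mulr1 mulr0; exact: addr0.
Qed.
End Test.
End Witness.

(** The test word contains word3 M and has length at least d0, so its differences kill
    both summands of the join. The columns in excess of word3 M are put among the
    first N coordinates, which do not affect the bound of wit_word. *)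
Lemma witness c n M d0 : exists d (f : 'M[F]_(2 + n, d) -> F),
  [/\ Phi c n d f, killws (map (bcol n) (word3 (M.+2 + (2 + n)).+1)) d f,
     exists i, killns i predT d f &
     ~ csjoin (killws (map (bcol n) (word3 M))) (killns d0 predT) d f].
Proof.
pose N := (M.+1 + (M + d0).+1)%N; pose k := M.+2; pose L := (N + k)%N.
pose ka i := (if i <= M then k3 else if (i <= N) || (i == L) then k1 else k2)%N.
pose ks (i : 'I_(L + 2)) := ka i.
pose W := @wit c n N k.
exists (L + 2 + n)%N, W; split.
- exact: wit_Phi.
- exact: wit_word.
- by eexists; exact: wit_degree.
move=> [z [y [Kz Ky wE]]].
have mapks : map ks (enum 'I_(L + 2)) =
    nseq M.+1 k3 ++ nseq (M + d0).+2 k1 ++ nseq M.+1 k2 ++ [:: k1; k2].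
  rewrite [LHS](map_comp ka val) val_enum_ord.
  have seg a m x : (forall i, a <= i < a + m -> ka i = x)%N -> map ka (iota a m) = nseq m x.
    move=> H; rewrite -[m in RHS](size_iota a) -(size_map ka); apply/all_pred1P/allP => q' /mapP[i].
    by rewrite mem_iota => /H Hi ->; rewrite Hi; exact: eqxx.
  rewrite (_ : L + 2 = M.+1 + ((M + d0).+2 + (M.+1 + 2)))%N; last by rewrite /L /N /k; lia.
  rewrite !iotaD !map_cat; congr (_ ++ (_ ++ (_ ++ _))).
  - by apply: seg => i iM; rewrite /ka ifT //; lia.
  - by apply: seg => i iM; rewrite /ka ifF ?ifT // /N; lia.
  - by apply: seg => i iM; rewrite /ka !ifF // /L /N /k; lia.
  - by rewrite /= /ka; congr [:: _; _]; [rewrite ifF ?ifT|rewrite !ifF] => //; rewrite /L /N /k; lia.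
have cnt x : (count_mem x (word3 M) <= count_mem x (map ks (enum 'I_(L + 2))))%N.
  rewrite mapks !count_cat !count_nseq.
  by case: (pred1 x k1); case: (pred1 x k2); case: (pred1 x k3); lia.
have Kw : killw (map (bcol n) (map ks (enum 'I_(L + 2)))) (W).
  rewrite wE; apply: killwD; first exact: killw_submap Kz.
  have Ky' : killn (L + 2) predT y by apply: killn_ge Ky; rewrite /L /N /k; lia.
  by apply: Ky' => //; rewrite size_map size_map size_enum_ord.
rewrite -map_comp in Kw.
have fl (i : 'I_N) : ks (lshift 2 (lshift k i)) = if (i <= M)%N then k3 else k1.
  by rewrite /ks /ka /=; case: ifP => // _; rewrite ifT // (ltnW (ltn_ord i)).
have gl (i : 'I_k) : ks (lshift 2 (rshift N i)) = if i == 0 :> nat then k1 else k2.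
  have ik := ltn_ord i; rewrite /ks /ka /= ifF; last by rewrite /N; lia.
  by have [i0|i0] := eqVneq (i : nat) 0%N; [rewrite ifT // | rewrite ifF //]; rewrite /L; lia.
have K0 := @killw_top _ _ _ (enum 'I_(L + 2)) (bcol n \o ks)
  (fun j => delta_mx 0 (lshift n j)) W (col_mx 0 (row_mx 0 1%:M)) (enum_uniq _) Kw.
have {}K0 : W (col_mx 0 (row_mx 0 1%:M) +
    \sum_(j <- enum 'I_(L + 2)) bcol n (ks j) *m delta_mx 0 (lshift n j)) = 0.
  by apply: K0 => J i _ nJ; rewrite (@test_point n N k ks J); exact: (@wit_partial c n N k ks J i nJ).
rewrite (@test_point n N k ks predT) in K0.
have N01 : (0 : F) <> 1 by move/eqP.
apply: N01; apply: etrans (esym K0) _; apply: (@wit_full c n N k ks).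
- by exists ord0; rewrite fl.
- have MN : (M.+1 < N)%N by rewrite /N; lia.
  by exists (Ordinal MN); rewrite fl /= ltnn.
- by move=> i; rewrite fl !inE; case: ifP; rewrite eqxx ?orbT.
- by exists (lift ord0 ord0); rewrite gl.
- by exists ord0; rewrite gl.
- by move=> i; rewrite gl !inE; case: ifP; rewrite eqxx ?orbT.
- by rewrite /ks /ka /= ifF ?ifT // /L /N /k; lia.
- by rewrite /ks /ka /= !ifF // /L /N /k; lia.
Qed.

(** The last step of a chain would be an interval [x, Phi] whose proper initial
    intervals have finite length. The ascending sequence
    x + (functions of Phi killed by M' of degree less than i) contradicts this. *)
Theorem Phi_not_art c n : ~ cart 2 (csbot _) (Phi c n).
Proof.
move=> A2; have nP0 : ~ csle (Phi c n) (csbot _).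
  have [d [f [Pf _ _ nf]]] := witness c n 0 0 => P0; apply: nf.
  by rewrite (P0 _ _ Pf); exact: cs0.
have [x [y [Sxy _ yP Py nPx]]] := chain_last (@csle_refl _) (@csle_trans _) (@steps_le _ _ 2) A2 nP0.
have [j j1 [xy _ Pr]] := @steps_smp (cslat (mpt (2 + n))) 1 _ _ Sxy.
have xP := csle_trans xy yP.
have [M xZ] := Phi_proper xP nPx.
pose M' := (M.+2 + (2 + n)).+1.
pose K := killws (map (bcol n) (word3 M')); pose W := csmeet (Phi c n) K.
have xK : csle x (killws (map (bcol n) (word3 M))) by move=> d f /xZ[].
have nxW : ~ csle y (csjoin x W).
  have [d [f [Pf _ _ nf]]] := witness c n (M + M') 0 => /(_ d f (Py d f Pf)) [g [h [xg [_ Kh] fE]]].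
  have cnt m : (m <= M + M')%N -> forall z, (count_mem z (word3 m) <= count_mem z (word3 (M + M')))%N.
    move=> lm z; rewrite !count_cat !count_nseq.
    by rewrite !leq_add // leq_mul.
  apply: nf; exists f, (@zfun _); split; [|exact: cs0|by rewrite afun0].
  rewrite fE; apply: csD.
    by apply: killw_submap (xK _ _ xg) => z; apply: cnt; exact: leq_addr.
  by apply: killw_submap Kh => z; apply: cnt; exact: leq_addl.
have aW : cart 1 x (csjoin x W).
  apply: (@art_weaken _ _ j) => //; apply: Pr => //; split; first exact: csjoinl.
  by apply: csjoinP => // d f [Pf _]; exact: Py.
pose V i := csmeet W (killns i predT).
have [||i0 Hi0] := @art1_acc (cslat (mpt (2 + n))) x (csjoin x W) (fun i => csjoin x (V i)) aW.
- move=> i; split; first exact: csjoinl.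
  apply: csjoinP; first exact: csjoinl.
  by apply: csle_trans (@csjoinr _ x W) => d f [].
- move=> i; apply: csjoinP; first exact: csjoinl.
  apply: csle_trans (@csjoinr _ x (V i.+1)) => d f [Wf Df]; split=> //.
  exact: killn_ge Df.
have [d [f [Pf Kf [i Df] nf]]] := witness c n M i0.
have [] := Hi0 i d f; first by apply: csjoinr.
move=> g [h [xg [_ Dh] fE]]; apply: nf; exists g, h; split=> //.
exact: xK.
Qed.

(** * From subfunctors to functors of functions *)

(** The space F_2^d of rows, as an object of the source category. *)
Definition rowsp (d : nat) : vectType F2 := Vector.clone F2 'rV[F2]_d _.

(** The transpose appears since points are linear forms: they move backwards. *)
Definition hom d d' (g : 'M[F]_(d, d')) : 'Hom(rowsp d', rowsp d) :=
  linfun (mulmxr (g^T : 'M[F2]_(d', d))).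

Lemma homE d d' (g : 'M[F]_(d, d')) (x : rowsp d') : hom g x = (x : 'rV[F2]_d') *m g^T.
Proof. exact: lfunE. Qed.

Lemma homP d d' (h : 'Hom(rowsp d', rowsp d)) : exists g : 'M[F]_(d, d'), h = hom g.
Proof.
exists (lin1_mx h : 'M[F2]_(d', d))^T; apply/lfunP => x.
by rewrite homE trmxK mul_rV_lin1.
Qed.

Lemma coords (V : vectType F2) : exists d (h : 'Hom(V, rowsp d)) (h' : 'Hom(rowsp d, V)),
  (h' \o h = \1)%VF.
Proof.
pose b := vbasis (fullv : {vspace V}).
have l1 : linear (fun x : V => (\row_i coord b i x : 'rV[F2]_(\dim (fullv : {vspace V}))) : rowsp _).
  by move=> a x y; apply/rowP => i; rewrite !mxE linearP.
have l2 : linear (fun x : rowsp (\dim (fullv : {vspace V})) => \sum_i (x : 'rV[F2]__) 0 i *: b`_i : V).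
  move=> a x y; rewrite scaler_sumr -big_split; apply: eq_bigr => i _ /=.
  by rewrite !mxE scalerDl scalerA.
exists (\dim (fullv : {vspace V})), (linfun (mklin l1)), (linfun (mklin l2)).
apply/lfunP => x; rewrite comp_lfunE id_lfunE; apply: (etrans (lfunE _ _)).
apply: (etrans (congr1 _ (lfunE _ _))); rewrite /= [RHS](coord_vbasis (memvf x)).
by apply: eq_bigr => i _; rewrite mxE.
Qed.

Lemma F2_scale (M : lmodType F2) (a : F2) (x : M) : a *: x = 0 \/ a *: x = x.
Proof. by case: (F2_cases a) => ->; [left; exact: scale0r|right; exact: scale1r]. Qed.

Section Bridge.
Variables (G : Defs.functor F2) (N : nat) (Ph : csub (mpt N)).
Variable ev : forall d, G (rowsp d) -> 'M[F]_(N, d) -> F.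
Hypothesis evD : forall d (x y : G (rowsp d)), ev (x + y) = afun (ev x) (ev y).
Hypothesis ev_inj : forall d (x : G (rowsp d)), ev x = @zfun _ -> x = 0.
Hypothesis ev_nat : forall d d' (g : 'M[F]_(d, d')) (x : G (rowsp d')),
  ev (fmap G (hom g) x) = ev x \o mulmx^~ g.
Hypothesis ev_range : forall d f, Ph d f <-> exists x, f = @ev d x.

Lemma ev0 d : @ev d 0 = @zfun _.
Proof. by rewrite -[X in ev X](addr0 0) evD afunxx. Qed.

Lemma ev_injective d (x y : G (rowsp d)) : ev x = ev y -> x = y.
Proof.
move=> E; apply: F2_addr_eq0; apply: ev_inj.
by rewrite evD E afunxx.
Qed.

(** The functions obtained from the elements of U. *)
Definition values (U : subfunctor G) : csub (mpt N).
refine (@CSub (mpt N) (fun d f => exists2 x, x \in U (rowsp d) & f = ev x) _ _ _).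
- by move=> d; exists 0; [exact: rpred0|rewrite ev0].
- by move=> d _ _ [x Ux ->] [y Uy ->]; exists (x + y); [exact: rpredD|rewrite evD].
- move=> d d' g _ [x Ux ->]; exists (fmap G (hom g) x); first exact: subf_map.
  by rewrite ev_nat.
Defined.

(** The elements whose images in all coordinate spaces have their function in C. *)
Definition from_pred (C : csub (mpt N)) (V : vectType F2) : {pred G V} :=
  fun x => `[< forall d (h : 'Hom(V, rowsp d)), C d (ev (fmap G h x)) >].
Arguments from_pred C V _ : clear implicits.
Lemma from_pred_submod (C : csub (mpt N)) V : submod_closed (from_pred C V).
Proof.
split; first by apply/asboolP => d h; rewrite linear0 ev0; exact: cs0.
move=> a x y /asboolP Cx /asboolP Cy; apply/asboolP => d h.
rewrite linearP evD; apply: csD => //.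
by case: (F2_scale a (fmap G h x)) => ->; rewrite ?ev0; [exact: cs0|exact: Cx].
Qed.
HB.instance Definition _ C V :=
  GRing.isSubmodClosed.Build F2 (G V) (from_pred C V) (from_pred_submod C V).
Lemma from_pred_map (C : csub (mpt N)) (V W : vectType F2) (f : 'Hom(V, W)) x :
  x \in from_pred C V -> fmap G f x \in from_pred C W.
Proof.
move=> /asboolP Cx; apply/asboolP => d h.
by rewrite -fmap_comp; exact: Cx.
Qed.
Definition from_values (C : csub (mpt N)) : subfunctor G :=
  @SubFunctor F2 G (fun V => from_pred C V : submodClosed _) (@from_pred_map C).

Lemma bridge_iso : order_iso (@subf_le F2 G) (@csle (mpt N)) values from_values
  (sbot G) (stop G) (csbot _) Ph.
Proof.
split.
- by move=> U W _ _ UW d _ [x Ux ->]; exists x => //; exact: UW.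
- move=> C C' _ _ CC' V x /asboolP Cx; apply/asboolP => d h; apply: CC'; exact: Cx.
- move=> U _; split; first exact: csbot_le.
  by move=> d _ [x _ ->]; apply/ev_range; exists x.
- by move=> C _; split; [exact: sbot_le|exact: stop_ge].
- move=> U _; split=> V x.
    move=> /asboolP H; have [d [h [h' hh]]] := coords V.
    have [y Uy /ev_injective E] := H d h.
    have := subf_map h' Uy; rewrite -E -fmap_comp hh.
    by rewrite fmap_id.
  by move=> Ux; apply/asboolP => d h; exists (fmap G h x) => //; exact: subf_map.
- move=> C [_ CP]; split=> d f.
    by move=> [x /asboolP /(_ d \1%VF) H ->]; rewrite fmap_id in H.
  move=> Cf; have /ev_range[x fx] := CP _ _ Cf; exists x => //.
  apply/asboolP => d' h; have [g ->] := homP h.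
  rewrite ev_nat -fx; exact: (@csM _ C).
Qed.

Lemma art_bridge m (U : subfunctor G) :
  art (@subf_le F2 G) m (sbot G) U <-> cart m (csbot _) (values U).
Proof.
have bb : btw (@subf_le F2 G) (sbot G) (stop G) (sbot G) by split; [exact: sle_refl|exact: stop_ge].
have bU : btw (@subf_le F2 G) (sbot G) (stop G) U by split; [exact: sbot_le|exact: stop_ge].
have [vb vU] := (iso_fb bridge_iso bb, iso_fb bridge_iso bU).
have I := iso_sub (@sle_trans _ G) (@csle_trans (mpt N)) bridge_iso bb bU vb vU
  (@csle_refl _ _) (@csle_refl _ _) (@csle_refl _ _) (@csle_refl _ _).
have Eb : csle (values (sbot G)) (csbot _).
  by move=> d f [x]; rewrite mem_sbot => /eqP -> ->; rewrite ev0.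
split=> a.
  apply: (art_eql (@csle_refl _) (@csle_trans _) Eb (@csbot_le _ _) (@csle_refl _ _) (@csle_refl _ _)).
  apply: (art_iso (@sle_refl _ _) (@sle_trans _ _) (@csle_refl _) (@csle_trans _) I _ a).
  by apply: (iso_f bridge_iso) => //; exact: sbot_le.
apply: (art_iso (@csle_refl _) (@csle_trans _) (@sle_refl _ _) (@sle_trans _ _) (iso_sym I) (@sbot_le _ _ _)).
exact: (art_eql (@csle_refl _) (@csle_trans _) (@csbot_le _ _) Eb (@csle_refl _ _) (@csle_refl _ _) a).
Qed.
End Bridge.

(** It suffices to identify the functor with Phi c n on coordinate spaces. *)
Theorem simple_of_Phi (G : Defs.functor F2) (c : F) n
    (ev : forall d, G (rowsp d) -> 'M[F]_(2 + n, d) -> F) :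
  (forall d (x y : G (rowsp d)), ev d (x + y) = afun (ev d x) (ev d y)) ->
  (forall d (x : G (rowsp d)), ev d x = @zfun _ -> x = 0) ->
  (forall d d' (g : 'M[F]_(d, d')) (x : G (rowsp d')),
    ev d (fmap G (hom g) x) = ev d' x \o mulmx^~ g) ->
  (forall d f, Phi c n d f <-> exists x, f = ev d x) ->
  simple_artinian 2 G.
Proof.
move=> evD evI evN evR; apply/simple_artinianP.
have A U := art_bridge evD evI evN evR 2 U.
have Pv : csle (Phi c n) (values evD evN (stop G)).
  by move=> d f /evR[x ->]; exists x => //; exact: mem_stop.
have vP U : csle (values evD evN U) (Phi c n).
  by move=> d _ [x _ ->]; apply/evR; exists x.
split=> [/A a|U nU].
  apply: (@Phi_not_art c n).
  exact: (art_eql (@csle_refl _) (@csle_trans _) (@csle_refl _ _) (@csle_refl _ _) (vP _) Pv a).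
apply/A; have [|M UZ] := @Phi_proper c n _ (vP U).
  move=> PU; apply: nU => V x.
  have [d [h [h' hh]]] := coords V.
  have [|y Uy E] := PU d (ev d (fmap G h x)); first by apply/evR; exists (fmap G h x).
  have := subf_map h' Uy; rewrite -(ev_injective evD evI E) -fmap_comp hh.
  by rewrite fmap_id.
apply: (cart_sub (@csle_refl _ _) (@csbot_le _ _) UZ); apply: cart_Z => y; exact: word3_neq0.
Qed.

Local Notation "[ v ]p" := (@Pbar_gen F2 _ v) (format "[ v ]p").
Local Notation W d := (vdual (rowsp d)).

(** * Points as tuples of linear forms *)

Section Forms.
Variable d : nat.

Lemma form_linear (e : 'rV[F]_d) : linear (fun x : rowsp d => ((x : 'rV[F2]_d) *m e^T) 0 0 : F2^o).
Proof. by move=> a x y; rewrite mulmxDl -scalemxAl !mxE. Qed.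
(** The linear form with coordinates e. *)
Definition form (e : 'rV[F]_d) : W d := linfun (mklin (form_linear e)).
Lemma formE e (x : rowsp d) : form e x = ((x : 'rV[F2]_d) *m e^T) 0 0.
Proof. exact: lfunE. Qed.

Definition unform (p : W d) : 'rV[F2]_d := \row_k p (delta_mx 0 k : 'rV[F2]_d).
Lemma formK e : unform (form e) = e.
Proof. by apply/rowP => k; rewrite mxE formE -rowE !mxE. Qed.
Lemma unformK p : form (unform p) = p.
Proof.
apply/lfunP => x; rewrite formE mxE [in RHS](row_sum_delta x) linear_sum.
by apply: eq_bigr => k _; rewrite linearZ !mxE.
Qed.
Lemma unform_linear : linear unform.
Proof. by move=> a p q; apply/rowP => k; rewrite !mxE !lfunE /= lfunE. Qed.
Lemma formD e e' : form (e + e') = form e + form e'.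
Proof. by rewrite -[RHS]unformK; congr form; have := unform_linear 1 (form e) (form e'); rewrite !scale1r !formK => ->. Qed.
Lemma form0 : form 0 = 0.
Proof. by apply: (@addIr _ (form 0)); rewrite -formD addr0 add0r. Qed.
End Forms.

Lemma form_hom d d' (g : 'M[F]_(d, d')) e : vtransp (hom g) (form e) = form (e *m g).
Proof.
apply/lfunP => x; rewrite vtranspE comp_lfunE !formE homE.
by rewrite trmx_mul mulmxA.
Qed.

Lemma row_dependent d (u v : 'rV[F]_d) : ~~ row_free (col_mx u v : 'M_(1 + 1, d)) ->
  [\/ u = 0, v = 0 | u = v].
Proof.
rewrite -kermx_eq0 => /rowV0Pn[r /sub_kermxP].
rewrite -[r]hsubmxK mul_row_col.
case: (M1_cases (lsubmx r)) => ->; case: (M1_cases (rsubmx r)) => ->;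
  rewrite ?mul0mx ?mul1mx ?add0r ?addr0.
- by rewrite row_mx0 eqxx.
- by constructor 2.
- by constructor 1.
- by move=> uv _; constructor 3; rewrite -[u](mx_addK _ v) uv add0r.
Qed.

(** On functionals for which Pi acts by c, the formula
    Pi([u] /\ [v]) = [u] /\ [u + v] + [v] /\ [u + v] becomes the relation of Phi.
    The argument y stands for the remaining data, which depend on the plane only. *)
Lemma Phi_intro (c : F2) n d (Y : Type) (B : Y -> {linear LP2 (W d) -> F2^o})
    (y : 'rV[F]_d -> 'rV[F]_d -> 'M[F]_(n, d) -> Y) (f : 'M[F]_(2 + n, d) -> F) :
  (forall z a, B z (Pi_app _ a) = c *: B z a) ->
  (forall u v w, f (pt3 u v w) = B (y u v w) (wedge2 [form u]p [form v]p)) ->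
  (forall b : 'M_(2, d), Altc n d (fun w => f (col_mx b w))) ->
  (forall u v w (x : 'M_(n, 2)), y u v (w + x *m (col_mx u v : 'M_(1 + 1, d))) = y u v w) ->
  (forall u v w, y v u w = y u v w) -> (forall u v w, y u (u + v) w = y u v w) ->
  in_Phi c f.
Proof.
move=> BPi fE fA yI yS yT.
have bE (b : 'M[F]_(2, d)) : exists u v : 'rV_d, b = (col_mx u v : 'M_(1 + 1, d)).
  by exists (usubmx (b : 'M_(1 + 1, d))), (dsubmx (b : 'M_(1 + 1, d))); rewrite vsubmxK.
split=> // [b w x|b w nb|u v w|u v w].
- by have [u [v ->]] := bE b; rewrite -!/(pt3 _ _ _) !fE yI.
- have [u [v Eb]] := bE b; rewrite Eb in nb *; rewrite -/(pt3 _ _ _) fE.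
  have [->|->|->] := row_dependent nb.
  + by rewrite form0 Pbar_gen0 wedge20x linear0.
  + by rewrite form0 Pbar_gen0 wedge2x0 linear0.
  + by rewrite wedge2xx linear0.
- by rewrite !fE yS wedge2C.
- have yT' : y v (u + v) w = y u v w by rewrite addrC yT yS.
  rewrite !fE yT yT' -linearD formD -[c * _]BPi Pi_appE wedge2Dl.
  by [].
Qed.

(** * Evaluation at points *)

Section Evaluation.
(** E is a direct factor of the exterior square of Pbar on which Pi acts by c. *)
Variables (E : functor F2) (proj : ntrans LP2 E) (incl : ntrans E LP2) (c : F2).
Hypothesis inclK : forall V e, proj V (incl V e) = e.
Hypothesis proj_Pi : forall V a, proj V (Pi_app V a) = c *: proj V a.
Hypothesis incl_proj : forall V (N : lmodType F2) (h : {linear LP2 V -> N}),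
  (forall a, h (Pi_app V a) = c *: h a) -> forall a, h (incl V (proj V a)) = h a.

Section Degree0.
Definition eval0 d (f : dualF E (rowsp d)) (p : 'M[F]_(2 + 0, d)) : F :=
  dual_app f (proj _ (wedge2 [form (row_u p)]p [form (row_v p)]p)).

Lemma eval0_D d (x y : dualF E (rowsp d)) : eval0 (x + y) = afun (eval0 x) (eval0 y).
Proof. by apply/funext => p. Qed.

Lemma eval0_inj d (x : dualF E (rowsp d)) : eval0 x = @zfun _ -> x = 0.
Proof.
move=> x0; apply: dualP => e; rewrite -[e]inclK.
refine (Pbar_ext2 (f := dual_app x \o proj _) (g := \0) _ (incl _ e)) => u v /=.
have := congr1 (fun h => h (pt3 (unform u) (unform v) 0)) x0.
by rewrite /eval0 row_u_pt row_v_pt !unformK.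
Qed.

Lemma eval0_nat d d' (g : 'M[F]_(d, d')) (x : dualF E (rowsp d')) :
  eval0 (fmap (dualF E) (hom g) x) = eval0 x \o mulmx^~ g.
Proof.
apply/funext => p; rewrite -[RHS]/(eval0 x (p *m g)) (pt3P p) pt3_mul /eval0 !row_u_pt !row_v_pt.
rewrite [LHS]dual_mapE -ntrans_nat LP2_mapE !form_hom.
by [].
Qed.

Lemma alt0_all d (h : 'M[F]_(0, d) -> F) : Altc 0 d h.
Proof. by split=> [p []|p []]. Qed.

Lemma eval0_range d f : Phi c 0 d f <-> exists x : dualF E (rowsp d), f = eval0 x.
Proof.
split=> [Pf|[x ->]]; last first.
  apply: (@Phi_intro c 0 d unit (fun=> dual_app x \o proj (W d)) (fun _ _ _ => tt)).
  - by move=> _ a; rewrite /= proj_Pi linearZ.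
  - by move=> u v w; rewrite /eval0 row_u_pt row_v_pt.
  - by move=> b; exact: alt0_all.
  - by [].
  - by [].
  - by [].
pose chi (u v : W d) : F2^o := f (pt3 (unform u) (unform v) 0).
have un0 : unform (0 : W d) = 0 by exact: (linear0 (mklin (@unform_linear d))).
have unD (u v : W d) : unform (u + v) = unform u + unform v by exact: (linearD (mklin (@unform_linear d))).
have chi0 v : chi 0 v = 0 by rewrite /chi un0 (Phi0l Pf).
have chiC u v : chi u v = chi v u by rewrite /chi (PhiS Pf).
have chixx u : chi u u = 0 by rewrite /chi (Phixx Pf).
pose h := alt_lift chi0 chiC chixx.
have hPi a : h (Pi_app _ a) = c *: h a.
  refine (Pbar_ext2 (f := h \o Pi_app _) (g := c \*: h) _ a) => u v /=.
  rewrite Pi_appE wedge2Dl linearD !alt_liftE /chi unD.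
  exact: (esym (PhiR Pf _ _ _)).
exists (mkdual (h \o incl (W d))); apply/funext => p.
rewrite (pt3P p) /eval0 row_u_pt row_v_pt (flatmx0 (dsubmx p)).
rewrite [RHS](incl_proj hPi) alt_liftE /chi !formK.
by [].
Qed.

Lemma simple0 : simple_artinian 2 (dualF E).
Proof. exact: (simple_of_Phi eval0_D eval0_inj eval0_nat eval0_range). Qed.
End Degree0.

Section DegreeN.
Variable n : nat.

Definition gE : ntrans (tensF E (Lam n)) (tensF E (LamLam3 n)) :=
  ntrans_comp (tensF_ntrans proj (ntrans_id (LamLam3 n)))
    (ntrans_comp (g n) (tensF_ntrans incl (ntrans_id (Lam n)))).

(** Since g commutes with Pi, it is compatible with the projection to E. *)
Lemma gE_proj V a x : gE V (tens (proj V a) x) =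
  tensF_ntrans proj (ntrans_id (LamLam3 n)) V (g n V (tens a x)).
Proof.
pose h : {linear LP2 V -> tensF E (LamLam3 n) V} :=
  tensF_ntrans proj (ntrans_id (LamLam3 n)) V \o g n V \o mklin (tens_linl x).
have hPi b : h (Pi_app V b) = c *: h b.
  pose pr := tensF_ntrans proj (ntrans_id (LamLam3 n)) V.
  rewrite -[h b]/(pr (g n V (tens b x))) -[h _]/(pr (g n V (tens (Pi_app V b) x))).
  have -> : tens (Pi_app V b) x = tensF_ntrans Pi (ntrans_id (Lam n)) V (tens b x).
    by rewrite [RHS]tensor_mapE.
  rewrite g_Pi {}/pr; move: (g n V (tens b x)) => z.
  refine (tensor_ext (f := tensF_ntrans proj (ntrans_id (LamLam3 n)) V \o
     tensF_ntrans Pi (ntrans_id (LamLam3 n)) V)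
     (g := c \*: tensF_ntrans proj (ntrans_id (LamLam3 n)) V) _ z) => {}z t.
  rewrite [LHS](congr1 (tensF_ntrans proj (ntrans_id (LamLam3 n)) V) (tensor_mapE _ _ z t)).
  rewrite [LHS]tensor_mapE [RHS](congr1 ( *:%R c) (tensor_mapE _ _ z t)) [X in tens X _]proj_Pi.
  exact: (linearZ_LR (mklin (tens_linl t)) c (proj V z)).
rewrite -[RHS]/(h a) -(incl_proj hPi a).
rewrite -[h _]/(tensF_ntrans proj (ntrans_id (LamLam3 n)) V (g n V (tens (incl V (proj V a)) x))).
rewrite -[LHS]/(tensF_ntrans proj (ntrans_id (LamLam3 n)) V (g n V (tensF_ntrans incl (ntrans_id (Lam n)) V _))).
by rewrite [tensF_ntrans incl _ _ _]tensor_mapE.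
Qed.

Definition rforms d (w : 'M[F]_(n, d)) : n.-tuple (idF F2 (W d)) := [tuple form (row i w) | i < n].

Definition evaln d (f : dualF (tensF E (Lam n)) (rowsp d)) (p : 'M[F]_(2 + n, d)) : F :=
  dual_app f (tens (proj _ (wedge2 [form (row_u p)]p [form (row_v p)]p))
                   (wedge (rforms (dsubmx p)) : Lam n (W d))).

Lemma evaln_pt d (f : dualF (tensF E (Lam n)) (rowsp d)) u v w : evaln f (pt3 u v w) =
  dual_app f (tens (proj _ (wedge2 [form u]p [form v]p)) (wedge (rforms w) : Lam n (W d))).
Proof. by rewrite /evaln row_u_pt row_v_pt /pt3 col_mxKd. Qed.

Lemma evaln_D d (x y : dualF (tensF E (Lam n)) (rowsp d)) : evaln (x + y) = afun (evaln x) (evaln y).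
Proof. by apply/funext => p. Qed.

Lemma rforms_onto d (t : n.-tuple (W d)) : rforms (\matrix_(i < n) unform (tnth t i)) = t.
Proof. by apply: eq_from_tnth => i; rewrite tnth_mktuple rowK unformK. Qed.

Lemma evaln_inj d (x : dualF (tensF E (Lam n)) (rowsp d)) : evaln x = @zfun _ -> x = 0.
Proof.
move=> x0; apply: dualP => z.
refine (tensor_ext (f := dual_app x) (g := \0) _ z) => {z} e y; rewrite -[e]inclK.
rewrite -[tens _ y](tensor_mapE (proj (W d)) idfun).
refine (g_ext (f := dual_app x \o tensor_map (proj (W d)) idfun) (h := \0) _ _) => u v t.
rewrite [LHS](congr1 (dual_app x) (tensor_mapE _ _ _ _)).
have := congr1 (fun h => h (pt3 (unform u) (unform v) (\matrix_(i < n) unform (tnth t i)))) x0.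
by rewrite evaln_pt !unformK rforms_onto.
Qed.

Lemma evaln_nat d d' (g : 'M[F]_(d, d')) (x : dualF (tensF E (Lam n)) (rowsp d')) :
  evaln (fmap (dualF (tensF E (Lam n))) (hom g) x) = evaln x \o mulmx^~ g.
Proof.
apply/funext => p; rewrite -[RHS]/(evaln x (p *m g)) (pt3P p) pt3_mul !evaln_pt.
rewrite [LHS]dual_mapE [fmap _ _ _]tensor_mapE -ntrans_nat LP2_mapE !form_hom Lam_mapE.
congr (dual_app x (tens _ (wedge _))); apply: eq_from_tnth => i.
by rewrite tnth_map !tnth_mktuple row_mul -form_hom.
Qed.
End DegreeN.
End Evaluation.

(** * Contraction along a plane *)

Section ScaleSlots.
Variables (R : comNzRingType) (M : lmodType R).
Implicit Types (a A B C D P : R) (x y z X Y : M).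

Lemma addr3ACA x y z x' y' z' :
  (x + x') + (y + y') + (z + z') = (x + y + z) + (x' + y' + z').
Proof. by rewrite (addrACA x) (addrACA (x + y)). Qed.

Lemma scale_slot1 a A C D P Q x y X Y :
  A *: (a *: X + Y) + (a * C + D) *: x + (a * P + Q) *: y =
  a *: (A *: X + C *: x + P *: y) + (A *: Y + D *: x + Q *: y).
Proof. by rewrite !scalerDr !scalerDl !scalerA (mulrC A) addr3ACA. Qed.
Lemma scale_slot2 a A B C P Q x y X Y :
  (a * A + B) *: x + C *: (a *: X + Y) + (a * P + Q) *: y =
  a *: (A *: x + C *: X + P *: y) + (B *: x + C *: Y + Q *: y).
Proof. by rewrite !scalerDr !scalerDl !scalerA (mulrC C) addr3ACA. Qed.
Lemma scale_slot3 a A B C D P x y X Y :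
  (a * A + B) *: x + (a * C + D) *: y + P *: (a *: X + Y) =
  a *: (A *: x + C *: y + P *: X) + (B *: x + D *: y + P *: Y).
Proof. by rewrite !scalerDr !scalerDl !scalerA (mulrC P) addr3ACA. Qed.
End ScaleSlots.

Section Contraction.
Variables (d : nat) (S : 'M[F2]_(d, 2)).
Implicit Types x y z : 'rV[F2]_d.

(** The 2-form given by the two coordinates of S. *)
Definition area x y : F2 := (x *m S) 0 0 * (y *m S) 0 1 + (x *m S) 0 1 * (y *m S) 0 0.

Lemma areaxx x : area x x = 0.
Proof. by rewrite /area mulrC; exact: F2_addxx. Qed.
Lemma areaC x y : area x y = area y x.
Proof. by rewrite /area addrC mulrC [X in _ + X]mulrC. Qed.
Lemma areaPl a x x' y : area (a *: x + x') y = a * area x y + area x' y.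
Proof. by rewrite /area mulmxDl -scalemxAl !mxE; ring. Qed.
Lemma areaPr a x y y' : area x (a *: y + y') = a * area x y + area x y'.
Proof. by rewrite areaC areaPl !(areaC x). Qed.
Lemma areaxD x y : area x (x + y) = area x y.
Proof. by rewrite -[x in x + y]scale1r areaPr areaxx mulr0 add0r. Qed.

(** The contraction of x /\ y /\ z with area. If area u v = 1, it sends u /\ v /\ w to
    w modulo u and v. *)
Definition contr x y z : 'rV[F2]_d := area x y *: z + area y z *: x + area x z *: y.

Definition contr_fun (t : 3.-tuple (W d)) : 'rV[F2]_d :=
  contr (unform (tnth t ord0)) (unform (tnth t (lift ord0 ord0))) (unform (tnth t ord_max)).

Lemma contr_multilinear : multilinear contr_fun.
Proof.
move=> t i a x y; rewrite /contr_fun !tnth_tset.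
by elim/ord3P: i => /=; rewrite unform_linear /contr ?areaPl ?areaPr;
  [exact: scale_slot2|exact: scale_slot3|exact: scale_slot1].
Qed.

Lemma contr_alternating : alternating contr_fun.
Proof.
move=> t i j ij tij; rewrite /contr_fun.
have xx x : x + x = 0 :> 'rV[F2]_d by exact: mx_addxx.
have c12 x z : contr x x z = 0 by rewrite /contr areaxx scale0r add0r xx.
have c23 x y : contr x y y = 0 by rewrite /contr areaxx scale0r addr0 xx.
have c13 x y : contr x y x = 0 by rewrite /contr areaxx scale0r addr0 (areaC y) xx.
by move: ij tij; elim/ord3P: i; elim/ord3P: j => //= _ ->.
Qed.

Definition contraction : {linear Lam 3 (W d) -> 'rV[F2]_d} := ext_lift contr_multilinear contr_alternating.

Lemma contractionE (x y z : W d) :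
  contraction (wedge3 x y z) = contr (unform x) (unform y) (unform z).
Proof. by rewrite [LHS]ext_liftE /contr_fun !(tnth_nth 0). Qed.
End Contraction.

(** The choice has to depend on the plane of u and v only, not on the frame, so that
    the relation between frames survives. *)
Definition section_of d (u v : 'rV[F2]_d) : 'M[F2]_(d, 2) := odflt 0 [pick S | area S u v == 1].

Lemma section_ofC d (u v : 'rV[F2]_d) : section_of v u = section_of u v.
Proof. by congr odflt; apply: eq_pick => S; rewrite areaC. Qed.
Lemma section_ofD d (u v : 'rV[F2]_d) : section_of u (u + v) = section_of u v.
Proof. by congr odflt; apply: eq_pick => S; rewrite areaxD. Qed.
Lemma section_ofDr d (u v : 'rV[F2]_d) : section_of v (u + v) = section_of u v.
Proof. by rewrite addrC section_ofD section_ofC. Qed.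
Lemma area_section d (u v : 'rV[F2]_d) : row_free (col_mx u v : 'M_(1 + 1, d)) ->
  area (section_of u v) u v = 1.
Proof.
move=> /row_freeP[S uvS]; rewrite /section_of; case: pickP => [S' /eqP //|].
move/(_ S)/eqP; case; move: uvS; rewrite mul_col_mx => uvS.
have U j : (u *m S) 0 j = (j == 0)%:R.
  have := congr1 (fun A : 'M_(1 + 1, 2) => A (lshift 1 0) j) uvS.
  by rewrite col_mxEu => ->; rewrite mxE eq_sym.
have V j : (v *m S) 0 j = (j == 1)%:R.
  have := congr1 (fun A : 'M_(1 + 1, 2) => A (rshift 1 0) j) uvS.
  rewrite col_mxEd => ->; rewrite mxE eq_sym; congr ((j == _)%:R); exact: val_inj.
by rewrite /area !U !V /= mul0r addr0 mulr1.
Qed.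

Section Extension.
Variables (c : F2) (n d : nat) (f : 'M[F]_(2 + n, d) -> F).
Hypothesis Pf : Phi c n d f.

Let mx S (t : n.-tuple (Lam 3 (W d))) : 'M[F]_(n, d) := \matrix_(i < n) contraction S (tnth t i).

Lemma mx_tset S t i x : mx S (tset t i x) = rset (mx S t) i (contraction S x).
Proof.
apply/row_matrixP => j; rewrite rowK row_rset tnth_tset.
by case: eqP => // _; rewrite rowK.
Qed.

Definition chi_fun S (u v : 'rV[F2]_d) (t : n.-tuple (Lam 3 (W d))) : F2^o := f (pt3 u v (mx S t)).

Lemma chi_multilinear S u v : multilinear (chi_fun S u v).
Proof.
move=> t i a x y; have alt := PhiA Pf (col_mx u v : 'M_(1 + 1, d)).
have E z : chi_fun S u v (tset t i z) =
    (fun w => f (col_mx (col_mx u v : 'M_(1 + 1, d)) w)) (rset (mx S t) i (contraction S z)).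
  by rewrite /chi_fun mx_tset.
rewrite !E linearP; case: (F2_cases a) => ->.
  by rewrite [0 *: _]scale0r [0 *: _]scale0r !add0r.
rewrite [1 *: contraction S x]scale1r [1 *: _]scale1r; exact: (proj1 alt).
Qed.

Lemma chi_alternating S u v : alternating (chi_fun S u v).
Proof.
move=> t i j ij tij; have alt := PhiA Pf (col_mx u v : 'M_(1 + 1, d)).
apply: (proj2 alt _ _ _ ij); rewrite !rowK.
by rewrite tij.
Qed.

(** The functional y_1 /\ ... /\ y_n |-> f(u, v; contractions of the y_i). *)
Definition chi (u v : W d) : dual (LamLam3 n (W d)) :=
  mkdual (ext_lift (@chi_multilinear (section_of (unform u) (unform v)) (unform u) (unform v))
                   (@chi_alternating (section_of (unform u) (unform v)) (unform u) (unform v))).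

Lemma chiE u v t : dual_app (chi u v) (wedge t : LamLam3 n (W d)) =
  f (pt3 (unform u) (unform v) (mx (section_of (unform u) (unform v)) t)).
Proof. exact: ext_liftE. Qed.

Lemma dual_ext (x y : dual (LamLam3 n (W d))) :
  (forall t, dual_app x (wedge t : LamLam3 n (W d)) = dual_app y (wedge t : LamLam3 n (W d))) -> x = y.
Proof. by move=> xy; apply: dualP; exact: ext_ext. Qed.

Lemma unform0 : unform (0 : W d) = 0.
Proof. exact: (linear0 (mklin (@unform_linear d))). Qed.
Lemma unformD (u v : W d) : unform (u + v) = unform u + unform v.
Proof. exact: (linearD (mklin (@unform_linear d))). Qed.

Lemma chi0 v : chi 0 v = 0.
Proof. by apply: dual_ext => t; rewrite [LHS]chiE unform0 (Phi0l Pf). Qed.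
Lemma chiC u v : chi u v = chi v u.
Proof. by apply: dual_ext => t; rewrite [LHS]chiE [RHS]chiE section_ofC (PhiS Pf). Qed.
Lemma chixx u : chi u u = 0.
Proof. by apply: dual_ext => t; rewrite [LHS]chiE (Phixx Pf). Qed.
Lemma chi_rel u v : chi u (u + v) + chi v (u + v) = c *: chi u v.
Proof.
apply: dual_ext => t; have R := PhiR Pf (unform u) (unform v) (mx (section_of (unform u) (unform v)) t).
apply: esym; apply: (etrans (congr1 ( *%R c) (chiE u v t))); rewrite R.
apply: esym; apply: (etrans (congr2 +%R (chiE u (u + v) t) (chiE v (u + v) t))).
by rewrite unformD section_ofD section_ofDr.
Qed.

Definition extension : {linear LP2 (W d) -> dual (LamLam3 n (W d))} := alt_lift chi0 chiC chixx.

Lemma extensionE u v : extension (wedge2 [u]p [v]p) = chi u v.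
Proof. exact: alt_liftE. Qed.

Lemma extension_Pi a : extension (Pi_app _ a) = c *: extension a.
Proof.
refine (Pbar_ext2 (f := extension \o Pi_app _) (g := c \*: extension) _ a) => u v.
rewrite [RHS](congr1 ( *:%R c) (extensionE u v)) -chi_rel.
rewrite [LHS](congr1 extension (Pi_appE u v)) wedge2Dl linearD.
by rewrite !extensionE.
Qed.

(** The contraction of u /\ v /\ w is w modulo u and v, and f does not see the
    difference. *)
Lemma chi_wedge3 u v (w : 'M[F]_(n, d)) :
  dual_app (chi (form u) (form v))
    (wedge (map_tuple (fun a => wedge3 (form u) (form v) a) (rforms w)) : LamLam3 n (W d)) =
  f (pt3 u v w).
Proof.
rewrite chiE !formK; have [fr|nf] := boolP (row_free (col_mx u v : 'M_(1 + 1, d))); last first.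
  by rewrite /pt3 !(PhiFree Pf).
set S := section_of u v; have a1 : area S u v = 1 := area_section fr.
pose x : 'M[F]_(n, 1 + 1) := row_mx (\col_i area S v (row i w)) (\col_i area S u (row i w)).
rewrite -[RHS](PhiI Pf _ _ x); congr (f (col_mx _ _)).
apply/row_matrixP => i; rewrite rowK tnth_map tnth_mktuple contractionE !formK /contr a1 scale1r.
rewrite [RHS]linearD -addrA; congr (_ + _); rewrite [x *m _]mul_row_col.
by apply/rowP => k; rewrite !mxE !big_ord1 !mxE.
Qed.
End Extension.

(** * Images of the duals of g *)

Section Image.
Variables (E : functor F2) (proj : ntrans LP2 E) (incl : ntrans E LP2) (c : F2).
Hypothesis inclK : forall V e, proj V (incl V e) = e.
Hypothesis proj_Pi : forall V a, proj V (Pi_app V a) = c *: proj V a.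
Hypothesis incl_proj : forall V (N : lmodType F2) (h : {linear LP2 V -> N}),
  (forall a, h (Pi_app V a) = c *: h a) -> forall a, h (incl V (proj V a)) = h a.
Variable n : nat.
Local Notation gE := (gE proj incl n).

Definition wedges d (u v : 'rV[F]_d) (w : 'M[F]_(n, d)) : LamLam3 n (W d) :=
  wedge (map_tuple (fun a => wedge3 (form u) (form v) a) (rforms w)).

Lemma evaln_image d (xi : dual (tensF E (LamLam3 n) (W d))) u v w :
  evaln proj (dual_map (gE (W d)) xi) (pt3 u v w) =
  dual_app xi (tens (proj _ (wedge2 [form u]p [form v]p)) (wedges u v w)).
Proof.
rewrite evaln_pt [LHS]dual_mapE (gE_proj proj_Pi incl_proj); congr (dual_app xi _).
by rewrite [X in tensF_ntrans _ _ _ X]g_appE [LHS]tensor_mapE.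
Qed.

Lemma wedge3Dr (M : lmodType F2) (u v a a' : M) : wedge3 u v (a + a') = wedge3 u v a + wedge3 u v a'.
Proof. exact: (linearD (mklin (wedge3_lin3 u v))). Qed.

Lemma rformsE d (w : 'M[F]_(n, d)) i : tnth (rforms w) i = form (row i w).
Proof. exact: tnth_mktuple. Qed.

Lemma wedgesI d (u v : 'rV[F]_d) (w : 'M[F]_(n, d)) (x : 'M_(n, 2)) :
  wedges u v (w + x *m (col_mx u v : 'M_(1 + 1, d))) = wedges u v w.
Proof.
apply: (congr1 (@wedge _ _ _)); apply: eq_from_tnth => i; rewrite [LHS]tnth_map [RHS]tnth_map !rformsE.
pose x' : 'M[F]_(n, 1 + 1) := x; pose a := lsubmx (row i x'); pose b := rsubmx (row i x').
have R : row i (w + x' *m col_mx u v) = row i w + (a *m u + b *m v).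
  by rewrite linearD /= row_mul -[row i x']hsubmxK mul_row_col.
have -> : row i (w + x *m (col_mx u v : 'M_(1 + 1, d))) = row i w + (a *m u + b *m v) := R.
rewrite !formD wedge3Dr wedge3Dr.
have K (q : 'M[F]_1) (z : 'rV[F]_d) : form (q *m z) = 0 \/ form (q *m z) = form z.
  by case: (M1_cases q) => ->; [left; rewrite mul0mx form0|right; rewrite mul1mx].
have z0 : wedge3 (form u : idF F2 (W d)) (form v) 0 = 0.
  exact: linear0 (mklin (wedge3_lin3 (form u : idF F2 (W d)) (form v))).
have zu : wedge3 (form u : idF F2 (W d)) (form v) (form u) = 0.
  by apply: (@wedge_alternating _ _ _ _ ord0 ord_max).
have zv : wedge3 (form u : idF F2 (W d)) (form v) (form v) = 0.
  by apply: (@wedge_alternating _ _ _ _ (lift ord0 ord0) ord_max).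
by case: (K a u) => ->; case: (K b v) => ->; rewrite ?z0 ?zu ?zv !addr0.
Qed.

Lemma wedgesC d (u v : 'rV[F]_d) (w : 'M[F]_(n, d)) : wedges v u w = wedges u v w.
Proof.
apply: (congr1 (@wedge _ _ _)); apply: eq_from_tnth => i; rewrite [LHS]tnth_map [RHS]tnth_map; exact: wedge3C.
Qed.
Lemma wedgesD d (u v : 'rV[F]_d) (w : 'M[F]_(n, d)) : wedges u (u + v) w = wedges u v w.
Proof.
apply: (congr1 (@wedge _ _ _)); apply: eq_from_tnth => i; rewrite [LHS]tnth_map [RHS]tnth_map formD.
by rewrite [LHS]wedge3Dm wedge3xx add0r.
Qed.

Lemma evaln_alt d (x : dualF (tensF E (Lam n)) (rowsp d)) b :
  Altc n d (fun w => evaln proj x (col_mx b w)).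
Proof.
pose b' : 'M[F]_(1 + 1, d) := b; have -> : b = (col_mx (usubmx b') (dsubmx b') : 'M_(1 + 1, d)) by rewrite vsubmxK.
move: (usubmx b') (dsubmx b') => u v {b b'}.
have R (w : 'M[F]_(n, d)) i e : rforms (rset w i e) = tset (rforms w) i (form e : idF F2 (W d)).
  by apply: eq_from_tnth => j; rewrite tnth_tset !rformsE row_rset; case: eqP.
split=> [w i e e'|w i j ij wij]; rewrite -!/(pt3 _ _ _) !evaln_pt.
  rewrite !R formD -[form e in LHS]scale1r.
  rewrite [wedge _ in LHS]wedge_multilinear scale1r.
  rewrite [tens _ (_ + _)](linearD (mklin (tens_linr _))).
  exact: linearD.
rewrite (_ : wedge (rforms w) = 0); first by rewrite [tens _ 0](linear0 (mklin (tens_linr _))) linear0.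
by apply: (wedge_alternating ij); rewrite !rformsE wij.
Qed.

Lemma evaln_Phi d (xi : dual (tensF E (LamLam3 n) (W d))) :
  Phi c n d (evaln proj (dual_map (gE (W d)) xi)).
Proof.
apply: (@Phi_intro c n d (LamLam3 n (W d))
  (fun y => dual_app xi \o mklin (tens_linl y) \o proj (W d)) (@wedges d)).
- move=> y a; rewrite -[LHS]/(dual_app xi (tens (proj (W d) (Pi_app (W d) a)) y)) proj_Pi.
  have T : tens (c *: proj (W d) a) y = c *: tens (proj (W d) a) y.
    exact: (linearZ_LR (mklin (tens_linl y))).
  by rewrite T; exact: linearZ_LR.
- by move=> u v w; exact: evaln_image.
- exact: evaln_alt.
- exact: wedgesI.
- exact: wedgesC.
- exact: wedgesD.
Qed.

(** The functional xi on E (x) Lambda^n(Lambda^3) sends e (x) y to the value at y of the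
    linear extension of chi, evaluated at e. *)
Lemma evaln_onto d f : Phi c n d f ->
  exists xi : dual (tensF E (LamLam3 n) (W d)), f = evaln proj (dual_map (gE (W d)) xi).
Proof.
move=> Pf; pose ex := extension Pf.
have ll y : linear (fun e : E (W d) => dual_app (ex (incl (W d) e)) y : F2^o).
  by move=> a e e'; rewrite !linearP.
have lr e : linear (fun y => dual_app (ex (incl (W d) e)) y : F2^o).
  by move=> a y y'; rewrite linearP.
exists (mkdual (tensor_lift ll lr)); apply/funext => p; rewrite (pt3P p) evaln_image.
rewrite [RHS]tensor_liftE.
rewrite (incl_proj (extension_Pi Pf)) extensionE.
exact: (esym (chi_wedge3 Pf _ _ _)).
Qed.

Let Im := imF (dualF_ntrans gE).
Definition eval_image d (x : subF Im (rowsp d)) : 'M[F]_(2 + n, d) -> F := evaln proj (val x).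

Theorem simple_image : simple_artinian 2 (subF Im).
Proof.
apply: (@simple_of_Phi _ c n eval_image).
- by move=> d x y; exact: evaln_D.
- by move=> d x x0; apply: val_inj; exact: (evaln_inj inclK x0).
- by move=> d d' g x; exact: evaln_nat.
- move=> d f; split=> [/evaln_onto[xi ->]|[x ->]].
    exists (exist _ (dualF_ntrans gE (rowsp d) xi) (mem_imF (dualF_ntrans gE) xi)).
    by [].
  by have /asboolP[xi Exi] := valP x; rewrite /eval_image -Exi; exact: evaln_Phi.
Qed.
End Image.

(** * The two factors of the exterior square *)

Lemma P21_incl V (e : P21 V) : projP21 V (sub_incl (imF Pi) V e) = e.
Proof.
apply: val_inj; have /asboolP[q Eq] := valP e.
rewrite -[LHS]/(Pi_app V (val e)) -Eq; exact: Pi_app_idem.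
Qed.
Lemma P21_Pi V a : projP21 V (Pi_app V a) = (1 : F2) *: projP21 V a.
Proof. by rewrite scale1r; apply: val_inj; exact: Pi_app_idem. Qed.
Lemma P21_proj V (N : lmodType F2) (h : {linear LP2 V -> N}) :
  (forall a, h (Pi_app V a) = (1 : F2) *: h a) ->
  forall a, h (sub_incl (imF Pi) V (projP21 V a)) = h a.
Proof. by move=> hPi a; rewrite -[RHS]scale1r -hPi. Qed.

Lemma Gbar2_incl V (e : Gbar2 V) : projGbar2 V (sub_incl (kerF Pi) V e) = e.
Proof.
apply: val_inj; have /eqP Ke := valP e.
by rewrite -[LHS]/(val e - Pi V (val e)) Ke subr0.
Qed.
Lemma Gbar2_Pi V a : projGbar2 V (Pi_app V a) = (0 : F2) *: projGbar2 V a.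
Proof.
rewrite scale0r; apply: val_inj.
by rewrite -[LHS]/(Pi_app V a - Pi_app V (Pi_app V a)) Pi_app_idem subrr.
Qed.
Lemma Gbar2_proj V (N : lmodType F2) (h : {linear LP2 V -> N}) :
  (forall a, h (Pi_app V a) = (0 : F2) *: h a) ->
  forall a, h (sub_incl (kerF Pi) V (projGbar2 V a)) = h a.
Proof.
move=> hPi a; rewrite -[X in h X]/(a - Pi_app V a) linearB hPi scale0r.
exact: subr0.
Qed.

Theorem mainTheorem3 (n : nat) :
  simple_artinian 2 (Lsup2 n) /\ simple_artinian 2 (Dsup2 n).
Proof.
case: n => [|n]; split.
- exact: (simple0 P21_incl P21_Pi P21_proj).
- exact: (simple0 Gbar2_incl Gbar2_Pi Gbar2_proj).
- exact: (@simple_image _ _ _ _ P21_incl P21_Pi P21_proj n.+1).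
- exact: (@simple_image _ _ _ _ Gbar2_incl Gbar2_Pi Gbar2_proj n.+1).
Qed.
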